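(* Let $\{w_i\}_{i=1}^n$ be a basis of $\mathbb{R}^n$ and let $(S_1,\dots,S_m)$ form a uniform cover of $[n]$ with weights $(p_1,\dots,p_m)$. Let $H_j=\mathrm{span}\{w_k : k\in S_j\}$, $\widetilde{H}_j=\mathrm{span}\{w_k : k\notin S_j\}$, $d_j=\dim H_j=|S_j|$, $\widetilde{d}_j=n-d_j=\dim\widetilde{H}_j$ and $p=\sum_{j=1}^m p_j$. Put $$BL_1:=\frac{\prod_{j=1}^m|\wedge_{k\in[n]\setminus S_j}w_k|^{p_j}}{|\wedge_{i=1}^n w_i|^{p-1}},\qquad BL_2:=\frac{\prod_{j=1}^m|\wedge_{k\in S_j}w_k|^{p_j}}{|\wedge_{i=1}^n w_i|}.$$ Then for every $f\in\mathcal{F}(\mathbb{R}^n)$ the following four inequalities hold: $$\Vert f\Vert_\infty^{p-1}\Vert f\Vert_1\leqslant BL_1\cdot\frac{n!}{\prod_{j=1}^m(d_j!)^{p_j}}\prod_{j=1}^m\Vert P_{\widetilde{H}_j^\perp}f\Vert_1^{p_j},$$ $$\Vert f\Vert_\infty\Vert f\Vert_1^{p-1}\leqslant BL_2\cdot\frac{(n!)^{p-1}}{\prod_{j=1}^m(\widetilde{d}_j!)^{p_j}}\prod_{j=1}^m\Vert P_{H_j^\perp}f\Vert_1^{p_j},$$ $$\Vert f\Vert_\infty^{p-1}\Vert f\Vert_1\leqslant BL_2\cdot\frac{n!}{\prod_{j=1}^m(d_j!)^{p_j}}\prod_{j=1}^m\Vert P_{H_j}f\Vert_1^{p_j},$$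 $$\Vert f\Vert_\infty\Vert f\Vert_1^{p-1}\leqslant BL_1\cdot\frac{(n!)^{p-1}}{\prod_{j=1}^m(\widetilde{d}_j!)^{p_j}}\prod_{j=1}^m\Vert P_{\widetilde{H}_j}f\Vert_1^{p_j}.$$
   Context: $[n]=\{1,\dots,n\}$. For $m\geqslant1$, subsets $S_1,\dots,S_m\subseteq[n]$ (not necessarily distinct) form a uniform cover of $[n]$ with weights $(p_1,\dots,p_m)$, $p_j>0$ for all $j$, if $\sum_{j=1}^m p_j\chi_{S_j}(i)=1$ for every $i\in[n]$. For vectors $u_1,\dots,u_k$, $|\wedge_{i=1}^k u_i|$ is the $k$-dimensional volume of the parallelepiped they span (equal to $1$ for the empty family). $\mathcal{F}(\mathbb{R}^n)$ is the set of integrable log-concave functions $f:\mathbb{R}^n\to[0,\infty)$, i.e. $f=e^{-v}$ with $v:\mathbb{R}^n\to(-\infty,\infty]$ convex. For a linear subspace $F$ of $\mathbb{R}^n$ with orthogonal complement $F^\perp$, $P_Ff(x)=\sup_{y\in F^\perp}f(x+y)$, $x\in F$. $\Vert f\Vert_\infty$ is the supremum of $f$; $\Vert f\Vert_1$ is the integral of $f$ over $\mathbb{R}^n$ and $\Vert P_Ff\Vert_1$ is the integral of $P_Ff$ over $F$ with respect to Lebesgue measure on $F$ (unit point mass on $\{0\}$). *)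

(* Defs.v *)
From HB Require Import structures.
From mathcomp Require Import all_boot all_order all_algebra.
From mathcomp Require Import all_classical all_reals all_analysis.

Set Implicit Arguments.
Unset Strict Implicit.
Unset Printing Implicit Defensive.

Import Order.TTheory GRing.Theory Num.Theory.

Local Open Scope classical_set_scope.
Local Open Scope ring_scope.

Lemma sigma_finite_measure_of d (T : measurableType d) (R : realType)
    (m : {measure set T -> \bar R}) : sigma_finite setT m ->
  exists mu : {sigma_finite_measure set T -> \bar R},
    m = mu :> (set T -> \bar R).
Proof.
move=> sf; have c : sfinite_measure m by exact: sfinite_measure_sigma_finite.
pose mS := @isSFinite.Build d T R m c.
pose mF := @isSigmaFinite.Build d T R m sf.
by exists (SigmaFiniteMeasure.Pack (@SigmaFiniteMeasure.Class d T R m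
  _ (Measure.class m) mS mF)).
Qed.

Lemma pushforward_product_sigma_finite d1 d2 d3 (T1 : measurableType d1)
    (T2 : measurableType d2) (T3 : measurableType d3) (R : realType)
    (m1 : {sigma_finite_measure set T1 -> \bar R})
    (m2 : {sigma_finite_measure set T2 -> \bar R})
    (f : T1 * T2 -> T3) (g : T3 -> T1 * T2) :
  measurable_fun setT f -> measurable_fun setT g -> cancel f g ->
  exists mu : {sigma_finite_measure set T3 -> \bar R},
    pushforward (m1 \x m2)%E f = mu.
Proof.
move=> mf mg fK.
pose m0 := [the {measure set T3 -> \bar R} of pushforward (m1 \x m2)%E f].
pose m := m0 mf.
have sfm : sigma_finite setT m.
  have [F [TF Foo]] : exists F : (set (T1 * T2))^nat, setT = \bigcup_k F k /\
      forall k, measurable (F k) /\ ((m1 \x m2) (F k) < +oo)%E.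
    have /sigma_finiteP[F [TF ndF Foo]] := sigma_finiteT m1.
    have /sigma_finiteP[G [TG ndG Goo]] := sigma_finiteT m2.
    exists (fun k => F k `*` G k); split.
      rewrite -setXTT TF TG predeqE => -[x y]; split.
        move=> [/= [i _ Fix] [k _ Gky]]; exists (maxn i k) => //; split.
        - by move: x Fix; exact/subsetPset/ndF/leq_maxl.
        - by move: y Gky; exact/subsetPset/ndG/leq_maxr.
      by move=> [i _ []/= ? ?]; split; exists i.
    move=> k; have [? ?] := Foo k; have [? ?] := Goo k.
    split; first exact: measurableX.
    by rewrite product_measure1E// lte_mul_pinfty// ge0_fin_numE.
  exists (fun k => g @^-1` F k).
    by rewrite -preimage_bigcup -TF preimage_setT.
  move=> k; have [mF Fk] := Foo k; split.
    by rewrite -[X in measurable X]setTI; exact: mg.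
  rewrite /m/= /pushforward -comp_preimage (_ : g \o f = id) ?preimage_id//.
  by apply/funext => z; exact: fK.
exact: sigma_finite_measure_of.
Qed.

Section lebesgue_measure_on_tuples.
Context {R : realType}.
Local Open Scope ereal_scope.

Definition tcons n (z : measurableTypeR R * n.-tuple (measurableTypeR R)) :
  n.+1.-tuple (measurableTypeR R) := [tuple of z.1 :: z.2].

(* For n = 0 this is the unit point mass on the one-point space. *)
Fixpoint lebesgue_tuple n : set (n.-tuple (measurableTypeR R)) -> \bar R :=
  match n with
  | 0 => dirac [tuple]
  | n'.+1 => pushforward (lebesgue_measure \x @lebesgue_tuple n') (@tcons n')
  end.

Lemma measurable_tcons n : measurable_fun setT (@tcons n).
Proof.
exact: (measurable_cons (@measurable_fst _ _ _ _) (@measurable_snd _ _ _ _)).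
Qed.

Arguments lebesgue_tuple : clear implicits.

Lemma lebesgue_tuple_measure n :
  exists mu : {sigma_finite_measure set (n.-tuple (measurableTypeR R)) -> \bar R},
    lebesgue_tuple n = mu.
Proof.
elim: n => [|n [mu muE]]; first by eexists; reflexivity.
rewrite /= muE; apply: (@pushforward_product_sigma_finite _ _ _ _ _ _ _ lebesgue_measure mu _
  (fun t => (thead t, [tuple of behead t]))).
- exact: measurable_tcons.
- apply: measurable_fun_pair; first exact: measurable_tnth.
  exact: measurable_behead.
- by case=> x t; congr pair; apply: val_inj.
Qed.

Let lebesgue_tuple0 n : lebesgue_tuple n set0 = 0.
Proof. by have [mu ->] := lebesgue_tuple_measure n; exact: measure0. Qed.

Let lebesgue_tuple_ge0 n A : 0 <= lebesgue_tuple n A.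
Proof. by have [mu ->] := lebesgue_tuple_measure n; exact: measure_ge0. Qed.

Let lebesgue_tuple_sigma_additive n : semi_sigma_additive (lebesgue_tuple n).
Proof.
have [mu ->] := lebesgue_tuple_measure n.
exact: measure_semi_sigma_additive.
Qed.

HB.instance Definition _ n := isMeasure.Build _ _ _ (lebesgue_tuple n)
  (@lebesgue_tuple0 n) (@lebesgue_tuple_ge0 n)
  (@lebesgue_tuple_sigma_additive n).

Let lebesgue_tuple_sigma_finite n : sigma_finite setT (lebesgue_tuple n).
Proof. by have [mu ->] := lebesgue_tuple_measure n; exact: sigma_finiteT. Qed.

HB.instance Definition _ n := Measure_isSigmaFinite.Build _ _ _
  (lebesgue_tuple n) (@lebesgue_tuple_sigma_finite n).

(* Together with sigma-finiteness, this characterizes the measure. *)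
Lemma lebesgue_tuple_box n (A : 'I_n -> set (measurableTypeR R)) :
  (forall i, measurable (A i)) ->
  lebesgue_tuple n [set t | forall i, A i (tnth t i)] =
  \prod_(i < n) lebesgue_measure (A i).
Proof.
elim: n A => [|n IH] A mA.
  by rewrite big_ord0 /= diracE mem_set// => -[].
rewrite big_ord_recl -IH//= /pushforward.
have [mu muE] := lebesgue_tuple_measure n; rewrite muE.
rewrite -(@product_measure1E _ _ _ _ _ lebesgue_measure mu) //; last first.
  rewrite (_ : [set t | _] = \bigcap_(i in [set: 'I_n])
    ((fun t => tnth t i) @^-1` A (lift ord0 i))); last first.
    by apply/seteqP; split=> t /= tA i; [move=> _|]; exact: tA.
  apply: fin_bigcap_measurable => // i _.
  by rewrite -[X in measurable X]setTI; apply: measurable_tnth.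
congr (_ _); apply/seteqP; split => -[x t] /=.
  by move=> xtA; split=> [|i]; [exact: (xtA ord0)|have := xtA (lift ord0 i); rewrite tnthS].
by move=> [xA tA] i; case: (unliftP ord0 i) => [j ->|-> //]; rewrite tnthS.
Qed.

End lebesgue_measure_on_tuples.
Arguments lebesgue_tuple {R} n _.

Section euclidean_geometry.
Context {R : realType} {n : nat}.
Implicit Types (x y : 'rV[R]_n) (F : {vspace 'rV[R]_n}).

Definition dotv x y : R := \sum_(i < n) x 0 i * y 0 i.

Lemma dotvC x y : dotv x y = dotv y x.
Proof. by apply: eq_bigr => i _; rewrite mulrC. Qed.

Lemma dotvDl x y z : dotv (x + y) z = dotv x z + dotv y z.
Proof. by rewrite -big_split; apply: eq_bigr => i _; rewrite mxE mulrDl. Qed.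

Lemma dotvZl a x y : dotv (a *: x) y = a * dotv x y.
Proof. by rewrite mulr_sumr; apply: eq_bigr => i _; rewrite mxE mulrA. Qed.

Lemma dotvBl x y z : dotv (x - y) z = dotv x z - dotv y z.
Proof. by rewrite -scaleN1r dotvDl dotvZl mulN1r. Qed.

Lemma dotv_suml k (x : 'I_k -> 'rV[R]_n) y :
  dotv (\sum_i x i) y = \sum_i dotv (x i) y.
Proof.
apply: (big_morph (dotv ^~ y)) => [u v|]; first exact: dotvDl.
by rewrite -(scale0r 0) dotvZl mul0r.
Qed.

Lemma dotv_gt0 x : x != 0 -> 0 < dotv x x.
Proof.
move=> x0; rewrite lt_def sumr_ge0 ?andbT => [|i _]; last exact: sqr_ge0.
apply: contraNneq x0 => /eqP.
rewrite psumr_eq0 => [/allP x0|i _]; last exact: sqr_ge0.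
apply/eqP/rowP => i; rewrite mxE; apply/eqP.
by have := x0 i (mem_index_enum i); rewrite mulf_eq0 orbb.
Qed.

Definition orthonormal k (b : k.-tuple 'rV[R]_n) : Prop :=
  forall i j, dotv (tnth b i) (tnth b j) = (i == j)%:R.

Lemma exists_orthonormal_span (s : seq 'rV[R]_n) : free s ->
  exists2 b : (size s).-tuple 'rV[R]_n, orthonormal b & (<< b >> = << s >>)%VS.
Proof.
elim: s => [_|x s IH]; first by exists [tuple] => // -[].
rewrite free_cons => /andP[xs /IH[b bO bs]].
pose y := x - \sum_(i < size s) dotv x (tnth b i) *: tnth b i.
have inb i : tnth b i \in << b >>%VS by exact/memv_span/mem_tnth.
have bsum : \sum_(i < size s) dotv x (tnth b i) *: tnth b i \in << b >>%VS.
  by apply: memv_suml => i _; exact: memvZ.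
have y0 : y != 0.
  by apply: contraNneq xs => /eqP; rewrite subr_eq0 -bs => /eqP ->.
have yb i : dotv y (tnth b i) = 0.
  rewrite dotvBl dotv_suml (bigD1 i)//= dotvZl bO eqxx mulr1 big1 ?addr0 ?subrr//.
  by move=> j /negPf ji; rewrite dotvZl bO ji mulr0.
pose r := (Num.sqrt (dotv y y))^-1.
have r0 : r != 0 by rewrite invr_eq0 gt_eqF// sqrtr_gt0 dotv_gt0.
exists [tuple of r *: y :: b] => [i j|].
  case: (unliftP ord0 i) => [i' ->|->]; case: (unliftP ord0 j) => [j' ->|->];
    rewrite ?tnthS ?tnth0.
  - by rewrite bO (inj_eq lift_inj).
  - by rewrite dotvC dotvZl yb mulr0.
  - by rewrite dotvZl yb mulr0.
  - rewrite dotvZl dotvC dotvZl mulrA -expr2 exprVn sqr_sqrtr ?ltW ?dotv_gt0//.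
    by rewrite mulVf// gt_eqF// dotv_gt0.
rewrite !span_cons -bs; apply/eqP; rewrite eqEsubv; apply/andP; split.
  rewrite subv_add addvSr andbT -memvE memvZ//.
  by apply: memvB; [exact/(subvP (addvSl _ _))/memv_line|exact: (subvP (addvSr _ _))].
rewrite subv_add addvSr andbT -memvE.
have xE : x = r^-1 *: (r *: y) +
    \sum_(i < size s) dotv x (tnth b i) *: tnth b i.
  by rewrite scalerA mulVf// scale1r subrK.
by rewrite [in X in X \in _]xE memv_add// memvZ// memv_line.
Qed.

Lemma exists_orthonormal_basis F :
  exists b : (\dim F).-tuple 'rV[R]_n, basis_of F b /\ orthonormal b.
Proof.
have [b bO bF] := exists_orthonormal_span (basis_free (vbasisP F)).
have sz : size (vbasis F) = \dim F by rewrite size_tuple.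
exists (tcast sz b); split; last first.
  by move=> i j; rewrite !tcastE bO (inj_eq (@cast_ord_inj _ _ _)).
by rewrite basisEdim (eq_leq (size_tuple _)) andbT val_tcast bF
  (span_basis (vbasisP F)).
Qed.

Definition orthonormal_basis F : (\dim F).-tuple 'rV[R]_n :=
  sval (cid (exists_orthonormal_basis F)).

Lemma orthonormal_basisP F :
  basis_of F (orthonormal_basis F) /\ orthonormal (orthonormal_basis F).
Proof. exact: svalP (cid (exists_orthonormal_basis F)). Qed.

Definition orthogonal_complement F : {vspace 'rV[R]_n} :=
  (\bigcap_(i < \dim F)
     lker (linfun (mulmxr (tnth (vbasis F) i)^T : 'rV_n -> 'rV_1)))%VS.

Lemma orthogonal_complementP F y :
  reflect (forall x, x \in F -> dotv x y = 0) (y \in orthogonal_complement F).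
Proof.
have lkerE u : (y \in lker (linfun (mulmxr u^T : 'rV_n -> 'rV_1))) =
    (dotv u y == 0).
  rewrite memv_ker lfunE /= dotvC.
  have -> : y *m u^T = (dotv y u)%:M.
    by apply/rowP => i; rewrite !mxE ord1 eqxx mulr1n; apply: eq_bigr => k _; rewrite mxE.
  by apply/eqP/eqP => [/matrixP/(_ 0 0)|->]; rewrite ?mxE//= ?scalemx1 ?scale0r ?eqxx ?mulr1n// raddf0.
rewrite memvE; apply: (iffP subv_bigcapP) => [yF x /coord_vbasis ->|yF i _].
  rewrite dotv_suml big1// => i _; rewrite dotvZl.
  have := yF i isT; rewrite -memvE lkerE => /eqP.
  by rewrite (tnth_nth 0) => ->; rewrite mulr0.
by rewrite -memvE lkerE yF// vbasis_mem// mem_tnth.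
Qed.

End euclidean_geometry.

(* A log-concave function, and likewise its projections below, need not be   *)
(* Borel measurable, but it agrees with a Borel function outside a Lebesgue  *)
(* null set.  The integral of a nonnegative function is the supremum of the  *)
(* integrals of the Borel simple functions below it, which for such a        *)
(* function is its integral for the completed Lebesgue measure.  So no       *)
(* measurability condition is needed for integrability.                      *)
Section functions.
Context {R : realType} {n : nat}.
Implicit Types (f : 'rV[R]_n -> R) (F : {vspace 'rV[R]_n}).

Definition row_of_tuple (t : n.-tuple (measurableTypeR R)) : 'rV[R]_n :=
  \row_i tnth t i.

Definition norm1 f : \bar R :=
  (\int[lebesgue_tuple n]_t (f (row_of_tuple t))%:E)%E.

Definition norm_sup f : \bar R := ereal_sup [set (f x)%:E | x in setT].

Definition extended_convex (v : 'rV[R]_n -> \bar R) : Prop :=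
  (forall x, v x != -oo%E) /\
  forall (a : R) (x y : 'rV[R]_n), 0 <= a <= 1 ->
    (v (a *: x + (1 - a) *: y)%R <= a%:E * v x + (1 - a)%:E * v y)%E.

Definition log_concave f : Prop :=
  exists2 v, extended_convex v & forall x, (f x)%:E = expeR (- v x)%E.

Definition integrable_log_concave f : Prop :=
  log_concave f /\ (norm1 f < +oo)%E.

Definition subspace_point F (t : (\dim F).-tuple (measurableTypeR R)) :
  'rV[R]_n := \sum_(i < \dim F) tnth t i *: tnth (orthonormal_basis F) i.

(* Lebesgue measure on F is the image of Lebesgue measure on R^(dim F) under *)
(* the linear isometry given by an orthonormal basis of F.                   *)
Definition subspace_volume F (A : set 'rV[R]_n) : \bar R :=
  lebesgue_tuple (\dim F) (@subspace_point F @^-1` A).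

Definition subspace_norm1 F (g : 'rV[R]_n -> \bar R) : \bar R :=
  (\int[lebesgue_tuple (\dim F)]_t g (subspace_point t))%E.

(* Only its values on F are used. *)
Definition sup_projection F f (x : 'rV[R]_n) : \bar R :=
  ereal_sup [set (f (x + y))%:E | y in [set y | y \in orthogonal_complement F]].

Definition parallelepiped (u : seq 'rV[R]_n) : set 'rV[R]_n :=
  [set x | exists2 c : 'I_(size u) -> R, forall i, 0 <= c i <= 1 &
    x = \sum_(i < size u) c i *: u`_i].

(* The (size u)-dimensional volume; a linearly dependent family spans a      *)
(* parallelepiped of smaller dimension.                                      *)
Definition wedge_norm (u : seq 'rV[R]_n) : R :=
  if free u then fine (subspace_volume << u >>%VS (parallelepiped u)) else 0.

Definition subfamily (w : n.-tuple 'rV[R]_n) (A : {set 'I_n}) :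
  seq 'rV[R]_n := [seq tnth w k | k <- enum A].

End functions.

Section uniform_cover.
Context {R : realType} {n m : nat}.
Implicit Types (w : n.-tuple 'rV[R]_n) (S : 'I_m -> {set 'I_n}) (p : 'I_m -> R).

Definition uniform_cover S p : Prop :=
  [/\ (0 < m)%N, forall j, 0 < p j &
    forall i, \sum_(j < m) p j * (i \in S j)%:R = 1].

Definition BL1 w S p : R :=
  (\prod_(j < m) wedge_norm (subfamily w (~: S j)) `^ p j) /
  wedge_norm w `^ (\sum_(j < m) p j - 1).

Definition BL2 w S p : R :=
  (\prod_(j < m) wedge_norm (subfamily w (S j)) `^ p j) / wedge_norm w.

End uniform_cover.

(* Main.v *)
Require Import Defs.
From mathcomp Require Import all_boot all_order all_algebra.
From mathcomp Require Import all_classical all_reals all_analysis.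
From mathcomp Require Import measurable_realfun ring lra.

(** Let [p] be the sum of the weights.  All four inequalities follow from one
    inequality in coordinates.  For [g] log-concave on R^n with supremum [M]
    and [S] a set of coordinates, let [g_S] be the function on R^S obtained by
    taking suprema over the other coordinates; then, with [d_j = #|S_j|],

      M^(p-1) * int g  <=  n! / prod_j (d_j!)^(p_j) * prod_j (int g_(S_j))^(p_j)

    ([coordinate_inequality]).  It is proved on the level sets.  The set
    [g > M r] is contained in the cylinder over [g_S > M r] for every [S], so
    that Finner's inequality ([finner]), the weighted form of the inequality of
    Loomis and Whitney, bounds its volume by [prod_j u_j(r)^(p_j)], where
    [u_j(r)] is the volume of [g_(S_j) > M r].  Integrating over [r] in ]0, 1[
    gives [int g / M] on the left ([layer_cake]), and likewise [int u_j] is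
    [int g_(S_j) / M].  It remains to bound the integral of
    [prod_j u_j^(p_j)] by the product of the [(int u_j)^(p_j)].  For [p > 1]
    this fails for arbitrary functions, but the [u_j] are special: if [r <= s]
    and [s = r^q], then contracting [g_S > M r] by the ratio [q = ln s / ln r]
    towards a point where [g] is almost [M] maps it into [g_S > M s], so that
    [u_j(r) / (- ln r)^(d_j)] is nondecreasing ([level_volume_star]).  This
    simple consequence of log-concavity takes the place of the
    Brunn-Minkowski inequality.  It is the hypothesis of Berwald's inequality
    ([berwald]): among the nonincreasing functions with this property and a
    given integral, the multiple of [(- ln r)^d] has the largest integral of
    the power [n/d].  The inequality between arithmetic and geometric means
    with the weights [p_j d_j / n], whose sum is 1, reduces the product to
    these powers ([berwald_product]); the factorials are the moments of
    [- ln r] ([integral_neg_log]).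

    To pass from coordinates to the basis [w], let [W] be the matrix with rows
    [w_i].  For [g(c) = f(c W)], the projection of [f] along the span of the
    [w_k], [k] outside [S], is [g_S] in suitable coordinates; for
    [g(c) = f(c W^-T)], where the rows of [W^-T] form the dual basis, it is the
    projection of [f] onto the span of the [w_k], [k] in [S].  The Jacobians
    are volumes of parallelepipeds ([projection_orthogonal_bound],
    [projection_span_bound]), and they combine to the constants BL1 and BL2.
    This proves the first and the third inequality.  If [p > 1], the
    complements of the [S_j] with the weights [p_j / (p - 1)] form a uniform
    cover too; the first and the third inequality for this cover, raised to the
    power [p - 1], are the second and the fourth one for the given cover.  If
    [p <= 1], every [S_j] is the full set of coordinates, and these two
    inequalities reduce to an estimate between powers of the two norms of [f].

    Suprema over uncountable families need not be Borel functions.  Instead of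
    [g_S] the proof uses the function [envelope g S] below it, which is
    built from the open boxes on which [g] exceeds a constant and hence is
    Borel.  Nothing is lost when [S] is the full set: a convex set of positive
    volume has interior points ([convex_has_cube]), and by contracting towards
    such a point one finds that the envelope has the same integral as [g]
    ([row_integral_le_envelope]). *)

Import Order.TTheory GRing.Theory Num.Theory.
Import numFieldNormedType.Exports.
Local Open Scope classical_set_scope.
Local Open Scope ring_scope.

Set Implicit Arguments.
Unset Strict Implicit.
Unset Printing Implicit Defensive.

(** * Integration over row vectors *)

Lemma measurable_fun_natr_bool d (T : measurableType d) (R : realType)
    (f : T -> bool) :
  measurable_fun setT f -> measurable_fun setT (fun x => (f x)%:R : R).
Proof.
move=> mf; rewrite (_ : (fun x => _) = \1_(f @^-1` [set true])).
  by apply: measurable_indic; rewrite -[X in measurable X]setTI; exact: mf.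
apply/funext => x; rewrite indicE; congr ((nat_of_bool _)%:R).
by apply/idP/idP; rewrite inE.
Qed.

Section row_integral.
Context {R : realType}.
Local Notation leb := (@lebesgue_measure R).

Definition measurable_row n (h : 'rV[R]_n -> \bar R) :=
  measurable_fun [set: n.-tuple (measurableTypeR R)]
    (fun t => h (row_of_tuple t)).

(** For an arbitrary nonnegative [h] this is the supremum of the integrals of the
    Borel simple functions below [h]. *)
Definition row_integral n (h : 'rV[R]_n -> \bar R) : \bar R :=
  (\int[lebesgue_tuple n]_t h (row_of_tuple t))%E.

Definition tuple_of_row n (v : 'rV[R]_n) : n.-tuple (measurableTypeR R) :=
  [tuple v 0 i | i < n].

Lemma tuple_of_rowK n : cancel (@tuple_of_row n) row_of_tuple.
Proof. by move=> v; apply/rowP => i; rewrite mxE tnth_mktuple. Qed.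

Lemma row_of_tupleK n : cancel (@row_of_tuple R n) (@tuple_of_row n).
Proof. by move=> t; apply: eq_from_tnth => i; rewrite tnth_mktuple mxE. Qed.

Lemma measurable_fun_row_of_tuple d (T : measurableType d) m (h : 'rV[R]_m -> \bar R)
    (phi : T -> 'rV[R]_m) :
  measurable_row h ->
  (forall i, measurable_fun [set: T]
     (fun t => phi t 0 i : measurableTypeR R)) ->
  measurable_fun [set: T] (h \o phi).
Proof.
move=> mh mphi.
rewrite (_ : _ \o _ = (h \o row_of_tuple) \o (fun t => tuple_of_row (phi t))).
  apply: measurableT_comp => //; apply/measurable_fun_tnthP => i.
  by apply: eq_measurable_fun (mphi i) => t _; rewrite /= tnth_mktuple.
by apply/funext => t /=; rewrite tuple_of_rowK.
Qed.

Lemma measurable_coord n (i : 'I_n) :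
  measurable_fun [set: n.-tuple (measurableTypeR R)]
    (fun t => row_of_tuple t 0 i : measurableTypeR R).
Proof.
by apply: eq_measurable_fun (measurable_tnth i) => t _; rewrite /= mxE.
Qed.

Lemma measurable_row_comp n m (h : 'rV[R]_m -> \bar R) (phi : 'rV[R]_n -> 'rV[R]_m) :
  measurable_row h ->
  (forall i, measurable_fun [set: n.-tuple (measurableTypeR R)]
     (fun t => phi (row_of_tuple t) 0 i : measurableTypeR R)) ->
  measurable_row (h \o phi).
Proof.
exact: (measurable_fun_row_of_tuple (phi := fun t => phi (row_of_tuple t))).
Qed.

Lemma row_integral0 (h : 'rV[R]_0 -> \bar R) : row_integral h = h 0.
Proof.
rewrite /row_integral /= (_ : (fun t : 0.-tuple _ => _) = cst (h 0)).
  by rewrite integral_dirac// diracT mul1e.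
by apply/funext => t; congr h; apply/rowP => -[].
Qed.

Lemma row_of_tuple_tcons n (x : measurableTypeR R) (t : n.-tuple (measurableTypeR R)) :
  @row_of_tuple R (1 + n) (tcons (x, t)) = row_mx (x%:M : 'rV_1) (row_of_tuple t).
Proof.
apply/rowP => i; rewrite [LHS]mxE; case: (split_ordP (i : 'I_(1 + n))) => j ->.
  by rewrite row_mxEl mxE ord1 eqxx mulr1n (tnth_nth x).
by rewrite row_mxEr mxE !(tnth_nth x).
Qed.

Lemma measurable_row_cons n (h : 'rV[R]_(1 + n) -> \bar R) (x : R) :
  measurable_row h -> measurable_row (fun v : 'rV_n => h (row_mx x%:M v)).
Proof.
move=> mh; apply: (measurable_row_comp (phi := fun v : 'rV_n => row_mx x%:M v)) => // i.
case: (split_ordP i) => j ->.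
  by under eq_fun do rewrite row_mxEl; exact: measurable_cst.
by under eq_fun do rewrite row_mxEr; exact: measurable_coord.
Qed.

Section cons.
Context n (h : 'rV[R]_(1 + n) -> \bar R).
Hypotheses (mh : measurable_row h) (h0 : forall v, (0 <= h v)%E).

Let hz (z : measurableTypeR R * n.-tuple (measurableTypeR R)) :=
  h (row_mx (z.1%:M : 'rV_1) (row_of_tuple z.2)).

Let mh2 : measurable_fun setT hz.
Proof.
pose phi (z : measurableTypeR R * n.-tuple (measurableTypeR R)) : 'rV_(1 + n) :=
  row_mx (z.1%:M : 'rV_1) (row_of_tuple z.2).
apply: (measurable_fun_row_of_tuple (phi := phi) mh) => i.
case: (split_ordP i) => j ->.
  by under eq_fun do rewrite row_mxEl mxE ord1 eqxx mulr1n; exact: measurable_fst.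
under eq_fun do rewrite row_mxEr.
by apply: (measurableT_comp (measurable_coord j)); exact: measurable_snd.
Qed.

Let hz0 z : (0 <= hz z)%E. Proof. exact: h0. Qed.

Lemma row_integral_cons : row_integral h =
  (\int[leb]_x row_integral (fun v : 'rV_n => h (row_mx x%:M v)))%E.
Proof.
have [mu muE] := lebesgue_tuple_measure (R := R) n.
rewrite /row_integral /= ge0_integral_pushforward//; last exact: measurable_tcons.
rewrite /= muE.
rewrite preimage_setT -[RHS](fubini_tonelli1 hz mh2 hz0)//.
by apply: eq_integral => -[x t] _; congr h; exact: row_of_tuple_tcons.
Qed.

Lemma measurable_row_integral_cons : measurable_fun [set: measurableTypeR R]
  (fun x => row_integral (fun v : 'rV_n => h (row_mx x%:M v))).
Proof.
have [mu muE] := lebesgue_tuple_measure (R := R) n.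
rewrite /row_integral muE.
exact: (measurable_fun_fubini_tonelli_F (m2 := mu) hz mh2 hz0).
Qed.

Lemma row_integral_cons_swap : row_integral h =
  row_integral (fun v : 'rV_n => \int[leb]_x h (row_mx x%:M v))%E.
Proof.
rewrite row_integral_cons /row_integral.
have [mu muE] := lebesgue_tuple_measure (R := R) n; rewrite muE.
exact: (fubini_tonelli hz mh2 hz0).
Qed.

Lemma measurable_row_integral_cons' :
  measurable_row (fun v : 'rV_n => \int[leb]_x h (row_mx x%:M v))%E.
Proof.
exact: (measurable_fun_fubini_tonelli_G (m1 := leb) hz mh2 hz0).
Qed.

End cons.

End row_integral.

(** * Linear changes of variables *)

Section affine_line.
Context {R : realType}.
Local Notation leb := (@lebesgue_measure R).

Lemma measurable_affine (a b : R) :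
  measurable_fun [set: measurableTypeR R]
    (fun x : measurableTypeR R => a * x + b : measurableTypeR R).
Proof. exact: measurable_funD. Qed.

(** The right-hand side is a measure in [A], and it agrees with the left-hand
    side on intervals. *)
Lemma lebesgue_measure_affine (a b : R) (A : set (measurableTypeR R)) :
  a != 0 -> measurable A ->
  leb A = (`|a|%:E * leb ((fun x => a * x + b)%R @^-1` A))%E.
Proof.
move=> a0 mA.
pose m0 := [the {measure set measurableTypeR R -> \bar R} of
  pushforward leb (fun x : measurableTypeR R => a * x + b : measurableTypeR R)].
pose m := [the {measure set measurableTypeR R -> \bar R} of
  mscale (NngNum (normr_ge0 a)) (m0 (measurable_affine a b))].
rewrite -[RHS]/(m A); apply: lebesgue_measure_unique => // _ [[c d] _ <-].
have -> : m `]c, d]%classic =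
  (`|a|%:E * leb ((fun x => a * x + b)%R @^-1` `]c, d]))%E by [].
have [alt0|agt0|/eqP] := ltgtP a 0; last by rewrite (negPf a0).
- rewrite (_ : _ @^-1` _ = `[(d - b) / a, (c - b) / a[%classic); last first.
    apply/seteqP; split => x /=; rewrite !in_itv /= ler_ndivrMr// ltr_ndivlMr//;
      rewrite mulrC => /andP[h1 h2]; apply/andP; split; lra.
  rewrite !lebesgue_measure_itv /= !lte_fin ltr_ndivrMr// divfK// ltrBlDr subrK.
  case: ifPn => // cd; last by rewrite mule0.
  rewrite -EFinB -EFinB -EFinM ltr0_norm//; by congr EFin; field.
- rewrite (_ : _ @^-1` _ = `](c - b) / a, (d - b) / a]%classic); last first.
    apply/seteqP; split => x /=; rewrite !in_itv /= ltr_pdivrMr// ler_pdivlMr//;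
      rewrite mulrC => /andP[h1 h2]; apply/andP; split; lra.
  rewrite !lebesgue_measure_itv /= !lte_fin ltr_pdivrMr// divfK// ltrBlDr subrK.
  case: ifPn => // cd; last by rewrite mule0.
  rewrite -EFinB -EFinB -EFinM gtr0_norm//; by congr EFin; field.
Qed.

Lemma ge0_integral_affine (a b : R) (f : R -> \bar R) :
  a != 0 -> measurable_fun [set: measurableTypeR R] f ->
  (forall x, 0 <= f x)%E ->
  (\int[leb]_x f x = `|a|%:E * \int[leb]_x f (a * x + b)%R)%E.
Proof.
move=> a0 mf f0.
pose m0 := [the {measure set measurableTypeR R -> \bar R} of
  pushforward leb (fun x : measurableTypeR R => a * x + b : measurableTypeR R)].
pose m := [the {measure set measurableTypeR R -> \bar R} of
  mscale (NngNum (normr_ge0 a)) (m0 (measurable_affine a b))].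
rewrite (eq_measure_integral m); last first.
  by move=> A mA _; exact: lebesgue_measure_affine.
rewrite ge0_integral_mscale//=; congr (_ * _)%E.
rewrite ge0_integral_pushforward//; exact: measurable_affine.
Qed.

Lemma ge0_integral_shift (b : R) (f : R -> \bar R) :
  measurable_fun [set: measurableTypeR R] f -> (forall x, 0 <= f x)%E ->
  (\int[leb]_x f (x + b)%R = \int[leb]_x f x)%E.
Proof.
move=> mf f0; rewrite [RHS](ge0_integral_affine b (oner_neq0 _) mf f0).
by rewrite normr1 mul1e; under [RHS]eq_integral do rewrite mul1r.
Qed.

End affine_line.

(** Both integrals are suprema over the simple functions below the integrand, and
    every simple function below [f] is below [g]. *)
Lemma ge0_le_integralT d (T : measurableType d) (R : realType)
    (mu : {measure set T -> \bar R}) (f g : T -> \bar R) :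
  (forall x, 0 <= f x)%E -> (forall x, f x <= g x)%E ->
  (\int[mu]_x f x <= \int[mu]_x g x)%E.
Proof.
move=> f0 fg; rewrite !ge0_integralTE//; last first.
  by move=> x; exact: le_trans (fg x).
apply: le_ereal_sup => _ [h hf <-]; exists h => // x.
exact: le_trans (hf x) (fg x).
Qed.

Section linear_change_of_variables.
Context {R : realType}.
Local Notation leb := (@lebesgue_measure R).

Lemma row_integral_ge0 n (h : 'rV[R]_n -> \bar R) :
  (forall v, 0 <= h v)%E -> (0 <= row_integral h)%E.
Proof. by move=> h0; apply: integral_ge0. Qed.

Lemma le_row_integral n (g h : 'rV[R]_n -> \bar R) :
  (forall v, 0 <= g v)%E -> (forall v, g v <= h v)%E ->
  (row_integral g <= row_integral h)%E.
Proof. by move=> g0 gh; apply: ge0_le_integralT. Qed.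

Lemma eq_row_integral n (g h : 'rV[R]_n -> \bar R) :
  g =1 h -> row_integral g = row_integral h.
Proof. by move=> gh; apply: eq_integral => t _; exact: gh. Qed.

Lemma row_integralZl n (k : R) (h : 'rV[R]_n -> \bar R) :
  0 <= k -> measurable_row h -> (forall v, 0 <= h v)%E ->
  row_integral (fun v => k%:E * h v)%E = (k%:E * row_integral h)%E.
Proof. by move=> k0 mh h0; apply: ge0_integralZl_EFin. Qed.

Lemma measurable_row_affine n m (A : 'M[R]_(n, m)) (w : 'rV[R]_m) h :
  measurable_row h -> measurable_row (fun v : 'rV_n => h (v *m A + w)).
Proof.
move=> mh; apply: (measurable_row_comp (phi := fun v : 'rV_n => v *m A + w) mh) => i.
under eq_fun do rewrite mxE [X in X + _]mxE.
apply: measurable_funD => //; apply: measurable_sum => j.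
apply: measurable_funM => //; exact: measurable_coord.
Qed.

Lemma measurable_row_mulmx n m (A : 'M[R]_(n, m)) h :
  measurable_row h -> measurable_row (fun v : 'rV_n => h (v *m A)).
Proof.
by move=> mh; have := measurable_row_affine A 0 mh; under eq_fun do rewrite addr0.
Qed.

Lemma measurable_row_shift n (w : 'rV[R]_n) h :
  measurable_row h -> measurable_row (fun v : 'rV_n => h (v + w)).
Proof.
by move=> mh; have := measurable_row_affine 1%:M w mh;
  under eq_fun do rewrite mulmx1.
Qed.

Lemma measurable_row_fst n (h : 'rV[R]_(1 + n) -> \bar R) (v : 'rV_n) :
  measurable_row h ->
  measurable_fun [set: measurableTypeR R] (fun x => h (row_mx x%:M v)).
Proof.
move=> mh.
apply: (measurable_fun_row_of_tuple
  (phi := fun x : measurableTypeR R => row_mx (x%:M : 'rV_1) v) mh) => i.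
case: (split_ordP i) => j ->.
  by under eq_fun do rewrite row_mxEl mxE ord1 eqxx mulr1n; exact: measurable_id.
by under eq_fun do rewrite row_mxEr; exact: measurable_cst.
Qed.

Lemma row_integral_shift n (w : 'rV[R]_n) h :
  measurable_row h -> (forall v, 0 <= h v)%E ->
  row_integral (fun v => h (v + w)) = row_integral h.
Proof.
elim: n w h => [|n IH] w h mh h0.
  by rewrite !row_integral0; congr h; apply/rowP => -[].
rewrite [LHS](row_integral_cons (n := n) (measurable_row_shift w mh) (fun v => h0 _)).
rewrite [RHS](row_integral_cons mh h0).
rewrite -[w](@hsubmxK _ 1 1 n).
have w0 : lsubmx (w : 'rV_(1 + n)) = (lsubmx (w : 'rV_(1 + n)) 0 0)%:M.
  by apply/rowP => i; rewrite [RHS]mxE ord1 eqxx mulr1n.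
rewrite -[RHS](ge0_integral_shift (lsubmx (w : 'rV_(1 + n)) 0 0)); first last.
- by move=> x; exact: row_integral_ge0.
- exact: (measurable_row_integral_cons mh).
apply: eq_integral => x _ /=.
rewrite -(IH (rsubmx (w : 'rV_(1 + n))) (fun v => h (row_mx (x + _)%:M v)))//; last first.
  exact: measurable_row_cons.
apply: eq_row_integral => v; congr h.
by rewrite [LHS](@add_row_mx _ 1 1 n) {1}w0 -raddfD.
Qed.

Definition scales_volume n (A : 'M[R]_n) := forall h : 'rV[R]_n -> \bar R,
  measurable_row h -> (forall v, 0 <= h v)%E ->
  row_integral h = (`|\det A|%:E * row_integral (fun v => h (v *m A)))%E.

Lemma scales_volume_mul n (A B : 'M[R]_n) :
  scales_volume A -> scales_volume B -> scales_volume (A *m B).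
Proof.
move=> sA sB h mh h0; rewrite sB// sA//; last exact: measurable_row_mulmx.
rewrite det_mulmx normrM mulrC EFinM muleA; congr (_ * _)%E.
by apply: eq_row_integral => v; rewrite mulmxA.
Qed.

Lemma scales_volume_lblock n (a : R) (c : 'cV[R]_n) (D : 'M[R]_n) :
  a != 0 -> scales_volume D -> scales_volume (block_mx a%:M 0 c D : 'M[R]_(1 + n)).
Proof.
move=> a0 sD h mh h0.
rewrite (row_integral_cons_swap mh)// sD; first last.
- by move=> v; exact: integral_ge0.
- exact: (measurable_row_integral_cons' mh).
rewrite (row_integral_cons_swap (measurable_row_mulmx _ mh) (fun v => h0 _)).
rewrite (@det_lblock _ 1 n) det_scalar1 normrM mulrC EFinM -muleA; congr (_ * _)%E.
rewrite -row_integralZl//; last 2 first.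
- apply: (measurable_row_integral_cons' (measurable_row_mulmx (block_mx a%:M 0 c D) mh)) => v.
  exact: h0.
- by move=> v; exact: integral_ge0.
apply: eq_row_integral => v.
rewrite (ge0_integral_affine ((v *m c) 0 0) a0)//; last exact: measurable_row_fst.
congr (_ * _)%E; apply: eq_integral => x _; congr h.
rewrite mul_row_block mulmx0 add0r; congr row_mx.
by rewrite -scalar_mxM mulrC raddfD /= -mx11_scalar.
Qed.

Lemma scales_volume_ublock n (a : R) (b : 'rV[R]_n) (D : 'M[R]_n) :
  a != 0 -> scales_volume D -> scales_volume (block_mx a%:M b 0 D : 'M[R]_(1 + n)).
Proof.
move=> a0 sD h mh h0.
rewrite (row_integral_cons mh)// (ge0_integral_affine 0 a0); last 2 first.
- exact: (measurable_row_integral_cons mh).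
- by move=> x; exact: row_integral_ge0.
rewrite (row_integral_cons (measurable_row_mulmx _ mh) (fun v => h0 _)).
rewrite (@det_ublock _ 1 n) det_scalar1 normrM EFinM -muleA; congr (_ * _)%E.
rewrite -ge0_integralZl_EFin//; last 2 first.
- by move=> x _; exact: row_integral_ge0.
- apply: (measurable_row_integral_cons (measurable_row_mulmx (block_mx a%:M b 0 D) mh)) => v.
  exact: h0.
apply: eq_integral => x _.
have mk := measurable_row_cons (a * x + 0) mh.
rewrite -(row_integral_shift (x *: b) mk)// sD//; last first.
  exact: measurable_row_shift mk.
congr (_ * _)%E; apply: eq_row_integral => v; congr h.
by rewrite mul_row_block mulmx0 !addr0 -scalar_mxM mulrC mul_scalar_mx addrC.
Qed.

(** Gaussian elimination.  A matrix with a nonzero corner is the product of a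
    lower and an upper block triangular matrix, by the Schur complement, for
    which Tonelli's theorem peels off one coordinate.  Otherwise some row has a
    nonzero entry in the first column, and adding it to the first row makes the
    corner nonzero. *)
Lemma scales_volume_unit n (A : 'M[R]_n) : A \in unitmx -> scales_volume A.
Proof.
elim: n A => [A _ h mh h0|n IH A].
  rewrite !row_integral0 det_mx00 normr1 mul1e; congr h.
  by apply/rowP => -[].
have step (B : 'M[R]_(1 + n)) : B \in unitmx -> B 0 0 != 0 -> scales_volume B.
  move=> uB B00.
  pose a := B 0 0; pose b := ursubmx B; pose c := dlsubmx B; pose D := drsubmx B.
  have aE : ulsubmx B = a%:M.
    by rewrite [LHS]mx11_scalar !mxE; congr (B _ _)%:M; apply: val_inj.
  have BE : B = block_mx 1%:M 0 (a^-1 *: c) 1%:M *m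
                block_mx a%:M b 0 (D - a^-1 *: c *m b).
    rewrite mulmx_block !mul1mx !mul0mx !addr0 -scalemxAl.
    rewrite mul_mx_scalar scalerA mulVf// scale1r addrC.
    by rewrite subrK -aE submxK.
  rewrite BE; apply: scales_volume_mul.
    apply: scales_volume_lblock; first exact: oner_neq0.
    by move=> h mh h0; rewrite det1 normr1 mul1e;
      apply: eq_row_integral => v; rewrite mulmx1.
  apply: scales_volume_ublock => //; apply: IH.
  move: uB; rewrite BE unitmx_mul => /andP[_].
  by rewrite !unitmxE (@det_ublock _ 1 n) unitrM => /andP[].
move=> uA; have [A00|A00] := eqVneq (A 0 0) 0; last exact: step.
have [i Ai0] : exists i : 'I_n, (A : 'M[R]_(1 + n)) (rshift 1 i) 0 != 0.
  apply: contrapT => /forallNP Ai0.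
  have : \det A = 0.
    rewrite (expand_det_col _ 0) big1// => j _.
    case: (@split_ordP 1 n j) => k ->.
      by rewrite (_ : lshift n k = (0 : 'I_n.+1)) ?A00 ?mul0r//; apply: val_inj; rewrite /= ord1.
    by have /negP := Ai0 k; rewrite negbK => /eqP ->; rewrite mul0r.
  by move: uA; rewrite unitmxE => /[swap] ->; rewrite unitr0.
pose U (s : R) : 'M[R]_(1 + n) := block_mx 1%:M (s *: delta_mx 0 i) 0 1%:M.
have UU : U (-1) *m U 1 = 1%:M.
  rewrite mulmx_block !mul1mx !mulmx1 !mul0mx !mulmx0 !addr0 !add0r.
  by rewrite scale1r scaleN1r subrr -scalar_mx_block.
have uU s : U s \in unitmx by rewrite unitmxE (@det_ublock _ 1 n) !det1 mulr1 unitr1.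
rewrite -[A]mul1mx -UU -mulmxA; apply: scales_volume_mul.
  apply: scales_volume_ublock; first exact: oner_neq0.
  by move=> h mh h0; rewrite det1 normr1 mul1e;
    apply: eq_row_integral => v; rewrite mulmx1.
apply: step; first by rewrite unitmx_mul uU.
rewrite -[A](@submxK _ 1 n 1 n) (@mulmx_block _ 1 n 1 n 1 n) scale1r !mul1mx.
rewrite [in X in X != 0](_ : (0 : 'I_n.+1) = lshift n (0 : 'I_1)); last exact: val_inj.
rewrite block_mxEul mxE -rowE.
rewrite !mxE (_ : lshift n (0 : 'I_1) = (0 : 'I_n.+1)); last exact: val_inj.
by rewrite A00 add0r.
Qed.

End linear_change_of_variables.

Section split.
Context {R : realType}.
Local Notation leb := (@lebesgue_measure R).

Lemma measurable_row_integral_row_mx a b (h : 'rV[R]_(a + b) -> \bar R) :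
  measurable_row h -> (forall v, 0 <= h v)%E ->
  measurable_row (fun u : 'rV_a => row_integral (fun v : 'rV_b => h (row_mx u v))).
Proof.
move=> mh h0; rewrite /measurable_row /row_integral.
have [mu ->] := lebesgue_tuple_measure (R := R) b.
pose phi (z : a.-tuple (measurableTypeR R) * b.-tuple (measurableTypeR R)) :=
  row_mx (row_of_tuple z.1) (row_of_tuple z.2).
have mphi : measurable_fun setT (h \o phi).
  apply: (measurable_fun_row_of_tuple mh) => i.
  case: (split_ordP i) => j ->.
    under eq_fun do rewrite row_mxEl.
    by apply: (measurableT_comp (measurable_coord j)); exact: measurable_fst.
  under eq_fun do rewrite row_mxEr.
  by apply: (measurableT_comp (measurable_coord j)); exact: measurable_snd.
exact: (measurable_fun_fubini_tonelli_F (m2 := mu) (h \o phi) mphi (fun z => h0 _)).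
Qed.

Lemma row_integral_row_mx a b (h : 'rV[R]_(a + b) -> \bar R) :
  measurable_row h -> (forall v, 0 <= h v)%E ->
  row_integral h =
  row_integral (fun u : 'rV_a => row_integral (fun v : 'rV_b => h (row_mx u v))).
Proof.
elim: a h => [|a IH] h mh h0.
  rewrite row_integral0; apply: eq_row_integral => v; congr h.
  by apply/rowP => i; rewrite -[LHS](row_mxEr (0 : 'M[R]_(1, 0)) v 0 i); congr (row_mx _ _ _ _); apply: val_inj.
rewrite (row_integral_cons (n := a + b) mh)//.
rewrite (row_integral_cons (measurable_row_integral_row_mx mh h0)); last first.
  by move=> u; exact: row_integral_ge0.
apply: eq_integral => x _.
rewrite (IH _ (measurable_row_cons (n := a + b) x mh) (fun v => h0 _)).
apply: eq_row_integral => u; apply: eq_row_integral => v; congr h.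
by rewrite [LHS](@row_mxA _ 1 1 a b) [LHS]castmx_id.
Qed.

Lemma norm_det_orthonormal k (M : 'M[R]_k) : M *m M^T = 1%:M -> `|\det M| = 1.
Proof.
move=> MM; apply/eqP; rewrite -(@eqrXn2 _ 2)// -normrX expr1n.
by rewrite expr2 -{2}det_tr -det_mulmx MM det1 normr1.
Qed.

(** Tonelli's theorem in the rotated coordinates given by the rows of [B] and
    [C]. *)
Lemma row_integral_orthonormal a b n (B : 'M[R]_(a, n)) (C : 'M[R]_(b, n)) h :
  (a + b)%N = n -> col_mx B C *m (col_mx B C)^T = 1%:M ->
  measurable_row h -> (forall v, 0 <= h v)%E ->
  row_integral h =
  row_integral (fun u : 'rV_a => row_integral (fun v : 'rV_b => h (u *m B + v *m C))).
Proof.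
move=> abn; subst n => BC1 mh h0.
have detBC := norm_det_orthonormal BC1.
have uBC : col_mx B C \in unitmx.
  by rewrite unitmxE unitfE -normr_eq0 detBC oner_eq0.
rewrite (scales_volume_unit uBC)// detBC mul1e.
rewrite (row_integral_row_mx (measurable_row_mulmx _ mh) (fun v => h0 _)).
by apply: eq_row_integral => u; apply: eq_row_integral => v; rewrite mul_row_col.
Qed.

End split.

(** * Hoelder's inequality for several factors *)

Section generalized_hoelder.
Context {R : realType}.

Lemma weighted_amgm (I : finType) (P : pred I) (p y : I -> R) :
  (forall i, P i -> 0 < p i) -> \sum_(i | P i) p i = 1 ->
  (forall i, P i -> 0 <= y i) ->
  \prod_(i | P i) y i `^ p i <= \sum_(i | P i) p i * y i.
Proof.
move=> p0 p1 y0; set A := \sum_(i | P i) p i * y i.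
have [[i Pi yi]|ypos] := pselect (exists2 i, P i & y i = 0).
  rewrite (bigD1 i)//= yi powR0 ?gt_eqF ?p0// mul0r.
  by apply: sumr_ge0 => j Pj; rewrite mulr_ge0 ?y0// ltW ?p0.
have {}ypos i : P i -> 0 < y i.
  by move=> Pi; rewrite lt_neqAle y0// andbT; apply/eqP => yi; apply: ypos; exists i.
have [i Pi] : exists i, P i.
  apply: contrapT => /forallNP nP; move: p1; rewrite big1 => [/esym/eqP|i /nP//].
  by rewrite oner_eq0.
have A0 : 0 < A.
  rewrite /A (bigD1 i)//= ltr_wpDr ?mulr_gt0 ?p0 ?ypos//.
  by apply: sumr_ge0 => j /andP[Pj _]; rewrite mulr_ge0 ?y0// ltW ?p0.
(* The factorwise bound used below is [ln y <= ln A + (y / A - 1)]. *)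
have -> : A = expR (\sum_(i | P i) p i * (ln A + (y i / A - 1))).
  rewrite (eq_bigr (fun i => p i * (ln A - 1) + A^-1 * (p i * y i))); last first.
    by move=> j _; ring.
  rewrite big_split /= -mulr_suml p1 mul1r -mulr_sumr -/A mulVf ?gt_eqF//.
  by rewrite subrK lnK.
rewrite expR_sum; apply: ler_prod => j Pj; rewrite powR_ge0/= /powR gt_eqF ?ypos//.
rewrite ler_expR; apply: ler_wpM2l; first by rewrite ltW ?p0.
have -> : ln (y j) = ln A + ln (y j / A) by rewrite ln_div ?posrE ?ypos// addrC subrK.
rewrite lerD2l.
have := @expR_ge1Dx R (y j / A - 1); rewrite addrCA subrr addr0 => h.
by rewrite -ler_expR lnK ?posrE ?divr_gt0 ?ypos.
Qed.

Lemma weighted_amgme (I : finType) (P : pred I) (p : I -> R) (y : I -> \bar R) :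
  (forall i, P i -> 0 < p i) -> \sum_(i | P i) p i = 1 ->
  (forall i, P i -> 0 <= y i)%E ->
  (\prod_(i | P i) y i `^ p i <= \sum_(i | P i) (p i)%:E * y i)%E.
Proof.
move=> p0 p1 y0.
have py0 i : P i -> (0 <= (p i)%:E * y i)%E.
  by move=> Pi; rewrite mule_ge0 ?y0// lee_fin ltW ?p0.
have [[i Pi yi]|yfin] := pselect (exists2 i, P i & y i = +oo%E).
  rewrite (_ : \sum_(i | P i) _ = +oo)%E ?leey//.
  apply/esum_eqyP; first by move=> j Pj; rewrite gt_eqF// (lt_le_trans _ (py0 _ Pj))// ltNy0.
  by exists i; split; rewrite ?mem_index_enum// yi gt0_muley// lte_fin p0.
have yE i : P i -> y i = (fine (y i))%:E.
  move=> Pi; rewrite fineK// ge0_fin_numE ?y0// ltey; apply/eqP => yi.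
  by apply: yfin; exists i.
rewrite (eq_bigr (fun i => (fine (y i) `^ p i)%:E)); last first.
  by move=> i Pi; rewrite {1}yE// poweR_EFin.
rewrite [leRHS](eq_bigr (fun i => (p i * fine (y i))%:E)); last first.
  by move=> i Pi; rewrite {1}yE// EFinM.
rewrite prodEFin sumEFin lee_fin; apply: weighted_amgm => // i Pi.
by rewrite fine_ge0 ?y0.
Qed.

Lemma measurable_prod_poweR d (T : measurableType d) (I : finType) (P : pred I) (p : I -> R)
    (h : I -> T -> \bar R) :
  (forall i, measurable_fun setT (h i)) ->
  measurable_fun setT (fun x => \prod_(i | P i) h i x `^ p i)%E.
Proof.
move=> mh; elim: (index_enum I) => [|i r IH].
  by under eq_fun do rewrite big_nil; exact: measurable_cst.
under eq_fun do rewrite big_cons.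
case: (P i) => //; apply: emeasurable_funM => //.
exact: measurableT_comp (measurable_poweR (p i)) (mh i).
Qed.

(** Once each factor is divided by its integral, this is the weighted inequality
    between arithmetic and geometric means, integrated. *)
Lemma generalized_hoelder d (T : measurableType d)
    (mu : {measure set T -> \bar R}) (I : finType) (P : pred I) (p : I -> R)
    (h : I -> T -> \bar R) :
  (forall i, P i -> 0 < p i) -> \sum_(i | P i) p i = 1 ->
  (forall i, measurable_fun setT (h i)) -> (forall i x, 0 <= h i x)%E ->
  (\int[mu]_x \prod_(i | P i) h i x `^ p i <=
    \prod_(i | P i) (\int[mu]_x h i x) `^ p i)%E.
Proof.
move=> p0 p1 mh h0; pose a i := (\int[mu]_x h i x)%E.
have a0 i : (0 <= a i)%E by exact: integral_ge0.
have [[i Pi ai]|apos] := pselect (exists2 i, P i & a i = 0%E).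
  rewrite (_ : \int[mu]_x _ = 0)%E ?prode_ge0// => [j Pj|]; first exact: poweR_ge0.
  have hi0 : ae_eq mu setT (h i) (cst 0%E).
    apply/ae_eq_integral_abs => //; rewrite -ai.
    by apply: eq_integral => x _; rewrite gee0_abs.
  rewrite (ge0_ae_eq_integral (g := cst 0%E))//; first by rewrite integral0.
  - exact: measurable_prod_poweR.
  - by move=> x _; apply: prode_ge0 => j Pj; exact: poweR_ge0.
  - apply: filterS hi0 => x /(_ Logic.I) /= hx _.
    by rewrite (bigD1 i)//= hx poweR0r ?gt_eqF ?p0// mul0e.
have {}apos i : P i -> (0 < a i)%E.
  by move=> Pi; rewrite lt0e a0 andbT; apply/eqP => ai; apply: apos; exists i.
have [[i Pi ai]|afin] := pselect (exists2 i, P i & a i = +oo%E).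
  rewrite (_ : \prod_(i | P i) _ = +oo)%E ?leey//.
  rewrite (bigD1 i)//= -/(a i) ai poweRyr ?gt_eqF ?p0// gt0_mulye//.
  apply: (big_ind (fun x => 0 < x)%E) => //; first exact: mule_gt0.
  by move=> j /andP[Pj _]; rewrite poweR_gt0 ?apos.
have aE i : P i -> a i = (fine (a i))%:E.
  move=> Pi; rewrite fineK// ge0_fin_numE// ltey; apply/eqP => ai.
  by apply: afin; exists i.
have fa0 i : P i -> 0 < fine (a i) by move=> Pi; rewrite -lte_fin -aE ?apos.
pose c := \prod_(i | P i) fine (a i) `^ p i.
have -> : (\prod_(i | P i) (\int[mu]_x h i x) `^ p i = c%:E)%E.
  rewrite /c -prodEFin; apply: eq_bigr => i Pi.
  by rewrite -/(a i) aE// poweR_EFin.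
have c0 : 0 <= c by apply: prodr_ge0 => i _; exact: powR_ge0.
pose k i x := ((fine (a i))^-1%:E * h i x)%E.
have k0 i x : (0 <= k i x)%E.
  by rewrite mule_ge0// lee_fin invr_ge0 fine_ge0.
have mk i : measurable_fun setT (k i) by exact: emeasurable_funM.
have hk x : (\prod_(i | P i) h i x `^ p i = c%:E * \prod_(i | P i) k i x `^ p i)%E.
  rewrite /c -prodEFin -big_split; apply: eq_bigr => i Pi /=.
  rewrite -poweR_EFin -poweRM ?k0//; last by rewrite lee_fin ltW ?fa0.
  by rewrite /k muleA -EFinM mulfV ?mul1e// gt_eqF ?fa0.
under eq_integral do rewrite hk.
rewrite ge0_integralZl_EFin//; last 2 first.
- by move=> x _; apply: prode_ge0 => i _; exact: poweR_ge0.
- exact: measurable_prod_poweR.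
rewrite -[leRHS]mule1 lee_wpmul2l ?lee_fin//.
apply: (@le_trans _ _ (\int[mu]_x \sum_(i | P i) (p i)%:E * k i x)%E).
  apply: ge0_le_integralT => x; first by apply: prode_ge0 => i _; exact: poweR_ge0.
  by apply: weighted_amgme => // i; exact: k0.
pose q i := if P i then p i else 0.
have q0 i : 0 <= q i by rewrite /q; case: ifP => // /p0 /ltW.
have sumq (F : I -> \bar R) :
    (\sum_(i | P i) (p i)%:E * F i = \sum_i (q i)%:E * F i)%E.
  by rewrite big_mkcond; apply: eq_bigr => i _; rewrite /q; case: ifP => // _; rewrite mul0e.
under eq_integral do rewrite sumq.
rewrite ge0_integral_sum//=; last 2 first.
- by move=> i; exact: emeasurable_funM.
- by move=> i x _; rewrite mule_ge0 ?lee_fin.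
under eq_bigr do rewrite ge0_integralZl_EFin//.
rewrite -sumq (eq_bigr (fun i => (p i)%:E)); first by rewrite sumEFin p1.
move=> i Pi; rewrite ge0_integralZl_EFin//= ?invr_ge0 ?fine_ge0//.
by rewrite -/(a i) {2}aE// -EFinM mulVf ?mulr1// gt_eqF ?fa0.
Qed.

End generalized_hoelder.

(** * Finner's inequality *)

Section finner.
Context {R : realType}.
Local Notation leb := (@lebesgue_measure R).

Let eq_lee (x y : \bar R) : x = y -> (x <= y)%E.
Proof. by move=> ->. Qed.

Definition depends_on n (S : {set 'I_n}) T (h : 'rV[R]_n -> T) :=
  forall u v : 'rV_n, (forall i, i \in S -> u 0 i = v 0 i) -> h u = h v.

Definition unit_cube_off n (S : {set 'I_n}) (v : 'rV[R]_n) : bool :=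
  [forall i, (i \notin S) ==> (0 <= v 0 i <= 1)].

(** For [h] depending on the coordinates in [S] only, this is the integral
    of [h] over R^S; keeping the ambient space R^n makes linear changes of
    variables available without reindexing. *)
Definition partial_integral n (S : {set 'I_n}) (h : 'rV[R]_n -> \bar R) : \bar R :=
  row_integral (fun v => h v * (unit_cube_off S v)%:R%:E)%E.

Definition behead_set n (S : {set 'I_(1 + n)}) : {set 'I_n} :=
  [set i | rshift 1 i \in S].

Lemma unit_cube_off_cons n (S : {set 'I_(1 + n)}) x (v : 'rV[R]_n) :
  unit_cube_off S (row_mx x%:M v) =
  ((lshift n (0 : 'I_1) \in S) || (0 <= x <= 1)) && unit_cube_off (behead_set S) v.
Proof.
apply/forallP/andP => [h|[h0 /forallP h] i].
  split; first by have := h (lshift n (0 : 'I_1)); rewrite row_mxEl mxE eqxx mulr1n implyNb.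
  apply/forallP => i; have := h (rshift 1 i); rewrite row_mxEr.
  by rewrite inE.
case: (split_ordP i) => j ->; last first.
  by have := h j; rewrite row_mxEr inE.
by rewrite row_mxEl mxE ord1 eqxx mulr1n implyNb.
Qed.

Lemma measurable_unit_cube_off n (S : {set 'I_n}) :
  measurable_row (fun v : 'rV[R]_n => ((unit_cube_off S v)%:R%:E : \bar R)).
Proof.
rewrite /measurable_row.
pose E := [set t : n.-tuple (measurableTypeR R) | unit_cube_off S (row_of_tuple t)].
have mE : measurable E.
  rewrite (_ : E = \bigcap_(i in [set i | i \notin S])
    ((fun t : n.-tuple (measurableTypeR R) => tnth t i) @^-1` `[0, 1])); last first.
    apply/seteqP; split => [t /forallP tE i /= iS|t tE].
      by have := tE i; rewrite iS mxE in_itv.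
    apply/forallP => i; apply/implyP => iS.
    by have := tE i iS; rewrite mxE /= in_itv.
  apply: fin_bigcap_measurable => [|i _]; first exact: finite_finset.
  by rewrite -[X in measurable X]setTI; apply: measurable_tnth.
apply/measurable_EFinP.
rewrite (_ : (fun t => _) = \1_E); first exact: measurable_indic.
apply/funext => t.
by rewrite indicE; congr ((nat_of_bool _)%:R); apply/idP/idP; rewrite inE.
Qed.

Lemma partial_integral_ge0 n (S : {set 'I_n}) (h : 'rV[R]_n -> \bar R) :
  (forall v, 0 <= h v)%E -> (0 <= partial_integral S h)%E.
Proof.
by move=> h0; apply: row_integral_ge0 => v; rewrite mule_ge0// lee_fin.
Qed.

Lemma measurable_partial_integrand n (S : {set 'I_n}) (h : 'rV[R]_n -> \bar R) :
  measurable_row h -> measurable_row (fun v => h v * (unit_cube_off S v)%:R%:E)%E.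
Proof. by move=> mh; apply: emeasurable_funM => //; exact: measurable_unit_cube_off. Qed.

Section cons.
Context n (S : {set 'I_(1 + n)}) (h : 'rV[R]_(1 + n) -> \bar R).
Hypotheses (mh : measurable_row h) (h0 : forall v, (0 <= h v)%E).

Lemma partial_integral_cons : partial_integral S h =
  (\int[leb]_x (((lshift n (0 : 'I_1) \in S) || (0 <= x <= 1))%:R%:E *
    partial_integral (behead_set S) (fun v => h (row_mx x%:M v))))%E.
Proof.
rewrite /partial_integral row_integral_cons; last 2 first.
- exact: measurable_partial_integrand.
- by move=> v; rewrite mule_ge0// lee_fin.
apply: eq_integral => x _; rewrite -row_integralZl//; last 2 first.
- by apply: measurable_partial_integrand; exact: measurable_row_cons.
- by move=> v; rewrite mule_ge0// lee_fin.
apply: eq_row_integral => v; rewrite unit_cube_off_cons.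
by case: (_ || _); rewrite ?mul1e// mul0e mule0.
Qed.

Lemma measurable_partial_integral_cons : measurable_fun [set: measurableTypeR R]
  (fun x => partial_integral (behead_set S) (fun v => h (row_mx x%:M v))).
Proof.
pose k (v : 'rV[R]_(1 + n)) := (h v * (unit_cube_off (behead_set S) (rsubmx v))%:R%:E)%E.
have mk : measurable_row k.
  apply: emeasurable_funM => //.
  apply: (measurable_row_comp (phi := @rsubmx R 1 1 n) (measurable_unit_cube_off (behead_set S))) => i.
  by under eq_fun do rewrite mxE; exact: measurable_coord.
have k0 v : (0 <= k v)%E by rewrite mule_ge0// lee_fin.
apply: eq_measurable_fun (measurable_row_integral_cons mk k0) => x _.
by apply: eq_row_integral => v; rewrite /k row_mxKr.
Qed.

End cons.

Lemma partial_integral_cons_out n (S : {set 'I_(1 + n)}) h x :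
  measurable_row h -> (forall v, 0 <= h v)%E -> depends_on S h -> lshift n (0 : 'I_1) \notin S ->
  partial_integral S h = partial_integral (behead_set S) (fun v => h (row_mx x%:M v)).
Proof.
move=> mh h0 hS S0; rewrite partial_integral_cons// (negPf S0) /=.
set c := RHS.
have c0 : (0 <= c)%E by exact: partial_integral_ge0.
rewrite (eq_integral (fun y : measurableTypeR R => (\1_(`[0, 1]%classic : set R) y)%:E * c)%E); last first.
  move=> y _; congr (_ * _)%E.
    by rewrite indicE; congr ((nat_of_bool _)%:R%:E); apply/idP/idP; rewrite inE /= in_itv.
  apply: eq_row_integral => v; congr (_ * _)%E.
  apply: hS => i; case: (split_ordP i) => j -> iS; last by rewrite !row_mxEr.
  by move: S0; rewrite -(ord1 j) iS.
rewrite ge0_integralZr//; last by apply/measurable_EFinP; exact: measurable_indic.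
rewrite integral_indic// setIT -[X in (X * _)%E]/(leb `[0, 1]%classic).
by rewrite lebesgue_measure_itv /= lte01 oppr0 adde0 mul1e.
Qed.

(** Induction on [n].  For a fixed first coordinate, the induction hypothesis
    bounds the integral over the remaining ones by a product.  In that product,
    the factors with the first coordinate outside [S j] do not depend on it,
    and the weights of the others sum to 1, so that Hoelder's inequality bounds
    the integral over the first coordinate. *)
Theorem finner n m (S : 'I_m -> {set 'I_n}) (p : 'I_m -> R)
    (h : 'I_m -> 'rV[R]_n -> \bar R) :
  (forall j, 0 < p j) -> (forall i, \sum_j p j * (i \in S j)%:R = 1) ->
  (forall j, measurable_row (h j)) -> (forall j v, 0 <= h j v)%E ->
  (forall j, depends_on (S j) (h j)) ->
  (row_integral (fun v => \prod_j h j v `^ p j) <=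
   \prod_j partial_integral (S j) (h j) `^ p j)%E.
Proof.
move=> p0; elim: n S h => [|n IH] S h Sp mh h0 hS.
  rewrite row_integral0; apply: eq_lee; apply: eq_bigr => j _; congr (_ `^ _)%E.
  rewrite /partial_integral row_integral0 (_ : unit_cube_off _ _ = true) ?mule1//.
  by apply/forallP => -[].
have mprod : measurable_row (fun v => \prod_j h j v `^ p j)%E.
  exact: (measurable_prod_poweR xpredT p mh).
have prod0 (v : 'rV_(1 + n)) : (0 <= \prod_j h j v `^ p j)%E.
  by apply: prode_ge0 => j _; exact: poweR_ge0.
rewrite (row_integral_cons mprod prod0).
pose H j x := partial_integral (behead_set (S j)) (fun v => h j (row_mx x%:M v)).
have H0 j x : (0 <= H j x)%E by exact: partial_integral_ge0.
have mH j : measurable_fun [set: measurableTypeR R] (H j).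
  exact: measurable_partial_integral_cons.
apply: (@le_trans _ _ (\int[leb]_x \prod_j H j x `^ p j)%E).
  apply: ge0_le_integralT => x; first by apply: row_integral_ge0 => v.
  apply: (IH (fun j => behead_set (S j)) (fun j v => h j (row_mx x%:M v)))
    => [i|j|j v|j u v uv] //.
  - by rewrite -[RHS](Sp (rshift 1 i)); apply: eq_bigr => j _; rewrite inE.
  - exact: (measurable_row_cons x (mh j)).
  - apply: (hS j : depends_on (n := 1 + n) (S j) (h j)) => i.
    case: (split_ordP i) => k ->; first by rewrite !row_mxEl.
    by move=> kS; rewrite !row_mxEr uv ?inE.
pose P j := lshift n (0 : 'I_1) \in S j.
have HE j : ~~ P j -> H j = cst (partial_integral (S j) (h j)).
  by move=> Pj; apply/funext => x; rewrite (partial_integral_cons_out x).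
have {}HE x : (\prod_j H j x `^ p j = \prod_(j | ~~ P j) partial_integral (S j) (h j) `^ p j *
    \prod_(j | P j) H j x `^ p j)%E.
  rewrite (bigID (fun j => ~~ P j)) /=; congr (_ * _)%E; last first.
    by apply: eq_bigl => j; rewrite /= negbK.
  by apply: eq_bigr => j Pj; rewrite HE.
under eq_integral do rewrite HE.
rewrite ge0_integralZl//; last 3 first.
- exact: measurable_prod_poweR.
- by move=> x _; apply: prode_ge0 => j _; exact: poweR_ge0.
- by apply: prode_ge0 => j _; exact: poweR_ge0.
rewrite [leRHS](bigID (fun j => ~~ P j)) /= [X in (_ <= _ * X)%E](eq_bigl P); last first.
  by move=> j; rewrite /= negbK.
apply: lee_wpmul2l; first by apply: prode_ge0 => j _; exact: poweR_ge0.
apply: le_trans (generalized_hoelder _ _ _ _ _) _ => //.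
  rewrite -(Sp (lshift n (0 : 'I_1))) big_mkcond; apply: eq_bigr => j _.
  by rewrite /P; case: ifP; rewrite ?mulr1 ?mulr0.
apply: eq_lee; apply: eq_bigr => j Pj; congr (_ `^ _)%E.
rewrite partial_integral_cons//; apply: eq_integral => x _.
by move: Pj; rewrite /P => ->; rewrite mul1e.
Qed.

End finner.

(** * Moments of the logarithm *)

Section log_moments.
Context {R : realType}.
Local Notation leb := (@lebesgue_measure R).

Definition neg_log (r : R) : R := - ln r.

Lemma measurable_neg_log : measurable_fun setT neg_log.
Proof. by apply: measurable_funN; exact: measurable_ln. Qed.

Lemma neg_log_ge0 r : r \in `]0, 1[ -> 0 <= neg_log r.
Proof.
by rewrite in_itv/= => /andP[r0 r1]; rewrite oppr_ge0 ln_le0// ltW.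
Qed.

Lemma neg_log_gt0 r : r \in `]0, 1[ -> 0 < neg_log r.
Proof. by rewrite in_itv/= => r01; rewrite oppr_gt0 ln_lt0. Qed.

Lemma expR_neg_log r : 0 < r -> expR (neg_log r) = r^-1.
Proof. by move=> r0; rewrite expRN lnK. Qed.

(* Minus the derivative of [neg_log q ^+ d.+1]; the exponential stands for
   the factor [q^-1]. *)
Let k d (q : R) : R := d.+1%:R * neg_log q ^+ d * expR (neg_log q).

Let measurable_k d : measurable_fun setT (k d).
Proof.
apply: measurable_funM.
  apply: measurable_funM => //.
  by apply: measurable_funX; exact: measurable_neg_log.
by apply: measurableT_comp => //; exact: measurable_neg_log.
Qed.

Let is_derive_neg_log (q : R) : 0 < q -> is_derive q 1 neg_log (- q^-1).
Proof. by move=> q0; have dln := is_derive1_ln q0; exact: is_deriveN. Qed.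

Let is_derive_k d (q : R) : 0 < q ->
  is_derive q 1 (fun q => - neg_log q ^+ d.+1) (k d q).
Proof.
move=> q0; have dl := is_derive_neg_log q0.
rewrite (_ : (fun q => _) = - (neg_log ^+ d.+1)); last first.
  by apply/funext => x; rewrite /GRing.opp/= exprfctE.
apply: is_derive_eq; rewrite /k expR_neg_log// /GRing.scale /=.
by rewrite mulrN opprK.
Qed.

Let continuous_k d (q : R) : 0 < q -> {for q, continuous (k d)}.
Proof.
move=> q0; have dl := is_derive_neg_log q0.
apply: differentiable_continuous; apply/derivable1_diffP.
rewrite (_ : k d = cst d.+1%:R * neg_log ^+ d * (expR \o neg_log)); last first.
  by apply/funext => x; rewrite /k /GRing.mul/= exprfctE.
exact: ex_derive.
Qed.

Let k_ge0 d q : q \in `]0, 1[ -> 0 <= k d q.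
Proof.
by move=> q01; rewrite !mulr_ge0 ?expR_ge0 ?exprn_ge0 ?neg_log_ge0.
Qed.

Let integral_k d r : 0 < r -> r < 1 ->
  (\int[leb]_(q in `]r, 1%R[) (k d q)%:E = (neg_log r ^+ d.+1)%:E)%E.
Proof.
move=> r0 r1.
have q0 q : q \in `[r, 1] -> 0 < q.
  by rewrite in_itv /= => /andP[+ _]; exact: lt_le_trans.
have dF q : q \in `[r, 1] -> derivable (fun q => - neg_log q ^+ d.+1) q 1.
  by move=> /q0 q0'; have dk := is_derive_k d q0'; exact: ex_derive.
have cF q : q \in `[r, 1] -> {for q, continuous (fun q => - neg_log q ^+ d.+1)}.
  by move=> qr; apply: differentiable_continuous; exact/derivable1_diffP/dF.
have rr : r \in `[r, 1] by rewrite in_itv /= lexx ltW.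
have r11 : 1 \in `[r, 1] by rewrite in_itv /= lexx ltW.
rewrite -(integral_itv_bndoo true false); last first.
  by apply/measurable_EFinP; apply: measurable_funTS; exact: measurable_k.
rewrite (@continuous_FTC2 _ _ (fun q => - neg_log q ^+ d.+1))//.
- by rewrite /neg_log ln1 oppr0 expr0n oppr0 sub0e -EFinN opprK.
- apply/continuous_in_subspaceT => q; rewrite inE /= => /q0.
  exact: continuous_k.
- split.
  + by move=> q qr; apply: dF; exact: subset_itv_oo_cc qr.
  + by apply: cvg_at_right_filter; exact: cF.
  + by apply: cvg_at_left_filter; exact: cF.
- move=> q qr; rewrite derive1E; have qr' := subset_itv_oo_cc qr.
  by have dk := is_derive_k d (q0 _ qr'); exact: derive_val.
Qed.

(** Write the integrand for [d.+1] as the integral over ]r, 1[ of minus its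
    derivative, and exchange the integrals; this gives [d.+1] times the integral
    for [d]. *)
Lemma integral_neg_log d :
  (\int[leb]_(r in `]0%R, 1%R[) (neg_log r ^+ d)%:E = (d`!%:R)%:E)%E.
Proof.
elim: d => [|d IH].
  under eq_integral do rewrite expr0.
  by rewrite integral_cst//= lebesgue_measure_itv /= lte01 oppr0 adde0 mul1e.
pose T (r q : R) := [&& 0 < r, r < q & q < 1].
pose F (z : measurableTypeR R * measurableTypeR R) : \bar R :=
  ((T z.1 z.2)%:R%:E * (k d z.2)%:E)%E.
have mF : measurable_fun setT F.
  apply: emeasurable_funM; apply/measurable_EFinP; last first.
    exact: (measurableT_comp (measurable_k d)).
  apply: measurable_fun_natr_bool; apply: measurable_and.
    exact: measurable_fun_ltr.
  by apply: measurable_and; exact: measurable_fun_ltr.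
have F0 z : (0 <= F z)%E.
  rewrite /F; case: (boolP (T _ _)) => [/and3P[h1 h2 h3]|_]; last by rewrite mul0e.
  by rewrite mul1e lee_fin k_ge0// in_itv /= h3 (lt_trans h1 h2).
transitivity (\int[leb]_r \int[leb]_q F (r, q))%E.
  rewrite integral_mkcond; apply: eq_integral => r _; rewrite patchE.
  case: ifPn => [|rn].
    rewrite inE /= in_itv /= => /andP[r0 r1]; rewrite -integral_k// integral_mkcond.
    apply: eq_integral => q _; rewrite patchE /F /T /= r0 /=.
    rewrite (_ : (q \in _) = (r < q < 1)).
      by case: ifP; rewrite ?mul1e// mul0e.
    by apply/idP/idP; rewrite inE /= in_itv.
  rewrite integral0_eq// => q _; rewrite /F /T /=.
  case: and3P => [[r0 rq q1]|_]; last by rewrite mul0e.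
  move: rn; rewrite notin_setE /= in_itv /= r0 /= => /negP.
  by rewrite (lt_trans rq q1).
rewrite (fubini_tonelli F mF F0).
transitivity (\int[leb]_(q in `]0%R, 1%R[) (d.+1%:R%:E * (neg_log q ^+ d)%:E))%E.
  rewrite [RHS]integral_mkcond; apply: eq_integral => q _; rewrite patchE.
  case: ifPn => [|qn].
    rewrite inE /= in_itv /= => /andP[q0 q1].
    transitivity (\int[leb]_(r in `]0%R, q[) (k d q)%:E)%E.
      rewrite [RHS]integral_mkcond; apply: eq_integral => r _; rewrite patchE /F /T /= q1 andbT.
      rewrite (_ : (r \in _) = (0 < r < q)).
        by case: ifP; rewrite ?mul1e// mul0e.
      by apply/idP/idP; rewrite inE /= in_itv.
    rewrite integral_cst//= lebesgue_measure_itv /= lte_fin q0 oppr0 adde0 -!EFinM.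
    by rewrite /k expR_neg_log// divfK// gt_eqF.
  rewrite integral0_eq// => r _; rewrite /F /T /=.
  case: and3P => [[r0 rq q1]|_]; last by rewrite mul0e.
  by move: qn; rewrite notin_setE /= in_itv /= q1 (lt_trans r0 rq).
rewrite ge0_integralZl_EFin//; last 2 first.
- by move=> q q01; rewrite lee_fin exprn_ge0// neg_log_ge0.
- apply/measurable_EFinP; apply: measurable_funX; apply: measurable_funTS.
  exact: measurable_neg_log.
by rewrite IH -EFinM -natrM factS.
Qed.

End log_moments.

(** * Berwald's inequality *)

Section berwald.
Context {R : realType}.
Local Notation leb := (@lebesgue_measure R).
Local Notation I01 := (`]0%R, 1%R[%classic : set (measurableTypeR R)).
Implicit Types (q v w c : R).

(** The graph of the convex function [v `^ q] lies above its tangents; here this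
    is Young's inequality. *)
Lemma powR_tangent q v w : 1 <= q -> 0 <= v -> 0 <= w ->
  v `^ q - w `^ q <= q * v `^ (q - 1) * (v - w).
Proof.
move=> q1 v0 w0; have q0 : 0 < q by exact: lt_le_trans q1.
rewrite mulrBr -[X in _ <= X - _]mulrA (mulrC _ v) mulr_powRB1//.
have [->|qn1] := eqVneq q 1; first by rewrite subrr powRr0 !mul1r !powRr1.
have qm0 : 0 < q - 1 by rewrite subr_gt0 lt_neqAle eq_sym qn1.
have := @conjugate_powR R w (v `^ (q - 1)) q (q / (q - 1)) w0 (powR_ge0 _ _) q0.
rewrite divr_gt0// => /(_ isT).
have -> : (v `^ (q - 1)) `^ (q / (q - 1)) = v `^ q.
  by rewrite -powRrM mulrC divfK// gt_eqF.
have -> : q^-1 + (q / (q - 1))^-1 = 1.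
  by field; rewrite gt_eqF//= gt_eqF.
move=> /(_ erefl); rewrite -(ler_pM2l q0) => h.
have e : q * (w `^ q / q + v `^ q / (q / (q - 1))) = w `^ q + (q - 1) * v `^ q.
  by field; rewrite gt_eqF//= gt_eqF.
by rewrite e in h; lra.
Qed.

Let tangent_slope_le q c v w (b : bool) : 1 <= q -> 0 <= c -> 0 <= v ->
  (if b then v <= w /\ c <= v else w <= v /\ v <= c) ->
  q * v `^ (q - 1) * (v - w) <= q * c `^ (q - 1) * (v - w).
Proof.
move=> q1 c0 v0 h; rewrite -!mulrA; apply: ler_wpM2l; first by lra.
have pm a a' : 0 <= a -> a <= a' -> a `^ (q - 1) <= a' `^ (q - 1).
  move=> a0 aa; apply: ge0_ler_powR; rewrite ?nnegrE//; first by lra.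
  exact: le_trans aa.
case: b h => -[h1 h2].
  rewrite -subr_ge0 -mulrBl mulr_le0 ?subr_le0//.
  by rewrite pm.
by rewrite ler_wpM2r ?subr_ge0// pm.
Qed.

(** Equality holds for [v] equal to [w := neg_log ^+ d].  As [v / w] is
    nondecreasing, [v] crosses [w] at most once, from below.  Let [c] be the
    value of [v] at the crossing.  On either side of it, the tangent inequality
    gives [v^q - w^q <= q c^(q-1) (v - w)] for [q = n / d], and the integral of
    the right-hand side is zero. *)
Lemma berwald d n (v : R -> R) : (0 < d <= n)%N ->
  {in `]0, 1[, forall r, 0 <= v r} ->
  {in `]0, 1[ &, forall r s, r <= s -> v s <= v r} ->
  {in `]0, 1[ &, forall r s, r <= s ->
    v r * neg_log s ^+ d <= v s * neg_log r ^+ d} ->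
  measurable_fun I01 v ->
  (\int[leb]_(r in `]0%R, 1%R[) (v r)%:E = (d`!%:R)%:E)%E ->
  (\int[leb]_(r in `]0%R, 1%R[) (v r `^ (n%:R / d%:R))%:E <= (n`!%:R)%:E)%E.
Proof.
move=> /andP[d0 dn] vge vdec vstar mv vint.
set q := _ / _; pose w (r : R) := neg_log r ^+ d.
have q1 : 1 <= q by rewrite ler_pdivlMr ?ltr0n// mul1r ler_nat.
have w0 r : r \in `]0, 1[ -> 0 < w r by move=> r01; rewrite exprn_gt0// neg_log_gt0.
have wq r : r \in `]0, 1[ -> w r `^ q = neg_log r ^+ n.
  move=> r01; rewrite /w -powR_mulrn ?neg_log_ge0// -powRrM.
  by rewrite /q mulrC divfK ?pnatr_eq0 -?lt0n// powR_mulrn ?neg_log_ge0.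
have mw : measurable_fun I01 w.
  by apply: measurable_funX; apply: measurable_funTS; exact: measurable_neg_log.
have mpow (g : R -> R) : measurable_fun I01 g -> measurable_fun I01 (fun r : measurableTypeR R => (g r `^ q)%:E).
  by move=> mg; apply/measurable_EFinP; exact: (measurableT_comp (measurable_powR _)).
have nint : (\int[leb]_(r in `]0%R, 1%R[) (w r `^ q)%:E = (n`!%:R)%:E)%E.
  by rewrite -integral_neg_log; apply: eq_integral => r; rewrite inE => /wq ->.
rewrite -nint.
have wint : (\int[leb]_(r in `]0%R, 1%R[) (w r)%:E = (d`!%:R)%:E)%E by exact: integral_neg_log.
have [[a a01 va]|noA] := pselect (exists2 a, a \in `]0, 1[ & v a < w a).
  (* The crossing value.  Since [v] is nonincreasing and lies below [w] to the
     left of the crossing, it is the infimum of [v] over this part. *)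
  pose A : set R := v @` [set r : R | (r \in `]0, 1[) /\ v r < w r].
  have lbA : lbound A 0 by move=> _ [r [r01 _] <-]; exact: vge.
  have iA : has_inf A by split; [exists (v a); exists a|exists 0].
  pose c := inf A.
  have c0 : 0 <= c by apply: lb_le_inf => //; exact: iA.1.
  pose K := q * c `^ (q - 1).
  have K0 : 0 <= K by rewrite mulr_ge0 ?powR_ge0//; lra.
  have key r : r \in `]0, 1[ -> v r `^ q + K * w r <= w r `^ q + K * v r.
    move=> r01; have := powR_tangent q1 (vge _ r01) (ltW (w0 _ r01)).
    suff : q * v r `^ (q - 1) * (v r - w r) <= K * (v r - w r) by lra.
    apply: (@tangent_slope_le _ _ _ _ (v r < w r)) => //; first exact: vge.
    case: ifPn => [vw|]; first by split; [exact: ltW|apply: ge_inf; [exact: iA.2|exists r]].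
    rewrite -leNgt => wv; split => //; apply: lb_le_inf; first exact: iA.1.
    move=> _ [s [s01 vs] <-]; apply: vdec => //.
    have [sr|] := ltP s r; first exact: ltW.
    rewrite le_eqVlt => /predU1P[->//|rs]; exfalso.
    have := vstar _ _ r01 s01 (ltW rs); rewrite -/(w r) -/(w s); apply/negP; rewrite -ltNge.
    apply: (@lt_le_trans _ _ (w s * w r)); first by rewrite ltr_pM2r ?w0.
    by rewrite mulrC ler_pM2r ?w0.
  have : (\int[leb]_(r in `]0%R, 1%R[) ((v r `^ q)%:E + (K%:E * (w r)%:E)) <=
      \int[leb]_(r in `]0%R, 1%R[) ((w r `^ q)%:E + (K%:E * (v r)%:E)))%E.
    apply: ge0_le_integral => //.
    - by move=> r r01; rewrite -EFinM -EFinD lee_fin addr_ge0 ?powR_ge0// mulr_ge0// ltW// w0.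
    - apply: emeasurable_funD; first exact: mpow.
      by apply: emeasurable_funM => //; exact/measurable_EFinP.
    - apply: emeasurable_funD; first exact: mpow.
      by apply: emeasurable_funM => //; exact/measurable_EFinP.
  have intD (g h : R -> R) : measurable_fun I01 g -> measurable_fun I01 h ->
      {in `]0, 1[, forall r, 0 <= h r} -> (\int[leb]_(r in `]0%R, 1%R[) (h r)%:E = (d`!%:R)%:E)%E ->
      (\int[leb]_(r in `]0%R, 1%R[) ((g r `^ q)%:E + (K%:E * (h r)%:E)) =
       \int[leb]_(r in `]0%R, 1%R[) (g r `^ q)%:E + (K * d`!%:R)%:E)%E.
    move=> mg mh h0 inth; rewrite ge0_integralD//=.
    - by rewrite ge0_integralZl_EFin ?inth//; exact/measurable_EFinP.
    - by move=> r r01; rewrite lee_fin powR_ge0.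
    - exact: mpow.
    - by move=> r r01; rewrite -EFinM lee_fin mulr_ge0// h0.
    - by apply: emeasurable_funM => //; exact/measurable_EFinP.
  have w_ge0 : {in `]0, 1[, forall r, 0 <= w r} by move=> r r01; rewrite ltW// w0.
  rewrite (intD v w mv mw w_ge0 wint) (intD w v mw mv vge vint).
  by rewrite leeD2rE.
have {}noA r : r \in `]0, 1[ -> w r <= v r.
  by move=> r01; rewrite leNgt; apply/negP => vr; apply: noA; exists r.
(* Now [v >= w], and the integrals of [v] and [w] agree, so [v = w] almost
   everywhere. *)
suff vw : ae_eq leb I01 (EFin \o v) (EFin \o w).
  rewrite (ge0_ae_eq_integral (g := fun r : measurableTypeR R => (w r `^ q)%:E))//.
  - exact: mpow.
  - exact: mpow.
  - by move=> r _; rewrite lee_fin powR_ge0.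
  - by move=> r _; rewrite lee_fin powR_ge0.
  - by move: vw; apply: filterS => r h r01; have [->] := h r01.
have mvw : measurable_fun I01 (fun r : measurableTypeR R => (v r - w r)%:E).
  by apply/measurable_EFinP; exact: measurable_funB.
have vw0 : (\int[leb]_(r in `]0%R, 1%R[) (v r - w r)%:E = 0)%E.
  have : (\int[leb]_(r in `]0%R, 1%R[) ((v r - w r)%:E + (w r)%:E) = (d`!%:R)%:E)%E.
    by rewrite -vint; apply: eq_integral => r _; rewrite -EFinD subrK.
  rewrite ge0_integralD//=; last 3 first.
  - by move=> r r01; rewrite lee_fin subr_ge0 noA.
  - by move=> r r01; rewrite lee_fin ltW// w0.
  - exact/measurable_EFinP.
  by rewrite wint => /(congr1 (fun x => x - (d`!%:R)%:E)%E); rewrite addeK// subee.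
have : ae_eq leb I01 (fun r => (v r - w r)%:E) (cst 0%E).
  apply/ae_eq_integral_abs => //; rewrite -vw0; apply: eq_integral => r.
  by rewrite inE => r01; rewrite gee0_abs// lee_fin subr_ge0 noA.
apply: filterS => r /= h r01; have [/eqP] := h r01.
by rewrite subr_eq0 => /eqP ->.
Qed.

(** After normalizing the integrals, the inequality between arithmetic and
    geometric means with the weights [p_j d_j / n] bounds the product by a
    weighted sum of powers [n / d_j], to which Berwald's inequality applies.
    The factors with [d_j = 0] have weight 0 in that sum; they are constant,
    being both nonincreasing and nondecreasing. *)
Lemma berwald_product m n (d : 'I_m -> nat) (p A : 'I_m -> R) (u : 'I_m -> R -> R) :
  (forall j, 0 < p j) -> (forall j, d j <= n)%N ->
  \sum_j p j * (d j)%:R = n%:R ->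
  (forall j, {in `]0, 1[, forall r, 0 <= u j r}) ->
  (forall j, {in `]0, 1[ &, forall r s, r <= s -> u j s <= u j r}) ->
  (forall j, {in `]0, 1[ &, forall r s, r <= s ->
    u j r * neg_log s ^+ d j <= u j s * neg_log r ^+ d j}) ->
  (forall j, measurable_fun I01 (u j)) -> (forall j, 0 < A j) ->
  (forall j, \int[leb]_(r in `]0%R, 1%R[) (u j r)%:E = ((d j)`!%:R * A j)%:E)%E ->
  (\int[leb]_(r in `]0%R, 1%R[) (\prod_j u j r `^ p j)%:E <=
    (n`!%:R * \prod_j A j `^ p j)%:E)%E.
Proof.
move=> p0 dn pd uge udec ustar mu A0 uint.
pose v j r := (A j)^-1 * u j r.
have vge j : {in `]0, 1[, forall r, 0 <= v j r}.
  by move=> r r01; rewrite mulr_ge0 ?uge// invr_ge0 ltW.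
have mv j : measurable_fun I01 (v j) by exact: measurable_funM.
have vint j : (\int[leb]_(r in `]0%R, 1%R[) (v j r)%:E = ((d j)`!%:R)%:E)%E.
  under eq_integral do rewrite EFinM.
  rewrite ge0_integralZl_EFin//; last 3 first.
  - by move=> r r01; rewrite lee_fin uge.
  - exact/measurable_EFinP.
  - by rewrite invr_ge0 ltW.
  by rewrite uint -EFinM mulrC mulfK// gt_eqF.
have prodE r : r \in `]0, 1[ ->
    \prod_j u j r `^ p j = \prod_j A j `^ p j * \prod_j v j r `^ p j.
  move=> r01; rewrite -big_split; apply: eq_bigr => j _ /=.
  by rewrite -powRM ?vge// ?ltW// /v mulrA mulfV ?mul1r// gt_eqF.
have v1 j r : r \in `]0, 1[ -> d j = 0%N -> v j r = 1.
  move=> r01 dj; have uc s : s \in `]0, 1[ -> u j s = u j r.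
    move=> s01; have := ustar j; rewrite dj => us; apply/eqP; rewrite eq_le.
    have {}us x y : x \in `]0, 1[ -> y \in `]0, 1[ -> x <= y -> u j x <= u j y.
      by move=> x01 y01 /(us _ _ x01 y01); rewrite !expr0 !mulr1.
    by have [sr|/ltW rs] := leP s r; apply/andP; split;
      [exact: us|exact: udec|exact: udec|exact: us].
  have := uint j; rewrite (eq_integral (fun=> (u j r)%:E)); last first.
    by move=> s; rewrite inE /= => /uc ->.
  rewrite integral_cst//= lebesgue_measure_itv /= lte01 oppr0 adde0 mule1 dj mul1r.
  by move=> [uA]; rewrite /v uA mulVf// gt_eqF.
have mprod (h : 'I_m -> R -> R) : (forall j, measurable_fun I01 (h j)) ->
    measurable_fun I01 (fun r : measurableTypeR R => (\prod_j h j r `^ p j)%:E).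
  move=> mh; apply/measurable_EFinP; apply: measurable_prod => j _.
  exact: (measurableT_comp (measurable_powR _)).
rewrite (eq_integral (fun r : measurableTypeR R =>
  ((\prod_j A j `^ p j)%:E * (\prod_j v j r `^ p j)%:E))%E); last first.
  by move=> r; rewrite inE /= => r01; rewrite prodE.
have prodA0 : 0 <= \prod_j A j `^ p j by apply: prodr_ge0 => j _; exact: powR_ge0.
rewrite ge0_integralZl_EFin//; last 2 first.
- by move=> r _; rewrite lee_fin; apply: prodr_ge0 => j _; exact: powR_ge0.
- exact: mprod.
rewrite mulrC EFinM lee_wpmul2l ?lee_fin//.
have [n0|n0] := posnP n.
  rewrite (eq_integral (fun=> 1%E)); last first.
    move=> r; rewrite inE /= => r01; rewrite big1// => j _.
    by rewrite v1 ?powR1//; apply/eqP; rewrite -leqn0 -n0.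
  by rewrite integral_cst//= lebesgue_measure_itv /= lte01 oppr0 adde0 mul1e n0 lee_fin.
pose t j := p j * (d j)%:R / n%:R.
have t0 j : 0 <= t j by rewrite divr_ge0// mulr_ge0// ltW.
have t1 : \sum_j t j = 1 by rewrite -mulr_suml pd mulfV// pnatr_eq0 -lt0n.
have amgm r : r \in `]0, 1[ ->
    \prod_j v j r `^ p j <= \sum_j t j * v j r `^ (n%:R / (d j)%:R).
  move=> r01; rewrite (bigID (fun j => d j == 0)%N) /= big1 ?mul1r; last first.
    by move=> j /eqP dj; rewrite v1// powR1.
  rewrite [leRHS](bigID (fun j => d j == 0)%N) /= [X in _ <= X + _]big1 ?add0r; last first.
    by move=> j /eqP dj; rewrite /t dj mulr0 !mul0r.
  rewrite (eq_bigr (fun j => (v j r `^ (n%:R / (d j)%:R)) `^ t j)); last first.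
    move=> j dj; rewrite -powRrM; congr (_ `^ _).
    by rewrite /t; field; rewrite !pnatr_eq0 dj -lt0n n0.
  apply: weighted_amgm.
  - by move=> j dj; rewrite /t divr_gt0 ?mulr_gt0 ?ltr0n// lt0n.
  - rewrite -t1 [RHS](bigID (fun j => d j == 0)%N) /= [X in _ = X + _]big1 ?add0r//.
    by move=> j /eqP dj; rewrite /t dj mulr0 mul0r.
  - by move=> j _; exact: powR_ge0.
have mvq j : measurable_fun I01 (fun r : measurableTypeR R => (v j r `^ (n%:R / (d j)%:R))%:E).
  by apply/measurable_EFinP; exact: (measurableT_comp (measurable_powR _)).
apply: (@le_trans _ _ (\int[leb]_(r in `]0%R, 1%R[)
    \sum_j ((t j)%:E * (v j r `^ (n%:R / (d j)%:R))%:E))%E).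
  apply: ge0_le_integral => //.
  - by move=> r _; rewrite lee_fin; apply: prodr_ge0 => j _; exact: powR_ge0.
  - exact: mprod.
  - by apply: emeasurable_sum => j; exact: emeasurable_funM.
  - by move=> r r01; rewrite sumEFin lee_fin amgm.
rewrite ge0_integral_sum//; last 2 first.
- by move=> j; exact: emeasurable_funM.
- by move=> j r _; rewrite -EFinM lee_fin mulr_ge0// powR_ge0.
have -> : ((n`!%:R)%:E = \sum_j (t j)%:E * (n`!%:R)%:E :> \bar R)%E.
  under eq_bigr do rewrite -EFinM.
  by rewrite sumEFin -mulr_suml t1 mul1r.
apply: lee_sum => j _; rewrite ge0_integralZl_EFin//; last first.
  by move=> r _; rewrite lee_fin powR_ge0.
have [dj|dj] := posnP (d j); first by rewrite /t dj mulr0 mul0r !mul0e.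
apply: lee_wpmul2l; first by rewrite lee_fin.
apply: (@berwald (d j) n) => //; first by rewrite dj dn.
- by move=> r s r01 s01 rs; rewrite ler_wpM2l ?invr_ge0 ?(ltW (A0 j))// udec.
- move=> r s r01 s01 rs; rewrite -!mulrA ler_wpM2l ?invr_ge0 ?(ltW (A0 j))//.
  exact: ustar.
Qed.

End berwald.

(** * Log-concave functions and their envelopes *)

Section geometric_concavity.
Context {R : realType}.

(** Log-concavity without the logarithm: where the function vanishes, no infinite
    values arise. *)
Definition geo_concave n (g : 'rV[R]_n -> R) :=
  (forall x, 0 <= g x) /\
  forall a x y, 0 < a < 1 ->
    g x `^ a * g y `^ (1 - a) <= g (a *: x + (1 - a) *: y).

Lemma log_concave_geo n (f : 'rV[R]_n -> R) : log_concave f -> geo_concave f.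
Proof.
move=> [v [vNy vconv] fE]; have f0 x : 0 <= f x by rewrite -lee_fin fE expeR_ge0.
have fy x : v x = +oo%E -> f x = 0 by move=> vx; have := fE x; rewrite vx => -[].
have ff x s : v x = s%:E -> f x = expR (- s) by move=> vx; have := fE x; rewrite vx => -[].
split=> // a x y a01; have /andP[a0 a1] := a01.
case vx : (v x) (vNy x) => [s| |]// _; last first.
  by rewrite (fy x)// powR0 ?gt_eqF// mul0r.
case vy : (v y) (vNy y) => [t| |]// _; last first.
  by rewrite (fy y)// powR0 ?mulr0// gt_eqF// subr_gt0.
rewrite (ff x s)// (ff y t)// -!expRM -expRD -lee_fin fE.
rewrite -[leLHS]/(expeR (_)%:E) lee_expeR.
have := vconv a x y; rewrite (ltW a0) (ltW a1) => /(_ isT); rewrite vx vy -!EFinM -EFinD => h.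
rewrite leeNr; apply: le_trans h _; rewrite -EFinN lee_fin; lra.
Qed.

Lemma geo_concave_linear n m (A : 'M[R]_(n, m)) (f : 'rV[R]_m -> R) :
  geo_concave f -> geo_concave (fun v : 'rV_n => f (v *m A)).
Proof.
by move=> [f0 fc]; split=> // a x y a01; rewrite mulmxDl -!scalemxAl; exact: fc.
Qed.

End geometric_concavity.

Section regularization.
Context {R : realType} {n : nat}.
Local Notation full := ([set: 'I_n]%SET).
Implicit Types (S : {set 'I_n}) (a b v x y z : 'rV[R]_n) (r : R).

Definition box_within S a b v : bool := [forall (i | i \in S), a 0 i < v 0 i < b 0 i].

Lemma box_withinP S a b v :
  reflect (forall i, i \in S -> a 0 i < v 0 i < b 0 i) (box_within S a b v).
Proof. exact: forall_inP. Qed.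

Definition proper_box a b := forall i, a 0 i < b 0 i.

Variable g : 'rV[R]_n -> R.

Definition minorizes_near S r v := exists a b,
  [/\ proper_box a b, box_within S a b v &
      forall y, box_within full a b y -> r <= g y].

(** For [S] the full set this is the lower semicontinuous envelope of [g];
    in general it is the supremum of that envelope over the coordinates
    outside [S].  It exceeds a given value on a union of open boxes, and is
    therefore a Borel function, whereas the supremum of [g] itself over these
    coordinates need not be one. *)
Definition envelope S v : \bar R :=
  ereal_sup [set r%:E | r in [set r | minorizes_near S r v]].

Lemma envelope_gtP S v r :
  reflect (exists2 s, r < s & minorizes_near S s v) (r%:E < envelope S v)%E.
Proof.
apply: (iffP ereal_sup_gtP) => [[_ [s sv <-]] rs|[s rs sv]].
  by exists s.
by exists s%:E; [exists s|].
Qed.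

Lemma minorizes_near_sub (S T : {set 'I_n}) r v : S \subset T ->
  minorizes_near T r v -> minorizes_near S r v.
Proof.
move=> ST [a [b [ab abv h]]]; exists a, b; split=> //.
by apply/box_withinP => i iS; move/box_withinP: abv; apply; exact: (fintype.subsetP ST).
Qed.

Lemma envelope_depends_on S : depends_on S (envelope S).
Proof.
suff le (u v : 'rV[R]_n) : (forall i, i \in S -> u 0 i = v 0 i) -> (envelope S u <= envelope S v)%E.
  by move=> u v uv; apply/eqP; rewrite eq_le !le// => i /uv.
move=> uv; apply: ereal_sup_le => _ [r [a [b [ab /box_withinP abu h]]] <-].
exists r => //; exists a, b; split=> //; apply/box_withinP => i iS.
by rewrite -uv// abu.
Qed.

(** Every box meets the fibre over [v], in a point where [g] is at least the
    value that the box contributes to the envelope.  So the envelope lies below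
    the supremum of [g] over the fibre. *)
Lemma envelope_le_bound S v (X : \bar R) :
  (forall y, (forall i, i \in S -> y 0 i = v 0 i) -> ((g y)%:E <= X)%E) ->
  (envelope S v <= X)%E.
Proof.
move=> gX; apply: ge_ereal_sup => _ [r [a [b [ab /box_withinP abv h]]] <-].
pose y : 'rV[R]_n := \row_i if i \in S then v 0 i else (a 0 i + b 0 i) / 2.
apply: (le_trans _ (gX y _)) => [|i iS]; last by rewrite mxE iS.
rewrite lee_fin h//; apply/box_withinP => i _; rewrite mxE.
case: ifPn => [/abv//|_]; have := ab i => abi; apply/andP; split; lra.
Qed.

Lemma envelope_setT_le v : (envelope full v <= (g v)%:E)%E.
Proof.
apply: envelope_le_bound => y yv; rewrite (_ : y = v)//.
by apply/rowP => i; rewrite yv.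
Qed.

Lemma le_envelope S v : (envelope full v <= envelope S v)%E.
Proof.
by apply: ereal_sup_le => _ [r rv <-]; exists r => //; exact: minorizes_near_sub rv.
Qed.

Lemma envelope_ge0 S v : (forall y, 0 <= g y) -> (0 <= envelope S v)%E.
Proof.
move=> g0; apply: le_ereal_sup_tmp; exists 0%E => //; exists 0 => //.
exists (v - const_mx 1), (v + const_mx 1); split=> //.
  by move=> i; rewrite !mxE; lra.
by apply/box_withinP => i _; rewrite !mxE; apply/andP; split; lra.
Qed.

Let rat_row (q : n.-tuple rat) : 'rV[R]_n := \row_i ratr (tnth q i).

(** Boxes with rational corners suffice, and there are countably many of them. *)
Lemma envelope_gt_ratP S v r : reflect
  (exists2 q : n.-tuple rat * n.-tuple rat,
    (exists2 s, r < s & forall y, box_within full (rat_row q.1) (rat_row q.2) y -> s <= g y) /\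
    proper_box (rat_row q.1) (rat_row q.2)
    & box_within S (rat_row q.1) (rat_row q.2) v)
  (r%:E < envelope S v)%E.
Proof.
apply: (iffP (envelope_gtP _ _ _)) => [[s rs [a [b [ab /box_withinP abv h]]]]|]; last first.
  by move=> [q [[s rs h] ab] abv]; exists s => //; exists (rat_row q.1), (rat_row q.2).
pose y i := if i \in S then v 0 i else (a 0 i + b 0 i) / 2.
have yab i : a 0 i < y i < b 0 i.
  by rewrite /y; case: ifPn => [/abv//|_]; have := ab i => abi; apply/andP; split; lra.
have [qa qaP] : {q : 'I_n -> rat & forall i, a 0 i < ratr (q i) < y i}.
  apply: (@choice _ _ (fun i q => a 0 i < ratr q < y i)) => i.
  have /andP[ay _] := yab i; have [q] := rat_in_itvoo ay.
  by rewrite in_itv /= => ?; exists q.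
have [qb qbP] : {q : 'I_n -> rat & forall i, y i < ratr (q i) < b 0 i}.
  apply: (@choice _ _ (fun i q => y i < ratr q < b 0 i)) => i.
  have /andP[_ yb] := yab i; have [q] := rat_in_itvoo yb.
  by rewrite in_itv /= => ?; exists q.
exists ([tuple qa i | i < n], [tuple qb i | i < n]) => /=; last first.
  apply/box_withinP => i iS; rewrite !mxE !tnth_mktuple.
  have /andP[_] := qaP i; have /andP[+ _] := qbP i.
  by rewrite /y iS => -> ->.
split.
  exists s => // z /box_withinP zq; apply: h; apply/box_withinP => i _.
  have := zq i (finset.in_setT i); rewrite !mxE !tnth_mktuple => /andP[az zb].
  have /andP[aq _] := qaP i; have /andP[_ qb'] := qbP i.
  by rewrite (lt_trans aq az) (lt_trans zb qb').
move=> i; rewrite !mxE !tnth_mktuple.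
by have /andP[_ h1] := qaP i; have /andP[h2 _] := qbP i; exact: lt_trans h1 h2.
Qed.

Lemma measurable_envelope S : measurable_row (envelope S).
Proof.
move=> mT; apply: (measurability _ (ErealGenOInfty.measurableE R)) => // _ [_ [r ->] <-].
rewrite setTI.
pose P (q : n.-tuple rat * n.-tuple rat) :=
  (exists2 s, r < s & forall y, box_within full (rat_row q.1) (rat_row q.2) y -> s <= g y) /\
    proper_box (rat_row q.1) (rat_row q.2).
pose B (q : n.-tuple rat * n.-tuple rat) : set (n.-tuple (measurableTypeR R)) :=
  [set t | P q /\ box_within S (rat_row q.1) (rat_row q.2) (row_of_tuple t)].
rewrite (_ : _ @^-1` _ = \bigcup_q B q); last first.
  apply/seteqP; split => [t /=|t [q _ [Pq qt]]/=].
    by rewrite in_itv /= andbT => /envelope_gt_ratP[q Pq qt]; exists q.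
  by rewrite in_itv /= andbT; apply/envelope_gt_ratP; exists q.
apply: countable_bigcupT_measurable => [|q]; first exact: countableP.
have [Pq|nPq] := pselect (P q); last first.
  rewrite (_ : B q = set0)//; apply/seteqP; split=> // t [].
  by move=> /nPq.
rewrite (_ : B q = \bigcap_(i in [set i | i \in S])
  ((fun t : n.-tuple (measurableTypeR R) => tnth t i) @^-1`
    `]rat_row q.1 0 i, rat_row q.2 0 i[)); last first.
  apply/seteqP; split => [t [_ /box_withinP tq] i iS /=|t tq].
    by rewrite in_itv /=; have := tq i iS; rewrite [row_of_tuple _ _ _]mxE.
  split=> //; apply/box_withinP => i iS; rewrite [row_of_tuple _ _ _]mxE.
  by have := tq i iS; rewrite /= in_itv.
apply: fin_bigcap_measurable => [|i _]; first exact: finite_finset.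
by rewrite -[X in measurable X]setTI; apply: measurable_tnth.
Qed.

End regularization.

(** * Convex sets of positive volume *)

Section convex_sets_contain_boxes.
Context {R : realType}.
Local Notation leb := (@lebesgue_measure R).

Definition convex_rows n (K : set 'rV[R]_n) := forall (a : R) (x y : 'rV[R]_n),
  0 <= a <= 1 -> K x -> K y -> K (a *: x + (1 - a) *: y).

Definition has_cube n (K : set 'rV[R]_n) := exists z : 'rV[R]_n, exists2 e : R, 0 < e &
  forall y : 'rV_n, (forall i, `|y 0 i - z 0 i| < e) -> K y.

(** The convex hull of two cubes in different parallel slices contains a cube
    halfway between them. *)
Lemma convex_join_cubes n (K : set 'rV[R]_(1 + n)) x1 x2 : x1 < x2 ->
  convex_rows K ->
  has_cube [set v : 'rV_n | K (row_mx x1%:M v)] ->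
  has_cube [set v : 'rV_n | K (row_mx x2%:M v)] ->
  has_cube K.
Proof.
move=> x12 Kc [z1 [e1 e10 h1]] [z2 [e2 e20 h2]].
pose e := Num.min e1 e2; have e0 : 0 < e by rewrite lt_min e10.
have ee1 : e <= e1 by rewrite ge_min lexx.
have ee2 : e <= e2 by rewrite ge_min lexx orbT.
pose D := x2 - x1; have D0 : 0 < D by rewrite subr_gt0.
pose M := \sum_i `|z2 0 i - z1 0 i|.
have M0 : 0 <= M by exact: sumr_ge0.
have leM i : `|z2 0 i - z1 0 i| <= M.
  by rewrite /M (bigD1 i)//= lerDl sumr_ge0.
(* The centres of the slices drift by at most [M] while the first coordinate
   changes by [D], hence by at most [e / 2] over a distance of [e3]. *)
pose e3 := e * D / (2 * (M + 1)).
have e30 : 0 < e3 by rewrite divr_gt0 ?mulr_gt0//; lra.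
pose f := Num.min (e / 2) (Num.min (D / 2) e3).
exists (row_mx ((x1 + x2) / 2)%:M (2^-1 *: (z1 + z2))), f.
  by rewrite !lt_min e30 !divr_gt0.
move=> y; rewrite -[y]hsubmxK; set x := lsubmx y 0 0; set t := rsubmx y.
have -> : lsubmx y = x%:M by rewrite [LHS]mx11_scalar.
move=> yf.
have xf : `|x - (x1 + x2) / 2| < f.
  have -> : x - (x1 + x2) / 2 = (x%:M : 'M[R]_1) 0 0 - (((x1 + x2) / 2)%:M : 'M[R]_1) 0 0.
    by rewrite [X in _ = X - _]mxE [X in _ = _ - X]mxE !eqxx !mulr1n.
  by have := yf (lshift n 0); rewrite !row_mxEl.
have {yf}tf i : `|t 0 i - 2^-1 * (z1 0 i + z2 0 i)| < f.
  have -> : 2^-1 * (z1 0 i + z2 0 i) = (2^-1 *: (z1 + z2)) 0 i by rewrite !mxE.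
  by have := yf (rshift 1 i); rewrite !row_mxEr.
move: xf; rewrite !lt_min => /and3P[_ xD xe3].
pose l := (x2 - x) / D.
have lD : l * D = x2 - x by rewrite divfK// gt_eqF.
have l01 : 0 <= l <= 1.
  rewrite divr_ge0 ?ler_pdivrMr ?mul1r ?(ltW D0)//; rewrite /D in xD *;
  move: xD; rewrite ltr_norml => /andP[? ?]; lra.
pose u : 'rV_n := t - (l *: z1 + (1 - l) *: z2).
have uf i : `|u 0 i| < e.
  have -> : u 0 i = (t 0 i - 2^-1 * (z1 0 i + z2 0 i)) + (l - 2^-1) * (z2 0 i - z1 0 i).
    by rewrite !mxE; field.
  apply: le_lt_trans (ler_normD _ _) _.
  have : `|t 0 i - 2^-1 * (z1 0 i + z2 0 i)| < e / 2 by have := tf i; rewrite !lt_min => /andP[].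
  suff : `|(l - 2^-1) * (z2 0 i - z1 0 i)| <= e / 2 by lra.
  rewrite normrM; apply: (@le_trans _ _ ((e3 / D) * (M + 1))).
    apply: ler_pM => //; last by have := leM i; lra.
    rewrite ler_pdivlMr// -[X in _ * X](gtr0_norm D0) -normrM mulrBl lD.
    rewrite (_ : _ - _ = - (x - (x1 + x2) / 2)) ?normrN ?ltW// /D; by field.
  by rewrite /e3 le_eqVlt; apply/orP; left; apply/eqP; field; rewrite gt_eqF//= gt_eqF//; lra.
have -> : row_mx x%:M t = l *: row_mx x1%:M (z1 + u) + (1 - l) *: row_mx x2%:M (z2 + u).
  rewrite !scale_row_mx add_row_mx; congr row_mx.
    rewrite !scale_scalar_mx -raddfD /=; congr (_%:M).
    by move: lD; rewrite /D => lD'; lra.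
  by apply/rowP => i; rewrite /u !mxE; ring.
apply: Kc => //.
  by apply: h1 => i; rewrite [(_ + u) 0 i]mxE addrAC subrr add0r; exact: lt_le_trans (uf i) ee1.
by apply: h2 => i; rewrite [(_ + u) 0 i]mxE addrAC subrr add0r; exact: lt_le_trans (uf i) ee2.
Qed.

(** Tonelli's theorem yields two parallel slices of positive mass, which contain
    cubes by induction; so does their convex hull. *)
Lemma convex_has_cube n (K : set 'rV[R]_n) (h : 'rV[R]_n -> \bar R) :
  convex_rows K -> measurable_row h -> (forall v, 0 <= h v)%E ->
  (forall v, h v != 0%E -> K v) -> (0 < row_integral h)%E -> has_cube K.
Proof.
elim: n K h => [|n IH] K h Kc mh h0 hK.
  rewrite row_integral0 => h00; exists 0, 1 => // y _; rewrite (_ : y = 0).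
    by apply: hK; rewrite gt_eqF.
  by apply/rowP => -[].
rewrite (row_integral_cons mh h0) => pos.
pose H x := row_integral (fun v : 'rV_n => h (row_mx x%:M v)).
have slice x : (H x != 0)%E -> has_cube [set v : 'rV_n | K (row_mx x%:M v)].
  move=> Hx; apply: (IH _ (fun v => h (row_mx x%:M v))) => //.
  - move=> a u v a01 Ku Kv /=.
    have -> : row_mx x%:M (a *: u + (1 - a) *: v) =
        a *: row_mx x%:M u + (1 - a) *: row_mx x%:M v :> 'rV[R]_(1 + n).
      rewrite !scale_row_mx add_row_mx; congr row_mx.
      by rewrite !scale_scalar_mx -raddfD /=; congr (_%:M); ring.
    exact: Kc.
  - exact: (measurable_row_cons x mh).
  - by move=> v; exact: hK.
  - by rewrite lt0e Hx; exact: row_integral_ge0.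
have [x1 Hx1] : exists x1, (H x1 != 0)%E.
  apply: contrapT => /forallNP Hn; move: pos.
  by rewrite integral0_eq ?ltxx// => x _; have /negP := Hn x; rewrite negbK => /eqP.
have [x2 x21 Hx2] : exists2 x2, x2 != x1 & (H x2 != 0)%E.
  apply: contrapT => Hn; move: pos.
  rewrite (_ : integral _ _ _ = \int[leb]_(x in [set x1]) H x)%E.
    by rewrite integral_set1 ltxx.
  rewrite [RHS]integral_mkcond; apply: eq_integral => x _; rewrite patchE.
  case: ifPn => //; rewrite notin_setE => xx1.
  apply/eqP; apply: contrapT => /negP Hx; apply: Hn; exists x => //.
  by apply/eqP => xE; exact: xx1.
have [x12|x12|xx] := ltgtP x1 x2; last by rewrite xx eqxx in x21.
  by apply: (convex_join_cubes x12) => //; exact: slice.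
by apply: (convex_join_cubes x12) => //; exact: slice.
Qed.

End convex_sets_contain_boxes.

(** * Homotheties, envelopes and level sets *)

Section envelope_of_concave.
Context {R : realType}.
Local Notation leb := (@lebesgue_measure R).

Import HBNNSimple.

(** Let [t] tend to 0. *)
Lemma lee_onem_limit (C : R) (x y : \bar R) : 0 <= C -> (0 <= x)%E -> (0 <= y)%E ->
  (forall t, 0 < t < 1 -> ((1 - C * t)%:E * x <= y)%E) -> (x <= y)%E.
Proof.
move=> C0; case: y => [y| |]// + _ h; last by rewrite leey.
have t0 : 0 < (2 * (C + 1))^-1 < 1.
  have C1 : 0 < 2 * (C + 1) by lra.
  by rewrite invr_gt0 C1 invf_lt1//; lra.
case: x h => [x| |]// h x0; last first.
  have := h _ t0; rewrite gt0_muley// lte_fin.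
  have : C * (2 * (C + 1))^-1 < 1 by rewrite ltr_pdivrMr; lra.
  by lra.
rewrite !lee_fin in x0 *; apply/ler_addgt0Pr => e e0.
pose t := Num.min 2^-1 (e / (C * x + 1)).
have Cx0 : 0 < C * x + 1 by rewrite ltr_wpDl ?mulr_ge0.
have tt0 : 0 < t by rewrite lt_min divr_gt0// andbT; lra.
have t1 : t < 1 by rewrite gt_min; apply/orP; left; lra.
have te : t * (C * x + 1) <= e.
  by rewrite -ler_pdivlMr// ge_min lexx orbT.
have := h t; rewrite tt0 t1 => /(_ isT); rewrite -EFinM lee_fin => h1.
have : 0 <= t by exact: ltW.
nra.
Qed.

Lemma finite_pos_lower_bound (s : seq R) :
  exists2 c : R, 0 < c & forall r, r \in s -> 0 < r -> c <= r.
Proof.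
elim: s => [|a s [c c0 h]]; first by exists 1.
have [a0|a0] := ltP 0 a; last first.
  exists c => // r; rewrite inE => /predU1P[->|]; last exact: h.
  by move=> /(le_lt_trans a0); rewrite ltxx.
exists (Num.min a c); first by rewrite lt_min a0.
move=> r; rewrite inE => /predU1P[-> _|rs r0]; first by rewrite ge_min lexx.
by rewrite ge_min h ?orbT.
Qed.

(** A simple function takes finitely many values, so that it is bounded, and
    bounded away from 0 where it is positive. *)
Lemma row_integral_le_simple n (f : 'rV[R]_n -> \bar R) (X : \bar R) :
  (forall v, 0 <= f v)%E ->
  (forall (h : 'rV[R]_n -> R) (c M : R), measurable_row (EFin \o h) -> 0 < c -> c <= M ->
    (forall v, h v = 0 \/ c <= h v <= M) -> (forall v, (h v)%:E <= f v)%E ->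
    (row_integral (EFin \o h) <= X)%E) ->
  (row_integral f <= X)%E.
Proof.
move=> f0 hX; rewrite /row_integral ge0_integralTE => [|t]; last exact: f0.
apply: ge_ereal_sup => _ [h hf <-].
have /finite_seqP[s sE] := fimfunP h.
have sP t : h t \in s by have : range h (h t); [exists t|rewrite sE].
have [c c0 hc] := finite_pos_lower_bound s.
have hM : exists2 M, c <= M & forall r, r \in s -> r <= M.
  elim: s {sE sP hc} => [|a s [M cM IH]]; first by exists c.
  exists (Num.max a M); first by rewrite le_max cM orbT.
  move=> r; rewrite inE => /predU1P[->|/IH rM]; first by rewrite le_max lexx.
  by rewrite le_max rM orbT.
have [M cM hM'] := hM.
rewrite -integralT_nnsfun.
rewrite (_ : integral _ _ _ = row_integral (fun v => (h (tuple_of_row v))%:E)); last first.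
  by apply: eq_integral => t _; rewrite row_of_tupleK.
apply: (hX (fun v => h (tuple_of_row v)) c M) => //.
- rewrite /measurable_row /=; under eq_fun do rewrite row_of_tupleK.
  by apply/measurable_EFinP; exact: measurable_funPT.
- move=> v; have : 0 <= h (tuple_of_row v) by [].
  rewrite le_eqVlt => /predU1P[<-|hv]; [by left|right].
  by rewrite hc ?sP//= hM'.
- by move=> v; have := hf (tuple_of_row v); rewrite tuple_of_rowK.
Qed.

Variable n : nat.
Local Notation full := ([set: 'I_n]%SET).
Implicit Types (S : {set 'I_n}) (x y z v : 'rV[R]_n).

Lemma row_integral_gt0_box (a b : 'rV[R]_n) (c : R) (h : 'rV[R]_n -> \bar R) :
  proper_box a b -> 0 < c -> (forall v, 0 <= h v)%E ->
  (forall v, box_within full a b v -> (c%:E <= h v)%E) -> (0 < row_integral h)%E.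
Proof.
move=> ab c0 h0 hc.
pose A i : set (measurableTypeR R) := `]a 0 i, b 0 i[%classic.
pose B := [set t : n.-tuple (measurableTypeR R) | forall i, A i (tnth t i)].
have mB : measurable B.
  rewrite (_ : B = \bigcap_(i in [set: 'I_n]) ((fun t => tnth t i) @^-1` A i)); last first.
    by apply/seteqP; split => [t tB i _|t tB i]; exact: tB.
  apply: fin_bigcap_measurable => // i _.
  rewrite -[X in measurable X]setTI; apply: measurable_tnth => //.
  exact: measurable_itv.
apply: (@lt_le_trans _ _ (\int[lebesgue_tuple n]_t (c%:E * (\1_B t)%:E))%E).
  rewrite ge0_integralZl_EFin//; last first.
  - exact: ltW.
  - by apply/measurable_EFinP; exact: measurable_indic.
  rewrite integral_indic// setIT mule_gt0 ?lte_fin//.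
  rewrite (_ : _ B = \prod_i leb (A i))%E; last first.
    by apply: (lebesgue_tuple_box (A := A)) => i; exact: measurable_itv.
  apply: (big_ind (fun x : \bar R => (0 < x)%E)); [by []|exact: mule_gt0|].
  by move=> i _; rewrite lebesgue_measure_itv /= lte_fin ab -EFinB lte_fin subr_gt0.
apply: ge0_le_integralT => t; first by rewrite -EFinM lee_fin mulr_ge0// ltW.
rewrite indicE; case: (boolP (t \in B)) => tB; last by rewrite mule0.
rewrite mule1; apply: hc; apply/box_withinP => i _; rewrite [row_of_tuple _ _ _]mxE.
by move: tB; rewrite inE => /(_ i); rewrite /A /= in_itv.
Qed.

Variable g : 'rV[R]_n -> R.
Hypothesis gc : geo_concave g.

Let g0 x : 0 <= g x. Proof. exact: gc.1. Qed.

Let powR_le (a s t : R) : 0 <= a -> 0 <= s -> s <= t -> s `^ a <= t `^ a.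
Proof.
move=> a0 s0 st; apply: ge0_ler_powR; rewrite ?nnegrE//; exact: le_trans st.
Qed.

(** The homothety maps a box on which [g] is at least [r] to a box on which
    log-concavity bounds [g] from below. *)
Lemma minorizes_near_homothety S r v x (l : R) : 0 <= r -> 0 < l < 1 ->
  minorizes_near g S r v ->
  minorizes_near g S (r `^ l * g x `^ (1 - l)) (l *: v + (1 - l) *: x).
Proof.
move=> r0 l01 [a [b [ab /box_withinP abv h]]]; have /andP[l0 l1] := l01.
have shift (s t q : R) : s < t -> l * s + q < l * t + q by rewrite ltrD2r ltr_pM2l.
exists (l *: a + (1 - l) *: x), (l *: b + (1 - l) *: x); split.
- by move=> i; rewrite !mxE; exact: shift.
- apply/box_withinP => i iS; have /andP[h1 h2] := abv i iS.
  by rewrite !mxE !shift.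
move=> y /box_withinP yab.
have -> : y = l *: (l^-1 *: (y - (1 - l) *: x)) + (1 - l) *: x.
  by rewrite scalerA mulfV ?gt_eqF// scale1r subrK.
apply: le_trans (gc.2 _ _ _ l01).
rewrite ler_wpM2r ?powR_ge0//; apply: powR_le => //; first exact: ltW.
apply: h; apply/box_withinP => i _; have := yab i (finset.in_setT i); rewrite !mxE.
move=> /andP[h1 h2]; rewrite ltr_pdivlMl// ltr_pdivrMl//.
by apply/andP; split; lra.
Qed.

Lemma minorizes_near_homothety_box x z a b c l : 0 <= c -> 0 < l < 1 ->
  proper_box a b -> box_within full a b z ->
  (forall y, box_within full a b y -> c <= g y) ->
  minorizes_near g full (g x `^ l * c `^ (1 - l)) (l *: x + (1 - l) *: z).
Proof.
move=> c0 /andP[l0 l1] ab abz h.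
have := @minorizes_near_homothety full c z x (1 - l) c0.
rewrite subKr [c `^ _ * _]mulrC [(1 - l) *: z + _]addrC; apply.
  by apply/andP; split; lra.
by exists a, b.
Qed.

Hypothesis gpos : (0 < row_integral (EFin \o g))%E.

(** The support of a simple function below [g] is contained in a convex set of the
    form [c <= g], which therefore contains a cube if the simple function has a
    positive integral. *)
Lemma positive_integral_box : exists a b c,
  [/\ proper_box a b, 0 < c & forall y, box_within full a b y -> c <= g y].
Proof.
apply: contrapT => nbox; move: gpos; apply/negP; rewrite -leNgt.
apply: row_integral_le_simple => [v|h c M mh c0 cM hv hg]; first by rewrite lee_fin.
rewrite leNgt; apply/negP => hpos; apply: nbox.
have h0 v : (0 <= (h v)%:E)%E.
  by rewrite lee_fin; have [->//|/andP[hc _]] := hv v; exact/ltW/(lt_le_trans c0).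
have [] := @convex_has_cube _ _ [set v | c <= g v] (EFin \o h) _ mh h0 _ hpos.
- move=> a x y /andP[a0 a1] /= cx cy.
  have [->|an0] := eqVneq a 0; first by rewrite scale0r add0r subr0 scale1r.
  have [->|an1] := eqVneq a 1; first by rewrite subrr scale0r addr0 scale1r.
  have a01 : 0 < a < 1 by rewrite !lt_neqAle a0 a1 eq_sym an0 an1.
  apply: le_trans (gc.2 _ _ _ a01).
  apply: (@le_trans _ _ (c `^ a * c `^ (1 - a))).
    rewrite -powRD; last by rewrite (gt_eqF c0) implybT.
    by rewrite addrC subrK powRr1// ltW.
  by apply: ler_pM; rewrite ?powR_ge0//; apply: powR_le => //; rewrite ?subr_ge0// ltW.
- move=> v /= hv0; have [hv00|/andP[hc _]] := hv v; first by rewrite hv00 eqxx in hv0.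
  by apply: le_trans hc _; rewrite -lee_fin.
move=> z [e e0 ze]; exists (z - const_mx e), (z + const_mx e), c; split => //.
  by move=> i; rewrite !mxE; lra.
move=> y /box_withinP yz; apply: ze => i; have := yz i (finset.in_setT i).
by rewrite !mxE ltr_norml => /andP[? ?]; apply/andP; split; lra.
Qed.

End envelope_of_concave.

Lemma onem_bernoulli (R : realFieldType) (t : R) k :
  0 <= t <= 1 -> 1 - k%:R * t <= (1 - t) ^+ k.
Proof.
move=> /andP[t0 t1]; elim: k => [|k IH]; first by rewrite mul0r subr0 expr0.
rewrite exprS -natr1; apply: (@le_trans _ _ ((1 - t) * (1 - k%:R * t))); last first.
  by rewrite ler_wpM2l// subr_ge0.
have : 0 <= k%:R * t * t by rewrite !mulr_ge0.
by nra.
Qed.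

Section level_volumes.
Context {R : realType} {n : nat}.
Local Notation leb := (@lebesgue_measure R).
Local Notation full := ([set: 'I_n]%SET).
Implicit Types (S : {set 'I_n}) (x y z v : 'rV[R]_n).

Lemma row_integral_homothety (l : R) z (h : 'rV[R]_n -> \bar R) : 0 < l ->
  measurable_row h -> (forall v, 0 <= h v)%E ->
  row_integral h = ((l ^+ n)%:E * row_integral (fun v => h (l *: v + z)%R))%E.
Proof.
move=> l0 mh h0.
have uA : (l%:M : 'M[R]_n) \in unitmx.
  by rewrite unitmxE det_scalar unitrX// unitfE gt_eqF.
rewrite -(row_integral_shift z mh h0) (scales_volume_unit uA)//; last first.
  exact: measurable_row_shift.
rewrite det_scalar ger0_norm ?exprn_ge0 ?ltW//; congr (_ * _)%E.
by apply: eq_row_integral => v; rewrite mul_mx_scalar.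
Qed.

Variable g : 'rV[R]_n -> R.
Hypothesis gc : geo_concave g.

Let g0 x : 0 <= g x. Proof. exact: gc.1. Qed.

(** Let [z] be the centre of a box on which [g >= c], and [h <= g] a simple
    function with [h <= M].  By log-concavity the envelope at the point
    [(1 - t) v + t z] is at least [g(v)^(1-t) c^t], hence at least
    [(c / M)^t h(v)].  Substituting this point in the integral costs a factor
    [(1 - t)^n]; both factors tend to 1 with [t] tending to 0. *)
Lemma row_integral_le_envelope :
  (row_integral (EFin \o g) <= row_integral (envelope g full))%E.
Proof.
have env0 v : (0 <= envelope g full v)%E by exact: envelope_ge0.
have [gpos|] := ltP 0%E (row_integral (EFin \o g)); last first.
  by move=> /le_trans; apply; exact: row_integral_ge0.
have [a [b [c [ab c0 gab]]]] := positive_integral_box gc gpos.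
pose z : 'rV[R]_n := 2^-1 *: (a + b).
have abz : box_within full a b z.
  by apply/box_withinP => i _; rewrite !mxE; have := ab i => ?; apply/andP; split; lra.
apply: row_integral_le_simple => [v|h e M mh e0 eM hv hg]; first by rewrite lee_fin.
have M0 : 0 < M by exact: lt_le_trans eM.
have h0 v : 0 <= h v by have [->//|/andP[hc _]] := hv v; exact/ltW/(lt_le_trans e0).
have hM v : h v <= M by have [->|/andP[]//] := hv v; exact: ltW.
pose L := Num.max 0 (- ln (c / M)).
have L0 : 0 <= L by rewrite le_max lexx.
apply: (@lee_onem_limit _ (n%:R + L)).
- by rewrite addr_ge0.
- by apply: row_integral_ge0 => v; rewrite lee_fin.
- exact: row_integral_ge0.
move=> t /andP[t0 t1]; pose l := 1 - t.
have l01 : 0 < l < 1 by rewrite /l; apply/andP; split; lra.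
have l0 : 0 < l by case/andP: l01.
rewrite [leRHS](row_integral_homothety ((1 - l) *: z) l0)//; last exact: measurable_envelope.
apply: (@le_trans _ _ ((l ^+ n)%:E * row_integral (fun v => ((c / M) `^ t)%:E * (h v)%:E))%E).
  rewrite row_integralZl ?powR_ge0//.
  rewrite muleA -EFinM lee_wpmul2r//; first by apply: row_integral_ge0 => v; rewrite lee_fin.
  rewrite lee_fin.
  have ln1 : 1 - n%:R * t <= l ^+ n by apply: onem_bernoulli; rewrite !ltW.
  have cM : 1 - L * t <= (c / M) `^ t.
    rewrite /powR gt_eqF ?divr_gt0//; apply: le_trans (expR_ge1Dx _).
    have : - ln (c / M) <= L by rewrite le_max lexx orbT.
    by nra.
  have [Lt|Lt] := leP (1 - L * t) 0.
    apply: (@le_trans _ _ 0); last by rewrite mulr_ge0 ?powR_ge0 ?exprn_ge0 ?ltW.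
    have : 0 <= n%:R * t by rewrite mulr_ge0// ltW.
    by lra.
  have [nt|nt] := leP (1 - n%:R * t) 0.
    apply: (@le_trans _ _ 0); last by rewrite mulr_ge0 ?powR_ge0 ?exprn_ge0 ?ltW.
    have : 0 <= L * t by rewrite mulr_ge0// ltW.
    by lra.
  apply: (@le_trans _ _ ((1 - n%:R * t) * (1 - L * t))); last by rewrite ler_pM// ltW.
  have : 0 <= (n%:R * t) * (L * t) by rewrite !mulr_ge0// ltW.
  by lra.
rewrite lee_wpmul2l ?lee_fin ?exprn_ge0 ?(ltW l0)//.
apply: le_row_integral => v; first by rewrite -EFinM lee_fin mulr_ge0 ?powR_ge0.
apply: (@le_trans _ _ (g v `^ l * c `^ (1 - l))%:E); last first.
  apply: le_ereal_sup_tmp; exists (g v `^ l * c `^ (1 - l))%:E => //.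
  exists (g v `^ l * c `^ (1 - l)) => //.
  by apply: (minorizes_near_homothety_box gc _ (ltW c0) l01 ab abz gab).
rewrite -EFinM lee_fin (_ : 1 - l = t); last by rewrite /l; ring.
have [->|/andP[ehv _]] := hv v; first by rewrite mulr0 mulr_ge0 ?powR_ge0.
have hv0 : 0 < h v by exact: lt_le_trans ehv.
have hE : h v = h v `^ l * h v `^ t.
  rewrite -powRD; last by rewrite (gt_eqF hv0) implybT.
  by rewrite /l subrK powRr1.
have cE : c `^ t = (c / M) `^ t * M `^ t.
  by rewrite -powRM ?divr_ge0 ?ltW// divfK// gt_eqF.
rewrite hE cE [leRHS]mulrCA ler_wpM2l ?powR_ge0// ler_pM ?powR_ge0//.
  by apply: ge0_ler_powR; rewrite ?nnegrE ?(ltW l0)// -lee_fin.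
by apply: ge0_ler_powR; rewrite ?nnegrE ?(ltW t0) ?(ltW M0).
Qed.

Definition level_volume S (r : R) : \bar R :=
  partial_integral S (fun v => ((r%:E < envelope g S v)%E%:R)%:E).

(** Only the coordinates in [S] are scaled, so that the unit cube in the other
    ones stays in place and the determinant is the power [#|S|]. *)
Lemma partial_integral_homothety S (l : R) z (h k : 'rV[R]_n -> \bar R) :
  0 < l -> measurable_row k -> (forall v, 0 <= h v)%E -> (forall v, 0 <= k v)%E ->
  depends_on S k -> (forall v, h v <= k (l *: v + z)%R)%E ->
  ((l ^+ #|S|)%:E * partial_integral S h <= partial_integral S k)%E.
Proof.
move=> l0 mk h0 k0 kS hk.
pose D : 'M[R]_n := diag_mx (\row_i (if i \in S then l else 1)).
pose w : 'rV[R]_n := \row_i (if i \in S then z 0 i else 0).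
have detD : \det D = l ^+ #|S|.
  rewrite det_diag -prodr_const [RHS]big_mkcond.
  by apply: eq_bigr => i _; rewrite mxE.
have uD : D \in unitmx by rewrite unitmxE detD unitrX// unitfE gt_eqF.
have DE v i : (v *m D + w) 0 i = if i \in S then l * v 0 i + z 0 i else v 0 i.
  rewrite mxE mul_mx_diag !mxE; case: ifP => _; first by rewrite mulrC.
  by rewrite mulr1 addr0.
pose F v := (k v * (unit_cube_off S v)%:R%:E)%E.
have mF : measurable_row F by exact: measurable_partial_integrand.
have F0 v : (0 <= F v)%E by rewrite mule_ge0// lee_fin.
rewrite -[leRHS](row_integral_shift w mF F0).
rewrite (scales_volume_unit uD) => [||v]; last 2 first.
- exact: (measurable_row_shift w mF).
- exact: F0.
rewrite detD ger0_norm ?exprn_ge0 ?(ltW l0)// lee_wpmul2l ?lee_fin ?exprn_ge0 ?(ltW l0)//.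
apply: le_row_integral => v; first by rewrite mule_ge0// lee_fin.
rewrite /F (_ : unit_cube_off S (v *m D + w) = unit_cube_off S v); last first.
  apply: eq_forallb => i; rewrite DE; by case: ifP.
rewrite lee_wpmul2r ?lee_fin//; apply: le_trans (hk v) _.
rewrite (kS _ (v *m D + w)) => [//|i iS].
by rewrite DE iS !mxE.
Qed.

Lemma measurable_level S r :
  measurable_row (fun v => ((r%:E < envelope g S v)%E%:R)%:E : \bar R).
Proof.
apply/measurable_EFinP; apply: measurable_fun_natr_bool.
apply: measurable_fun_lte => //; exact: measurable_envelope.
Qed.

Lemma level_depends_on S r :
  depends_on S (fun v => ((r%:E < envelope g S v)%E%:R)%:E : \bar R).
Proof. by move=> u v uv; rewrite (envelope_depends_on g uv). Qed.

Lemma level_volume_ge0 S r : (0 <= level_volume S r)%E.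
Proof. by apply: partial_integral_ge0 => v; rewrite lee_fin. Qed.

Lemma level_volume_nonincreasing S r s : r <= s ->
  (level_volume S s <= level_volume S r)%E.
Proof.
move=> rs; apply: le_row_integral => v; first by rewrite mule_ge0// lee_fin.
rewrite lee_wpmul2r ?lee_fin// ler_nat.
by case: ltP => // se; rewrite (le_lt_trans _ se)// lee_fin.
Qed.

(** By log-concavity, the homothety with centre [x] and ratio [l] maps the level
    set at [r] into the level set at [s]. *)
Lemma level_volume_homothety S (r s l : R) x : 0 < l < 1 -> 0 <= r ->
  s <= r `^ l * g x `^ (1 - l) -> 0 < g x ->
  ((l ^+ #|S|)%:E * level_volume S r <= level_volume S s)%E.
Proof.
move=> l01 r0 sx gx; have /andP[l0 l1] := l01.
apply: (@partial_integral_homothety S l ((1 - l) *: x)) => //.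
- exact: measurable_level.
- exact: level_depends_on.
move=> v; rewrite lee_fin ler_nat.
have [/envelope_gtP[t rt tv]|//] := boolP (r%:E < envelope g S v)%E.
rewrite (_ : (_ < _)%E = true)//; apply/envelope_gtP.
exists (t `^ l * g x `^ (1 - l)).
  apply: le_lt_trans sx _; rewrite ltr_pM2r ?powR_gt0//.
  apply: gt0_ltr_powR; rewrite ?nnegrE//; exact: le_trans (ltW rt).
apply: minorizes_near_homothety => //; exact: le_trans (ltW rt).
Qed.

End level_volumes.

(** * The layer cake formula *)

Section level_sets.
Context {R : realType} {n : nat}.
Local Notation leb := (@lebesgue_measure R).
Local Notation full := ([set: 'I_n]%SET).
Implicit Types (S : {set 'I_n}) (x y v : 'rV[R]_n).

Variable g : 'rV[R]_n -> R.
Hypothesis gc : geo_concave g.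

Let g0 x : 0 <= g x. Proof. exact: gc.1. Qed.

Variable M : R.
Hypotheses (M0 : 0 < M) (gM : forall x, g x <= M).

Lemma envelope_le_sup S v : (envelope g S v <= M%:E)%E.
Proof. by apply: envelope_le_bound => y _; rewrite lee_fin. Qed.

Let env0 S v : (0 <= envelope g S v)%E.
Proof. exact: envelope_ge0. Qed.

Lemma envelope_fin S v : envelope g S v \is a fin_num.
Proof. by rewrite ge0_fin_numE// (le_lt_trans (envelope_le_sup S v))// ltry. Qed.

Let F S (z : n.-tuple (measurableTypeR R) * measurableTypeR R) : \bar R :=
  ((((0 < z.2) && (z.2 < 1)) && ((M * z.2)%:E < envelope g S (row_of_tuple z.1))%E)%:R%:E *
  (unit_cube_off S (row_of_tuple z.1))%:R%:E)%E.

Let F0 S z : (0 <= F S z)%E.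
Proof. by rewrite mule_ge0// lee_fin. Qed.

Let mF S : measurable_fun setT (F S).
Proof.
apply: emeasurable_funM; last first.
  apply: (measurableT_comp (measurable_unit_cube_off S)); exact: measurable_fst.
apply/measurable_EFinP; apply: measurable_fun_natr_bool.
apply: measurable_and.
  by apply: measurable_and; exact: measurable_fun_ltr.
apply: measurable_fun_lte.
  by apply/measurable_EFinP; exact: measurable_funM.
by apply: (measurableT_comp (measurable_envelope g S)); exact: measurable_fst.
Qed.

Let FE S (r : measurableTypeR R) : (\int[lebesgue_tuple n]_t F S (t, r) =
  (((0 < r) && (r < 1))%R%:R)%:E * level_volume g S (M * r)%R)%E.
Proof.
rewrite /level_volume /partial_integral -row_integralZl//; last first.
  by apply: measurable_partial_integrand; exact: measurable_level.
apply: eq_integral => t _; rewrite /F /= muleA; congr (_ * _)%E.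
by rewrite -EFinM -natrM mulnb.
Qed.

Lemma measurable_level_volume S :
  measurable_fun (`]0%R, 1%R[%classic : set (measurableTypeR R)) (fun r => level_volume g S (M * r)%R).
Proof.
have [mu muE] := lebesgue_tuple_measure (R := R) n.
apply: (eq_measurable_fun (fubini_G mu (F S))); last first.
  apply: measurable_funTS.
  exact: (measurable_fun_fubini_tonelli_G (m1 := mu) (F S) (@mF S) (@F0 S)).
move=> r; rewrite inE /= in_itv /= => r01.
transitivity (\int[lebesgue_tuple n]_t F S (t, r))%E; first by rewrite /fubini_G muE.
by rewrite FE r01 mul1e.
Qed.

(** Tonelli's theorem for the indicator of the region below the graph of the
    envelope, with the heights measured in units of [M]. *)
Lemma layer_cake S : partial_integral S (envelope g S) =
  (M%:E * \int[leb]_(r in `]0%R, 1%R[) level_volume g S (M * r)%R)%E.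
Proof.
have [mu muE] := lebesgue_tuple_measure (R := R) n.
have -> : (\int[leb]_(r in `]0%R, 1%R[) level_volume g S (M * r)%R =
    \int[leb]_r \int[mu]_t F S (t, r))%E.
  rewrite integral_mkcond; apply: eq_integral => r _; rewrite patchE.
  transitivity (\int[lebesgue_tuple n]_t F S (t, r))%E; last by rewrite muE.
  rewrite FE.
  rewrite (_ : (r \in _) = (0 < r < 1)); last by apply/idP/idP; rewrite inE /= in_itv.
  by case: ifP => _; rewrite ?mul1e ?mul0e.
rewrite -(fubini_tonelli (m1 := mu) (m2 := leb) (F S) (@mF S) (@F0 S)).
rewrite -ge0_integralZl_EFin//; last 3 first.
- by move=> t _; exact: integral_ge0.
- exact: (measurable_fun_fubini_tonelli_F (m2 := leb) (F S) (@mF S) (@F0 S)).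
- exact: ltW.
rewrite /partial_integral /row_integral muE; apply: eq_integral => t _.
set v := row_of_tuple t.
have [w wE] : exists w, envelope g S v = w%:E.
  by exists (fine (envelope g S v)); rewrite fineK// envelope_fin.
have w0 : 0 <= w by rewrite -lee_fin -wE.
have wM : w <= M by rewrite -lee_fin -wE envelope_le_sup.
rewrite wE (_ : integral _ _ _ = \int[leb]_(r in `]0%R, (w / M)%R[) (unit_cube_off S v)%:R%:E)%E; last first.
  rewrite [RHS]integral_mkcond; apply: eq_integral => r _; rewrite patchE /F /= -/v wE lte_fin.
  rewrite (_ : (r \in _) = ((0 < r < 1) && (M * r < w))).
    by case: ifP => _; rewrite ?mul1e ?mul0e.
  apply/idP/idP; rewrite inE /= in_itv /= ltr_pdivlMr// mulrC.
    move=> /andP[r0 rw]; rewrite r0 rw/= andbT.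
    by rewrite -(ltr_pM2l M0) mulr1 (lt_le_trans rw wM).
  by move=> /andP[/andP[-> _] ->].
rewrite integral_cst//= lebesgue_measure_itv /= lte_fin.
case: ifPn => [_|].
  by rewrite oppr0 adde0 muleCA -!EFinM (mulrC M) divfK ?gt_eqF// mulrC.
rewrite -leNgt pmulr_lle0 ?invr_gt0// => w00.
by rewrite (_ : w = 0) ?mul0e ?mule0//; apply/eqP; rewrite eq_le w00.
Qed.

End level_sets.

(** * The inequality in coordinates *)

Lemma powR_sum (R : realType) (I : finType) (x : R) (p : I -> R) : 0 < x ->
  x `^ (\sum_i p i) = \prod_i x `^ p i.
Proof.
move=> x0; apply: (big_morph (powR x)); last exact: powRr0.
by move=> a b; rewrite powRD// (gt_eqF x0) implybT.
Qed.

Section coordinate_inequality.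
Context {R : realType} {n : nat}.
Local Notation leb := (@lebesgue_measure R).
Local Notation full := ([set: 'I_n]%SET).
Implicit Types (S : {set 'I_n}) (x y v : 'rV[R]_n).

Variable g : 'rV[R]_n -> R.
Hypothesis gc : geo_concave g.
Let g0 x : 0 <= g x. Proof. exact: gc.1. Qed.

Variable M : R.
Hypotheses (M0 : 0 < M) (gM : forall x, g x <= M).
Hypothesis Msup : forall r, r < M -> exists x, r < g x.

(** If [g] attained its supremum [M] at [x], contracting by the ratio
    [q = ln s / ln r] towards [x] would map the level set at [M r] into the one
    at [M r^q = M s].  In general contract by slightly less than [q] towards a
    point where [g] is almost [M]. *)
Lemma level_volume_star S r s : r \in `]0, 1[ -> s \in `]0, 1[ -> r <= s ->
  ((neg_log s ^+ #|S|)%:E * level_volume g S (M * r) <=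
   (neg_log r ^+ #|S|)%:E * level_volume g S (M * s))%E.
Proof.
move=> r01 s01; rewrite le_eqVlt => /predU1P[->//|rs].
have lr := neg_log_gt0 r01; have ls := neg_log_gt0 s01.
have [r0 r1] : 0 < r /\ r < 1 by move: r01; rewrite in_itv /= => /andP[].
have [s0 s1] : 0 < s /\ s < 1 by move: s01; rewrite in_itv /= => /andP[].
pose q := neg_log s / neg_log r.
have q0 : 0 < q by rewrite divr_gt0.
have q1 : q < 1 by rewrite ltr_pdivrMr// mul1r /neg_log ltrN2 ltr_ln.
suff h : ((q ^+ #|S|)%:E * level_volume g S (M * r) <= level_volume g S (M * s))%E.
  have -> : neg_log s ^+ #|S| = neg_log r ^+ #|S| * q ^+ #|S|.
    by rewrite -exprMn mulrC divfK// gt_eqF.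
  by rewrite EFinM -muleA lee_wpmul2l// lee_fin exprn_ge0// ltW.
apply: (@lee_onem_limit _ #|S|%:R) => //.
- by rewrite mule_ge0 ?level_volume_ge0// lee_fin exprn_ge0// ltW.
- exact: level_volume_ge0.
move=> t /andP[t0 t1]; pose l := q * (1 - t).
have l0 : 0 < l by rewrite mulr_gt0// subr_gt0.
have lq : l < q by rewrite /l gtr_pMr// ltrBlDr ltrDl.
have l1 : l < 1 by exact: lt_trans lq q1.
(* Chosen such that [r^l exp(e)^(1-l) = s]; so [x] need only satisfy
   [M exp(e) < g x]. *)
pose e := (l * neg_log r - neg_log s) / (1 - l).
have e0 : e < 0.
  rewrite pmulr_llt0 ?invr_gt0 ?subr_gt0// subr_lt0.
  by rewrite -ltr_pdivlMr.
have [x gx] : exists x, M * expR e < g x.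
  by apply: Msup; rewrite gtr_pMr// -expR0 ltr_expR.
apply: (@le_trans _ _ ((l ^+ #|S|)%:E * level_volume g S (M * r))%E).
  rewrite muleA -EFinM lee_wpmul2r ?level_volume_ge0// lee_fin.
  rewrite /l [(q * _) ^+ _]exprMn [leLHS]mulrC ler_wpM2l ?exprn_ge0 ?(ltW q0)//.
  by apply: onem_bernoulli; rewrite !ltW.
apply: (@level_volume_homothety _ _ _ gc _ _ _ _ x) => //.
- by rewrite l0.
- by rewrite mulr_ge0// ltW.
- apply: (@le_trans _ _ ((M * r) `^ l * (M * expR e) `^ (1 - l))); last first.
    rewrite ler_wpM2l ?powR_ge0//; apply: ge0_ler_powR; rewrite ?nnegrE ?subr_ge0 ?(ltW l1) ?(ltW gx)//.
    by rewrite mulr_ge0 ?expR_ge0// ltW.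
  rewrite !powRM ?expR_ge0 ?(ltW M0) ?(ltW r0)// mulrACA -powRD; last by rewrite (gt_eqF M0) implybT.
  rewrite addrC subrK powRr1 ?(ltW M0)// -expRM /powR (gt_eqF r0) -expRD.
  rewrite /e divfK ?gt_eqF ?subr_gt0// {1}/neg_log.
  by rewrite mulrN addrA subrr add0r /neg_log opprK lnK ?posrE.
- by apply: le_lt_trans gx; rewrite mulr_ge0 ?expR_ge0// ltW.
Qed.

Hypothesis gpos : (0 < row_integral (EFin \o g))%E.

Lemma partial_integral_envelope_gt0 S : (0 < partial_integral S (envelope g S))%E.
Proof.
have [a [b [c [ab c0 gab]]]] := positive_integral_box gc gpos.
pose a' : 'rV[R]_n := \row_i (if i \in S then a 0 i else 0).
pose b' : 'rV[R]_n := \row_i (if i \in S then b 0 i else 1).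
apply: (@row_integral_gt0_box _ _ a' b' c) => //.
- by move=> i; rewrite !mxE; case: ifP => _; [exact: ab|exact: ltr01].
- by move=> v; rewrite mule_ge0 ?lee_fin// envelope_ge0.
move=> v /box_withinP vab.
rewrite (_ : unit_cube_off S v = true) ?mule1.
  apply: le_ereal_sup_tmp; exists c%:E => //; exists c => //.
  exists a, b; split => //; apply/box_withinP => i iS.
  by have := vab i (finset.in_setT i); rewrite !mxE iS.
apply/forallP => i; apply/implyP => /negPf iS.
by have := vab i (finset.in_setT i); rewrite !mxE iS => /andP[/ltW -> /ltW ->].
Qed.

(** Markov's inequality. *)
Lemma level_volume_fin S r : r \in `]0, 1[ ->
  (partial_integral S (envelope g S) < +oo)%E ->
  level_volume g S (M * r) \is a fin_num.
Proof.
rewrite in_itv /= => /andP[r0 r1] fin.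
rewrite ge0_fin_numE ?level_volume_ge0// ltey; apply/eqP => Uy.
suff : ((M * r)%:E * level_volume g S (M * r) <= partial_integral S (envelope g S))%E.
  by rewrite Uy gt0_muley ?lte_fin ?mulr_gt0// leye_eq => /eqP h; rewrite h in fin.
rewrite -row_integralZl ?mulr_ge0 ?(ltW M0) ?(ltW r0)//; last first.
  by apply: measurable_partial_integrand; exact: measurable_level.
apply: le_row_integral => v.
  by rewrite -!EFinM lee_fin !mulr_ge0// ltW.
rewrite muleA lee_wpmul2r ?lee_fin//.
by case: ltP => [/ltW|_]; rewrite ?mule1// mule0 envelope_ge0.
Qed.

Variables (m : nat) (S : 'I_m -> {set 'I_n}) (p : 'I_m -> R).
Hypotheses (p0 : forall j, 0 < p j)
  (Sp : forall i, \sum_j p j * (i \in S j)%:R = 1).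

(** Double counting: sum the cover identity over the coordinates. *)
Lemma uniform_cover_card : \sum_j p j * #|S j|%:R = n%:R.
Proof.
under eq_bigr do rewrite -sum1_card natr_sum mulr_sumr big_mkcond.
rewrite exchange_big /= (eq_bigr (fun=> 1)) ?sumr_const ?card_ord// => i _.
rewrite -[RHS](Sp i); apply: eq_bigr => j _.
by case: ifP; rewrite ?mulr0.
Qed.

(** The level set of the full envelope is contained in the level sets of all
    the others, whose indicators depend on the coordinates in [S j] only. *)
Lemma level_volume_finner r :
  (level_volume g full r <= \prod_j level_volume g (S j) r `^ p j)%E.
Proof.
apply: le_trans (finner p0 Sp _ _ _); last 3 first.
- by move=> j; exact: measurable_level.
- by move=> j v; rewrite lee_fin.
- by move=> j; exact: level_depends_on.
apply: le_row_integral => v; first by rewrite mule_ge0// lee_fin.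
have [rv|_] := boolP (r%:E < envelope g full v)%E; last first.
  by rewrite mul0e; apply: prode_ge0 => j _; exact: poweR_ge0.
rewrite mul1e big1 ?lee_fin ?lern1 ?leq_b1// => j _.
by rewrite (lt_le_trans rv (le_envelope g (S j) v)) poweR1r.
Qed.

(** With [u_j(r) := level_volume g (S j) (M r)], Finner's inequality gives
    [int g / M <= int_0^1 prod_j u_j^(p_j)], and Berwald's inequality bounds the
    right-hand side by means of the integrals of the [u_j], which are those of
    the envelopes divided by [M]. *)
Lemma coordinate_inequality :
  ((M `^ (\sum_j p j - 1))%:E * row_integral (EFin \o g) <=
    (n`!%:R / \prod_j (#|S j|)`!%:R `^ p j)%:E *
    \prod_j partial_integral (S j) (envelope g (S j)) `^ p j)%E.
Proof.
pose J j := partial_integral (S j) (envelope g (S j)).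
have J0 j : (0 < J j)%E by exact: partial_integral_envelope_gt0.
pose C := n`!%:R / \prod_j (#|S j|)`!%:R `^ p j.
have fact0 k : 0 < k`!%:R :> R by rewrite ltr0n fact_gt0.
have den0 : 0 < \prod_j (#|S j|)`!%:R `^ p j :> R.
  by apply: prodr_gt0 => j _; rewrite powR_gt0.
have C0 : 0 < C by rewrite divr_gt0.
rewrite -/C.
have [[i Ji]|Jfin] := pselect (exists i, J i = +oo%E).
  rewrite (_ : \prod_j _ = +oo)%E ?gt0_muley ?leey ?lte_fin//.
  rewrite (bigD1 i)//= -/(J i) Ji poweRyr ?gt_eqF ?p0// gt0_mulye//.
  apply: (big_ind (fun x : \bar R => (0 < x)%E)); [by []|exact: mule_gt0|].
  by move=> j _; rewrite poweR_gt0 ?J0.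
have {}Jfin j : (J j < +oo)%E.
  by rewrite ltey; apply/eqP => Jj; apply: Jfin; exists j.
pose I j := fine (J j).
have JE j : J j = (I j)%:E by rewrite fineK// ge0_fin_numE// ltW.
have I0 j : 0 < I j by rewrite -lte_fin -JE.
have Ufin j r : r \in `]0, 1[ -> level_volume g (S j) (M * r) \is a fin_num.
  by move=> r01; apply: level_volume_fin => //; exact: Jfin.
pose u j r := fine (level_volume g (S j) (M * r)).
have uE j r : r \in `]0, 1[ -> (u j r)%:E = level_volume g (S j) (M * r).
  by move=> r01; rewrite fineK// Ufin.
pose A j := I j / (M * (#|S j|)`!%:R).
have A0 j : 0 < A j by rewrite divr_gt0// mulr_gt0.
have intu j : (\int[leb]_(r in `]0%R, 1%R[) (u j r)%:E = ((#|S j|)`!%:R * A j)%:E)%E.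
  transitivity (\int[leb]_(r in `]0%R, 1%R[) level_volume g (S j) (M * r)%R)%E.
    by apply: eq_integral => r; rewrite inE => r01; rewrite uE.
  have := layer_cake gc M0 gM (S j); rewrite -/(J j) JE => h.
  have -> : (#|S j|)`!%:R * A j = M^-1 * I j.
    by rewrite /A; field; rewrite !gt_eqF.
  by rewrite EFinM h muleA -EFinM mulVf ?mul1e// gt_eqF.
have key : (\int[leb]_(r in `]0%R, 1%R[) (\prod_j u j r `^ p j)%:E <=
    (n`!%:R * \prod_j A j `^ p j)%:E)%E.
  apply: (@berwald_product _ m n (fun j => #|S j|)) => //.
  - by move=> j; rewrite -[leqRHS](card_ord n) max_card.
  - exact: uniform_cover_card.
  - by move=> j r r01; rewrite fine_ge0// level_volume_ge0.
  - move=> j r s r01 s01 rs; rewrite -lee_fin !uE//.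
    by apply: level_volume_nonincreasing; rewrite ler_pM2l.
  - move=> j r s r01 s01 rs; rewrite -lee_fin !EFinM !uE//.
    by rewrite muleC [leRHS]muleC; exact: level_volume_star.
  - move=> j; apply/measurable_EFinP; apply: (eq_measurable_fun (fun r => level_volume g (S j) (M * r))).
      by move=> r; rewrite inE => r01; rewrite /= uE.
    exact: measurable_level_volume.
have step : (row_integral (EFin \o g) <= M%:E * (n`!%:R * \prod_j A j `^ p j)%:E)%E.
  apply: le_trans (row_integral_le_envelope gc) _.
  have -> : row_integral (envelope g full) = partial_integral full (envelope g full).
    apply: eq_row_integral => v; rewrite (_ : unit_cube_off _ _ = true) ?mule1//.
    by apply/forallP => i; rewrite finset.in_setT.
  rewrite (layer_cake gc M0 gM) lee_wpmul2l ?lee_fin ?(ltW M0)//; apply: le_trans key.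
  apply: ge0_le_integral => //.
  - by move=> r _; exact: level_volume_ge0.
  - exact: measurable_level_volume.
  - apply/measurable_EFinP; apply: measurable_prod => j _.
    apply: (measurableT_comp (measurable_powR _)).
    apply/measurable_EFinP; apply: (eq_measurable_fun (fun r => level_volume g (S j) (M * r))).
      by move=> r; rewrite inE => r01; rewrite /= uE.
    exact: measurable_level_volume.
  - move=> r r01; apply: le_trans (level_volume_finner _) _.
    rewrite -prodEFin le_eqVlt; apply/orP; left; apply/eqP; apply: eq_bigr => j _.
    by rewrite -uE// poweR_EFin.
apply: (@le_trans _ _ ((M `^ (\sum_j p j - 1))%:E * (M%:E * (n`!%:R * \prod_j A j `^ p j)%:E))%E).
  by rewrite lee_wpmul2l// lee_fin powR_ge0.
rewrite (eq_bigr (fun j => (I j `^ p j)%:E)); last by move=> j _; rewrite -/(J j) JE poweR_EFin.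
rewrite prodEFin -!EFinM lee_fin mulrA -{2}(powRr1 (ltW M0)) -powRD; last first.
  by rewrite (gt_eqF M0) implybT.
rewrite subrK powR_sum// mulrCA -big_split /= /C -mulrA ler_pM2l// mulrC ler_pdivlMr//.
rewrite -big_split le_eqVlt; apply/orP; left; apply/eqP; apply: eq_bigr => j _ /=.
rewrite -!powRM ?(mulr_ge0 (ltW M0) (ltW (A0 j))) ?(ltW M0) ?(ltW (A0 _)) ?(ltW (fact0 _))//.
by congr (_ `^ _); rewrite /A; field; rewrite !gt_eqF.
Qed.

End coordinate_inequality.

(** * Boundedness of integrable log-concave functions *)

Section bounded.
Context {R : realType} {n : nat}.
Local Notation full := ([set: 'I_n]%SET).

(** Let [U] be the volume of the level set at [c / 2].  Contracting it by one half
    towards [x] gives a set of volume [2^-n U] on which [g] is at least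
    [(c / 2)^(1/2) g(x)^(1/2)]; since the integral of [g] is finite, this bounds
    [g(x)]. *)
Lemma geo_concave_bounded (g : 'rV[R]_n -> R) : geo_concave g ->
  (0 < row_integral (EFin \o g))%E -> (row_integral (EFin \o g) < +oo)%E ->
  exists B, forall x, g x <= B.
Proof.
move=> gc gpos gfin; have g0 := gc.1.
have [a [b [c [ab c0 gab]]]] := positive_integral_box gc gpos.
have c20 : 0 < c / 2 by lra.
have Upos : (0 < level_volume g full (c / 2))%E.
  apply: (@row_integral_gt0_box _ _ a b 1) => //.
  move=> v vab; rewrite (_ : unit_cube_off _ _ = true); last first.
    by apply/forallP => i; rewrite finset.in_setT.
  rewrite mule1 (_ : (_ < _)%E = true)//; apply/envelope_gtP.
  by exists c; [lra|exists a, b].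
have lev r : 0 <= r -> (r%:E * level_volume g full r <= row_integral (EFin \o g))%E.
  move=> r0; rewrite -row_integralZl//; last first.
    by apply: measurable_partial_integrand; exact: measurable_level.
  apply: le_row_integral => v; first by rewrite -!EFinM lee_fin !mulr_ge0.
  apply: (@le_trans _ _ (envelope g full v)); last exact: envelope_setT_le.
  case: ltP => [/ltW rv|_]; last by rewrite mul0e mule0 envelope_ge0.
  by case: unit_cube_off; rewrite ?mul1e ?mule1// ?mul0e ?mule0 envelope_ge0.
pose I := fine (row_integral (EFin \o g)).
have IE : row_integral (EFin \o g) = I%:E by rewrite fineK// ge0_fin_numE// ltW.
have Ufin : level_volume g full (c / 2) \is a fin_num.
  rewrite ge0_fin_numE ?(ltW Upos)// ltey; apply/eqP => Uy.
  have := lev _ (ltW c20); rewrite Uy gt0_muley ?lte_fin// IE.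
  by rewrite leye_eq => /eqP.
pose U := fine (level_volume g full (c / 2)).
have UE : level_volume g full (c / 2) = U%:E by rewrite fineK.
have U0 : 0 < U by rewrite -lte_fin -UE.
pose K := (c / 2) `^ 2^-1 * ((2^-1) ^+ n * U).
have K0 : 0 < K by rewrite !mulr_gt0 ?powR_gt0// exprn_gt0.
exists ((I / K) ^+ 2) => x.
have [gx|gx] := ltP 0 (g x); last by apply: le_trans gx _; exact: sqr_ge0.
have h2 : 0 < (2^-1 : R) < 1 by apply/andP; split; lra.
have := level_volume_homothety gc full h2 (ltW c20) (lexx _) gx.
rewrite cardsT card_ord UE -EFinM => h.
have r0 : 0 <= (c / 2) `^ 2^-1 * g x `^ (1 - 2^-1) by rewrite mulr_ge0 ?powR_ge0.
have := lev _ r0; rewrite IE => h'.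
have := le_trans (lee_wpmul2l _ h) h'; rewrite lee_fin r0 => /(_ isT).
rewrite -EFinM lee_fin => h3.
have : g x `^ 2^-1 <= I / K.
  rewrite ler_pdivlMr//; apply: le_trans h3.
  rewrite (_ : 1 - 2^-1 = 2^-1); last by field.
  by rewrite le_eqVlt; apply/orP; left; apply/eqP; rewrite /K; ring.
move=> h4; rewrite -[leLHS]powRr1// (_ : 1 = 2^-1 * 2%:R); last by rewrite mulVf.
rewrite powRrM powR_mulrn ?powR_ge0//.
by apply: lerXn2r; rewrite ?nnegrE ?powR_ge0//; exact: le_trans (powR_ge0 _ _) h4.
Qed.

End bounded.

Section linear_change_lower_integral.
Context {R : realType}.

(** The substitution rule for the simple functions below [f] proves one inequality
    between the suprema; the other one is the same inequality for the inverse
    matrix. *)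
Lemma row_integral_unitmx n (A : 'M[R]_n) (f : 'rV[R]_n -> \bar R) :
  A \in unitmx -> (forall v, 0 <= f v)%E ->
  row_integral f = (`|\det A|%:E * row_integral (fun v => f (v *m A)))%E.
Proof.
have le (B : 'M[R]_n) (k : 'rV[R]_n -> \bar R) : B \in unitmx -> (forall v, 0 <= k v)%E ->
    (row_integral k <= `|\det B|%:E * row_integral (fun v => k (v *m B)))%E.
  move=> uB k0; apply: row_integral_le_simple => // h c M mh c0 cM hv hk.
  have h0 v : (0 <= (h v)%:E)%E.
    by rewrite lee_fin; have [->//|/andP[hc _]] := hv v; exact/ltW/(lt_le_trans c0).
  rewrite (scales_volume_unit uB mh h0) lee_wpmul2l ?lee_fin//.
  by apply: le_row_integral => v; [exact: h0|exact: hk].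
move=> uA f0; apply/eqP; rewrite eq_le le//=.
have := le (invmx A) (fun v => f (v *m A)); rewrite unitmx_inv => /(_ uA (fun v => f0 _)).
rewrite (_ : row_integral (fun v : 'rV_n => f (v *m invmx A *m A)) = row_integral f); last first.
  by apply: eq_row_integral => v; rewrite mulmxKV.
move=> h; have d0 : 0 < `|\det A| by rewrite normr_gt0 -unitfE -unitmxE.
apply: le_trans (lee_wpmul2l _ h) _; first by rewrite lee_fin.
by rewrite muleA -EFinM -normrM -det_mulmx mulmxV// det1 normr1 mul1e.
Qed.

End linear_change_lower_integral.

(** * Selecting coordinates *)

Section selection.
Context {R : realType} {n : nat}.
Implicit Types S : {set 'I_n}.

Definition selection_mx S : 'M[R]_(#|S|, n) := rowsub enum_val 1%:M.

Lemma selection_mxE S i k : selection_mx S i k = (enum_val i == k)%:R.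
Proof. by rewrite !mxE. Qed.

Lemma mul_selection_mx S m (A : 'M[R]_(n, m)) : selection_mx S *m A = rowsub enum_val A.
Proof. by rewrite /selection_mx mul_rowsub_mx mul1mx. Qed.

Lemma selection_mx_orthonormal S : selection_mx S *m (selection_mx S)^T = 1%:M.
Proof.
apply/matrixP => i j; rewrite mul_selection_mx !mxE (inj_eq enum_val_inj) eq_sym.
by [].
Qed.

Lemma selection_mx_orthogonal S : selection_mx S *m (selection_mx (~: S))^T = 0.
Proof.
apply/matrixP => i j; rewrite mul_selection_mx !mxE.
case: eqP => // ij; have := enum_valP i; have := enum_valP j.
by rewrite ij inE => /negP.
Qed.

Lemma col_selection_mx_orthonormal S :
  col_mx (selection_mx S) (selection_mx (~: S)) *m
    (col_mx (selection_mx S) (selection_mx (~: S)))^T = 1%:M.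
Proof.
rewrite tr_col_mx mul_col_row !selection_mx_orthonormal selection_mx_orthogonal.
have -> : selection_mx (~: S) *m (selection_mx S)^T = 0.
  by rewrite -[LHS]trmxK trmx_mul trmxK selection_mx_orthogonal trmx0.
by rewrite -scalar_mx_block.
Qed.

Lemma card_set_split S : (#|S| + #|~: S|)%N = n.
Proof. by rewrite cardsC card_ord. Qed.

Lemma row_selection_in S (u : 'rV[R]_#|S|) (i : 'I_#|S|) :
  (u *m selection_mx S) 0 (enum_val i) = u 0 i.
Proof.
rewrite mxE (bigD1 i)//= selection_mxE eqxx mulr1 big1 ?addr0// => j ji.
by rewrite selection_mxE (inj_eq enum_val_inj) (negPf ji) mulr0.
Qed.

Lemma row_selection_out S (u : 'rV[R]_#|S|) k : k \notin S ->
  (u *m selection_mx S) 0 k = 0.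
Proof.
move=> kS; rewrite mxE big1// => j _; rewrite selection_mxE.
case: eqP => [jk|]; last by rewrite mulr0.
by rewrite -jk enum_valP in kS.
Qed.

Lemma unit_cube_integral k :
  row_integral (fun v : 'rV[R]_k => ((unit_cube_off (finset.set0) v)%:R%:E : \bar R)) = 1%E.
Proof.
rewrite (eq_row_integral (h := fun v : 'rV[R]_k => (1 * (unit_cube_off finset.set0 v)%:R%:E)%E)); last first.
  by move=> v; rewrite mul1e.
rewrite -/(partial_integral finset.set0 (fun=> 1%E)).
elim: k => [|k IH].
  rewrite /partial_integral row_integral0 mul1e (_ : unit_cube_off _ _ = true)//.
  by apply/forallP => -[].
rewrite (@partial_integral_cons_out _ k finset.set0 _ 0) ?inE//; last exact: measurable_cst.
rewrite (_ : behead_set _ = finset.set0)//; apply/setP => i; by rewrite !inE.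
Qed.

(** The unit cube in the coordinates outside [S] has volume 1. *)
Lemma partial_integral_selection S (h : 'rV[R]_n -> \bar R) :
  measurable_row h -> (forall v, 0 <= h v)%E -> depends_on S h ->
  partial_integral S h = row_integral (fun u : 'rV_#|S| => h (u *m selection_mx S)).
Proof.
move=> mh h0 hS; rewrite /partial_integral.
rewrite (row_integral_orthonormal (card_set_split S) (col_selection_mx_orthonormal S)); last 2 first.
- exact: measurable_partial_integrand.
- by move=> v; rewrite mule_ge0// lee_fin.
apply: eq_row_integral => u.
rewrite -[RHS]mule1 -[in RHS](unit_cube_integral #|~: S|).
set E := selection_mx S; set C := selection_mx (~: S).
have hE v : h (u *m E + v *m C) = h (u *m E).
  apply: hS => i iS; rewrite mxE (row_selection_out v) ?addr0//.
  by rewrite inE negbK.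
have cE v : unit_cube_off S (u *m E + v *m C) = unit_cube_off finset.set0 v.
  apply/forallP/forallP => hv i; apply/implyP => iS.
    have iS' : enum_val i \notin S by have := enum_valP i; rewrite inE.
    have := hv (enum_val i).
    by rewrite mxE (row_selection_in v) (row_selection_out u iS') add0r iS'.
  have iS' : i \in ~: S by rewrite inE.
  have := hv (enum_rank_in iS' i); rewrite finset.in_set0 /= mxE.
  by rewrite -(row_selection_in v) enum_rankK_in// (row_selection_out u iS) add0r.
rewrite (eq_row_integral (h := fun v => (h (u *m E) * (unit_cube_off finset.set0 v)%:R%:E)%E)); last first.
  by move=> v; rewrite hE cE.
rewrite /row_integral ge0_integralZl//; exact: measurable_unit_cube_off.
Qed.

End selection.

(** * Orthonormal frames of subspaces *)

Section orthonormal_frames.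
Context {R : realType} {n : nat}.
Implicit Types (x y : 'rV[R]_n) (F : {vspace 'rV[R]_n}).

Lemma dotvE x y : dotv x y = (x *m y^T) 0 0.
Proof. by rewrite mxE; apply: eq_bigr => i _; rewrite mxE. Qed.

(** The chosen orthonormal basis of [F] as a matrix; [k] is meant to be the
    dimension of [F], kept separate to avoid casts. *)
Definition frame F k : 'M[R]_(k, n) := \matrix_(i < k) (orthonormal_basis F)`_i.

Lemma frameE F (i : 'I_(\dim F)) : row i (frame F (\dim F)) = tnth (orthonormal_basis F) i.
Proof. by rewrite rowK (tnth_nth 0). Qed.

Section frame_theory.
Variables (F : {vspace 'rV[R]_n}) (k : nat).
Hypothesis dF : \dim F = k.

Lemma row_frame_in i : row i (frame F k) \in F.
Proof.
have [/span_basis bF _] := orthonormal_basisP F.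
have : row i (frame F k) \in << orthonormal_basis F >>%VS.
  rewrite rowK; apply/memv_span/mem_nth.
  by rewrite size_tuple dF.
by rewrite bF.
Qed.

Lemma frame_orthonormal : frame F k *m (frame F k)^T = 1%:M.
Proof.
case: _ / dF; have [_ bO] := orthonormal_basisP F.
apply/matrixP => i j; rewrite -[LHS]/((frame F (\dim F) *m (frame F (\dim F))^T) i j).
have := bO i j; rewrite dotvE -!frameE tr_row.
rewrite !mxE => <-; apply: eq_bigr => l _; by rewrite !mxE.
Qed.

Lemma mulmx_frame_in m (A : 'M[R]_(m, k)) i : row i (A *m frame F k) \in F.
Proof.
rewrite row_mul mulmx_sum_row; apply: memv_suml => j _.
by rewrite memvZ// row_frame_in.
Qed.

Lemma memv_frameP x : x \in F -> exists s : 'rV[R]_k, x = s *m frame F k.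
Proof.
case: _ / dF; have [bF _] := orthonormal_basisP F.
rewrite -{1}(span_basis bF) => /coord_span ->.
exists (\row_i coord (orthonormal_basis F) i x).
rewrite mulmx_sum_row; apply: eq_bigr => i _.
by rewrite mxE rowK.
Qed.

Lemma frame_proj m (A : 'M[R]_(m, n)) : (forall i, row i A \in F) ->
  A *m (frame F k)^T *m frame F k = A.
Proof.
move=> AF; apply/row_matrixP => i; rewrite !row_mul.
have [s ->] := memv_frameP (AF i).
by rewrite -(mulmxA s) frame_orthonormal mulmx1.
Qed.

Lemma orthogonal_complement_frameP y :
  reflect (y *m (frame F k)^T = 0) (y \in orthogonal_complement F).
Proof.
apply: (iffP (orthogonal_complementP F y)) => [h|h x /memv_frameP[s ->]].
  apply/rowP => i; have := h _ (row_frame_in i); rewrite dotvC dotvE => e.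
  by rewrite [RHS]mxE -e !mxE; apply: eq_bigr => j _; rewrite !mxE.
by rewrite dotvC dotvE trmx_mul mulmxA h mul0mx mxE.
Qed.

Lemma dim_orthogonal_complement : (k + \dim (orthogonal_complement F))%N = n.
Proof.
have dis : (F :&: orthogonal_complement F = 0)%VS.
  apply/eqP; rewrite -subv0; apply/subvP => x; rewrite memv_cap => /andP[xF].
  move=> /orthogonal_complementP/(_ _ xF) xx; rewrite memv0.
  by apply: contraT => /dotv_gt0; rewrite xx ltxx.
have full : (F + orthogonal_complement F = fullv)%VS.
  apply/eqP; rewrite eqEsubv subvf; apply/subvP => x _.
  have -> : x = x *m (frame F k)^T *m frame F k + (x - x *m (frame F k)^T *m frame F k).
    by rewrite addrC subrK.
  apply: memv_add.
    by have := mulmx_frame_in (x *m (frame F k)^T) 0; rewrite row_id.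
  apply/orthogonal_complement_frameP.
  by rewrite mulmxBl -[X in _ - X]mulmxA frame_orthonormal mulmx1 subrr.
by rewrite -dF -dimv_disjoint_sum// full dimvf; exact: mul1n.
Qed.

Lemma subspace_norm1_frame (h : 'rV[R]_n -> \bar R) :
  subspace_norm1 F h = row_integral (fun s : 'rV_k => h (s *m frame F k)).
Proof.
case: _ / dF; apply: eq_integral => t _; congr h.
rewrite mulmx_sum_row; apply: eq_bigr => i _.
by rewrite mxE frameE.
Qed.

End frame_theory.
End orthonormal_frames.

(** * Volumes of parallelepipeds *)

Section wedge.
Context {R : realType} {n : nat}.
Implicit Types (F : {vspace 'rV[R]_n}).

Definition rows_mx (u : seq 'rV[R]_n) k : 'M[R]_(k, n) := \matrix_(i < k) u`_i.

Lemma frame_rows_unit (u : seq 'rV[R]_n) k : size u = k -> free u ->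
  rows_mx u k *m (frame << u >>%VS k)^T \in unitmx.
Proof.
move=> uk fu; have du : \dim << u >>%VS = k by rewrite -uk; apply/eqP.
suff [B BE] : exists B : 'M[R]_k, frame << u >>%VS k = B *m rows_mx u k.
  have := frame_orthonormal du; rewrite {1}BE -mulmxA => /mulmx1_unit[].
  by [].
exists (\matrix_(i, j) coord (in_tuple u) (cast_ord (esym uk) j) (row i (frame << u >>%VS k))).
apply/row_matrixP => i; rewrite row_mul mulmx_sum_row.
rewrite [LHS](coord_span (X := in_tuple u)) ?row_frame_in//.
rewrite (reindex (cast_ord uk)) /=; last first.
  by exists (cast_ord (esym uk)) => j _; rewrite ?cast_ordK ?cast_ordKV.
by apply: eq_bigr => j _; rewrite [row (cast_ord _ _) _]rowK ![in RHS]mxE cast_ordK.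
Qed.

Lemma rows_mx_in (u : seq 'rV[R]_n) k : size u = k -> forall i, row i (rows_mx u k) \in << u >>%VS.
Proof.
by move=> uk i; rewrite rowK memv_span// mem_nth// uk.
Qed.

(** In the coordinates of an orthonormal frame the parallelepiped spanned by
    [u] is a linear image of the unit cube. *)
Lemma wedge_normE (u : seq 'rV[R]_n) k : size u = k -> free u ->
  wedge_norm u = `|\det (rows_mx u k *m (frame << u >>%VS k)^T)|.
Proof.
move=> uk fu; rewrite /wedge_norm fu.
have du : \dim << u >>%VS = k by rewrite -uk; apply/eqP.
set A := _ *m _; have uA : A \in unitmx by exact: frame_rows_unit.
have UE : rows_mx u k = A *m frame << u >>%VS k.
  by rewrite (frame_proj du)//; exact: rows_mx_in.
pose cube (v : 'rV[R]_k) : \bar R := (unit_cube_off (finset.set0 : {set 'I_k}) v)%:R%:E.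
suff -> : subspace_volume << u >>%VS (parallelepiped u) =
    row_integral (fun v : 'rV_k => cube (v *m invmx A)).
  have := scales_volume_unit uA (h := fun v => cube (v *m invmx A)).
  move=> -> //; last 2 first.
  - exact: (measurable_row_mulmx (invmx A) (measurable_unit_cube_off _)).
  - by move=> v; rewrite lee_fin.
  rewrite (eq_row_integral (h := cube)); last by move=> v; rewrite mulmxK.
  by rewrite unit_cube_integral mule1.
pose P : set 'rV[R]_k := [set v | parallelepiped u (v *m frame << u >>%VS k)].
have PE v : P v <-> unit_cube_off (finset.set0 : {set 'I_k}) (v *m invmx A).
  split=> [[c c01 vE]|/forallP vc].
    pose c' : 'rV[R]_k := \row_i c (cast_ord (esym uk) i).
    have vA : v = c' *m A.
      rewrite -[LHS]mulmx1 -(frame_orthonormal du) mulmxA vE.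
      rewrite /A mulmxA; congr (_ *m _); rewrite mulmx_sum_row (reindex (cast_ord uk)) /=.
        by apply: eq_bigr => j _; rewrite mxE rowK cast_ordK.
      by exists (cast_ord (esym uk)) => j _; rewrite ?cast_ordK ?cast_ordKV.
    rewrite vA mulmxK//; apply/forallP => i; apply/implyP => _; rewrite mxE.
    exact: c01.
  exists (fun i => (v *m invmx A) 0 (cast_ord uk i)).
    by move=> i; have := vc (cast_ord uk i); rewrite finset.in_set0.
  rewrite -{1}(mulmxKV uA v) -(mulmxA _ A) -UE mulmx_sum_row (reindex (cast_ord uk)) /=.
    by apply: eq_bigr => j _; rewrite rowK.
  by exists (cast_ord (esym uk)) => j _; rewrite ?cast_ordK ?cast_ordKV.
transitivity (lebesgue_tuple k [set t | P (row_of_tuple t)]).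
  rewrite /subspace_volume /P; case: _ / du; congr lebesgue_tuple.
  apply/seteqP; split => t /=; rewrite mulmx_sum_row;
    (under eq_bigr do rewrite mxE frameE); exact.
rewrite (_ : [set t | _] = [set t |
  unit_cube_off (finset.set0 : {set 'I_k}) (row_of_tuple t *m invmx A)]); last first.
  by apply/seteqP; split => t /PE.
set E := [set t | _].
have mE : measurable E.
  have := measurable_row_mulmx (invmx A) (measurable_unit_cube_off (R := R) (finset.set0 : {set 'I_k})).
  move=> /measurable_EFinP/(_ measurableT [set 1%R]).
  rewrite setTI (_ : _ @^-1` _ = E); first by apply; exact: measurable_set1.
  apply/seteqP; split => t; rewrite /E /=; case: unit_cube_off => //.
  by move=> /eqP; rewrite eq_sym oner_eq0.
transitivity (\int[lebesgue_tuple k]_t (\1_E t)%:E)%E; first by rewrite integral_indic// setIT.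
apply: eq_integral => t _; rewrite indicE /cube; congr ((nat_of_bool _)%:R%:E).
by apply/idP/idP; rewrite inE.
Qed.

Lemma wedge_norm_gt0 (u : seq 'rV[R]_n) : free u -> 0 < wedge_norm u.
Proof.
move=> fu; rewrite (wedge_normE erefl fu) normr_gt0 -unitfE -unitmxE.
exact: frame_rows_unit.
Qed.

End wedge.

Section determinants.
Context {R : realType}.

(** In the orthonormal bases given by the rows of [E1], [E2] and of [O1], [O2], the
    matrix [W] is block triangular. *)
Lemma norm_det_block a b n (E1 O1 : 'M[R]_(a, n)) (E2 O2 : 'M[R]_(b, n)) (W : 'M[R]_n) :
  (a + b)%N = n ->
  col_mx E1 E2 *m (col_mx E1 E2)^T = 1%:M ->
  col_mx O1 O2 *m (col_mx O1 O2)^T = 1%:M ->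
  E2 *m W *m O1^T = 0 ->
  `|\det W| = `|\det (E1 *m W *m O1^T)| * `|\det (E2 *m W *m O2^T)|.
Proof.
move=> abn; subst n => EE OO EWO.
have : `|\det (col_mx E1 E2 *m W *m (col_mx O1 O2)^T)| = `|\det W|.
  rewrite !det_mulmx !normrM det_tr (norm_det_orthonormal EE) (norm_det_orthonormal OO).
  by rewrite mul1r mulr1.
rewrite tr_col_mx mul_col_mx mul_col_row EWO => <-.
by rewrite det_ublock normrM.
Qed.

End determinants.

(** * Projections of a function and its envelopes *)

Section projections.
Context {R : realType} {n : nat}.
Implicit Types (F : {vspace 'rV[R]_n}) (S : {set 'I_n}) (f : 'rV[R]_n -> R).

(** Let [c] be a point of R^S.  The points [y V] with [y] in the fibre over [c] all
    have the same orthogonal projection to [F], because the rows of [V] outside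
    [S] are orthogonal to [F].  In the coordinates of the frame this projection
    is [c X], where [X] is the matrix whose determinant appears.  So the supremum
    of [f(y V)] over the fibre, and with it the envelope at [c], is at most the
    value of the projected function at [c X]. *)
Lemma projection_lower_bound f (V : 'M[R]_n) F S :
  (forall x, 0 <= f x) -> \dim F = #|S| ->
  selection_mx S *m V *m (frame F #|S|)^T \in unitmx ->
  (forall i, i \notin S -> row i V \in orthogonal_complement F) ->
  (`|\det (selection_mx S *m V *m (frame F #|S|)^T)|%:E *
     partial_integral S (envelope (fun c => f (c *m V)) S) <=
   subspace_norm1 F (sup_projection F f))%E.
Proof.
move=> f0 dF; set X := _ *m _ *m _ => uX VF.
pose g (c : 'rV[R]_n) := f (c *m V).
have g0 c : 0 <= g c by exact: f0.
pose h (s : 'rV[R]_#|S|) := envelope g S (s *m invmx X *m selection_mx S).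
have mh : measurable_row h.
  apply: (measurable_row_mulmx (invmx X) (h := fun u => envelope g S (u *m selection_mx S))).
  exact: measurable_row_mulmx (measurable_envelope g S).
have h0 s : (0 <= h s)%E by exact: envelope_ge0.
rewrite (subspace_norm1_frame dF) partial_integral_selection; first last.
- exact: envelope_depends_on.
- by move=> v; exact: envelope_ge0.
- exact: measurable_envelope.
rewrite (_ : (_ * _)%E = row_integral h); last first.
  have hX u : envelope g S (u *m selection_mx S) = h (u *m X) by rewrite /h mulmxK.
  by rewrite (eq_row_integral hX); exact: esym (scales_volume_unit uX mh h0).
apply: le_row_integral => // s; rewrite /h.
apply: envelope_le_bound => y yS.
apply: ereal_sup_ubound; exists (y *m V - s *m frame F #|S|); last by rewrite addrC subrK.
apply/(orthogonal_complement_frameP dF).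
rewrite mulmxBl -[X in _ - X]mulmxA frame_orthonormal// mulmx1.
set c := s *m invmx X in yS *.
have -> : y = c *m selection_mx S + (y - c *m selection_mx S) by rewrite addrC subrK.
have cX : c *m selection_mx S *m V *m (frame F #|S|)^T = s.
  by rewrite -[RHS](mulmxKV uX) /X !mulmxA.
rewrite 2!mulmxDl cX.
rewrite addrAC subrr add0r [_ *m V]mulmx_sum_row mulmx_suml big1// => i _.
have [iS|iS] := boolP (i \in S).
  by rewrite !mxE yS// !mxE subrr scale0r mul0mx.
rewrite -scalemxAl.
by have /(orthogonal_complement_frameP dF) -> := VF i iS; rewrite scaler0.
Qed.

Lemma free_rows_mx (u : seq 'rV[R]_n) k : size u = k ->
  (forall c : 'rV[R]_k, c *m rows_mx u k = 0 -> c = 0) -> free u.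
Proof.
move=> uk; case: _ / uk => h; suff : free (in_tuple u) by [].
apply/freeP => c c0 i.
have /rowP/(_ i) : (\row_i c i : 'rV[R]_(size u)) = 0.
  by apply: h; rewrite mulmx_sum_row -[RHS]c0; apply: eq_bigr => j _; rewrite mxE rowK.
by rewrite !mxE.
Qed.

Variable w : n.-tuple 'rV[R]_n.
Hypothesis wB : basis_of fullv w.

Definition basis_mx := rows_mx w n.

Lemma basis_mx_unit : basis_mx \in unitmx.
Proof.
have fw := basis_free wB; have := frame_rows_unit (size_tuple w) fw.
by rewrite unitmx_mul => /andP[].
Qed.

Lemma wedge_norm_basis : wedge_norm w = `|\det basis_mx|.
Proof.
have fw := basis_free wB.
rewrite (wedge_normE (size_tuple w) fw) det_mulmx normrM det_tr.
rewrite (norm_det_orthonormal (frame_orthonormal _)) ?mulr1//.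
by rewrite (span_basis wB) dimvf; exact: mul1n.
Qed.

Lemma size_subfamily S : size (subfamily w S) = #|S|.
Proof. by rewrite size_map -cardE. Qed.

Lemma rows_mx_subfamily S : rows_mx (subfamily w S) #|S| = selection_mx S *m basis_mx.
Proof.
apply/row_matrixP => i; rewrite mul_selection_mx row_rowsub !rowK.
by rewrite (nth_map (enum_val i)) -?cardE// (tnth_nth 0) /enum_val; congr (_`_ _);
  congr nat_of_ord; apply: set_nth_default; rewrite -cardE.
Qed.

Lemma free_subfamily S : free (subfamily w S).
Proof.
apply: (free_rows_mx (size_subfamily S)) => c; rewrite rows_mx_subfamily mulmxA => h.
have {}h : c *m selection_mx S = 0.
  by rewrite -[LHS](mulmxK basis_mx_unit) h mul0mx.
by rewrite -[c]mulmx1 -(selection_mx_orthonormal S) mulmxA h mul0mx.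
Qed.

Lemma dim_subfamily S : \dim << subfamily w S >>%VS = #|S|.
Proof. by rewrite -size_subfamily; apply/eqP; exact: free_subfamily. Qed.

Lemma wedge_norm_subfamily S : wedge_norm (subfamily w S) =
  `|\det (selection_mx S *m basis_mx *m (frame << subfamily w S >>%VS #|S|)^T)|.
Proof.
by rewrite (wedge_normE (size_subfamily S) (free_subfamily S)) rows_mx_subfamily.
Qed.

(** Here [V] has the rows [w_i], those outside [S] being orthogonal to [F].  In
    orthonormal frames of [F] and its complement the basis matrix is block
    triangular, with [X] as one diagonal block and a matrix of determinant
    [wedge_norm (subfamily w (~: S))] as the other. *)
Lemma projection_orthogonal_bound f S (F := orthogonal_complement << subfamily w (~: S) >>%VS) :
  (forall x, 0 <= f x) ->
  (partial_integral S (envelope (fun c => f (c *m basis_mx)) S) <=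
   (wedge_norm (subfamily w (~: S)) / wedge_norm w)%:E *
     subspace_norm1 F (sup_projection F f))%E.
Proof.
move=> f0; set H := << _ >>%VS in F *.
have dH : \dim H = #|~: S| by exact: dim_subfamily.
have dF : \dim F = #|S|.
  apply/eqP; rewrite -(eqn_add2l #|~: S|) (dim_orthogonal_complement dH).
  by rewrite addnC card_set_split.
pose O1 := frame F #|S|; pose O2 := frame H #|~: S|.
have O12 : O1 *m O2^T = 0.
  apply/row_matrixP => i; rewrite row_mul row0.
  exact: (elimT (orthogonal_complement_frameP dH _) (row_frame_in dF i)).
have O21 : O2 *m O1^T = 0 by rewrite -[LHS]trmxK trmx_mul trmxK O12 trmx0.
have OO : col_mx O1 O2 *m (col_mx O1 O2)^T = 1%:M.
  by rewrite tr_col_mx mul_col_row O12 O21 !frame_orthonormal// -scalar_mx_block.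
have WO : selection_mx (~: S) *m basis_mx *m O1^T = 0.
  rewrite -(frame_proj dH (A := selection_mx (~: S) *m basis_mx)) => [|i].
    by rewrite -mulmxA O21 mulmx0.
  by rewrite -rows_mx_subfamily; apply: rows_mx_in; exact: size_subfamily.
have := norm_det_block (card_set_split S) (col_selection_mx_orthonormal S) OO WO.
rewrite -wedge_norm_basis -(wedge_norm_subfamily (~: S)) => wE.
have w0 : 0 < wedge_norm w by rewrite wedge_norm_gt0// (basis_free wB).
have ws0 : 0 < wedge_norm (subfamily w (~: S)) by rewrite wedge_norm_gt0// free_subfamily.
set X := selection_mx S *m basis_mx *m O1^T in wE.
have X0 : 0 < `|\det X| by rewrite -(pmulr_lgt0 _ ws0) -wE.
have uX : X \in unitmx by rewrite unitmxE unitfE -normr_gt0.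
have := projection_lower_bound f0 dF uX.
have VF i : i \notin S -> row i basis_mx \in orthogonal_complement F.
  move=> iS; apply/orthogonal_complementP => x xF; rewrite dotvC.
  move/orthogonal_complementP: xF; apply.
  rewrite /H rowK; apply: memv_span; apply/mapP; exists i.
    by rewrite mem_enum inE.
  by rewrite (tnth_nth 0).
move=> /(_ VF) h.
rewrite wE invfM mulrCA mulfV ?gt_eqF// mulr1.
rewrite -[leLHS]mul1e -(mulVf (lt0r_neq0 X0)) EFinM -muleA.
by rewrite lee_wpmul2l// lee_fin invr_ge0 ltW.
Qed.

(** Here the rows of [V] are the dual basis, of which those outside [S] are
    orthogonal to [F].  The duality makes [X] the inverse transpose of the matrix
    expressing the [w_k], [k] in [S], in an orthonormal frame of [F]. *)
Lemma projection_span_bound f S (F := << subfamily w S >>%VS) :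
  (forall x, 0 <= f x) ->
  (partial_integral S (envelope (fun c => f (c *m (invmx basis_mx)^T)) S) <=
   (wedge_norm (subfamily w S))%:E * subspace_norm1 F (sup_projection F f))%E.
Proof.
move=> f0; have dF : \dim F = #|S| by exact: dim_subfamily.
pose O := frame F #|S|; pose V := (invmx basis_mx)^T.
pose E : 'M[R]_(#|S|, n) := selection_mx S.
have VW : V *m basis_mx^T = 1%:M.
  by rewrite /V -trmx_mul mulmxV ?basis_mx_unit// trmx1.
pose X := E *m V *m O^T; pose Y := E *m basis_mx *m O^T.
have EWO : Y *m O = E *m basis_mx.
  apply: (frame_proj dF) => i.
  by rewrite -rows_mx_subfamily; apply: rows_mx_in; exact: size_subfamily.
have XY : X *m Y^T = 1%:M.
  rewrite /X -mulmxA -trmx_mul EWO trmx_mul mulmxA -(mulmxA E) VW mulmx1.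
  exact: selection_mx_orthonormal.
have [uX uYT] := mulmx1_unit XY.
have uY : Y \in unitmx by rewrite -unitmx_tr.
have wE : wedge_norm (subfamily w S) = `|\det Y| by exact: wedge_norm_subfamily.
have dXY : `|\det Y| * `|\det X| = 1.
  by rewrite mulrC -normrM -[in LHS](det_tr Y) -det_mulmx XY det1 normr1.
have VF i : i \notin S -> row i V \in orthogonal_complement F.
  move=> iS; apply/(orthogonal_complement_frameP dF).
  have -> : frame F #|S| = invmx Y *m (E *m basis_mx) by rewrite -EWO mulKmx.
  rewrite !trmx_mul !mulmxA -row_mul VW.
  rewrite (_ : row i 1%:M *m E^T = 0) ?mul0mx//.
  apply/rowP => j; rewrite -row_mul mul1mx !mxE.
  by case: eqP => // ij; rewrite -ij enum_valP in iS.
have h := projection_lower_bound f0 dF uX VF.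
rewrite wE -[leLHS]mul1e -dXY EFinM -muleA.
by rewrite lee_wpmul2l// lee_fin.
Qed.

End projections.

(** * Projections orthogonal to and onto spans of basis vectors *)

Section extended_powers.
Context {R : realType}.

Lemma lee_prod (I : finType) (x y : I -> \bar R) :
  (forall i, 0 <= x i <= y i)%E -> (\prod_i x i <= \prod_i y i)%E.
Proof.
move=> xy; suff /andP[] : (0 <= \prod_i x i <= \prod_i y i)%E by [].
elim/big_ind2: _ => [|a b c d /andP[a0 ab] /andP[c0 cd]|i _]; last exact: xy.
  by rewrite lexx andbT.
by rewrite mule_ge0//= lee_pmul.
Qed.

Lemma prod_poweR (I : finType) (x : I -> \bar R) (r : R) : (forall i, 0 <= x i)%E ->
  ((\prod_i x i) `^ r = \prod_i x i `^ r)%E.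
Proof.
move=> x0; suff [] : (0 <= \prod_i x i)%E /\ ((\prod_i x i) `^ r = \prod_i x i `^ r)%E by [].
elim/big_ind2: _ => [|a b c d [b0 ab] [d0 cd]|i _]; last by [].
  by rewrite poweR1r.
by split; [exact: mule_ge0|rewrite poweRM// ab cd].
Qed.

Lemma prod_powR (I : finType) (x : I -> R) (r : R) : (forall i, 0 <= x i) ->
  (\prod_i x i) `^ r = \prod_i x i `^ r.
Proof.
move=> x0; suff [] : 0 <= \prod_i x i /\ (\prod_i x i) `^ r = \prod_i x i `^ r by [].
elim/big_ind2: _ => [|a b c d [b0 ab] [d0 cd]|i _]; last by [].
  by rewrite powR1.
by split; [exact: mulr_ge0|rewrite powRM// ab cd].
Qed.

Lemma powR_div (x y r : R) : 0 <= x -> 0 < y -> (x / y) `^ r = x `^ r / y `^ r.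
Proof.
move=> x0 y0; apply: (mulIf (lt0r_neq0 (powR_gt0 r y0))).
by rewrite divfK ?lt0r_neq0 ?powR_gt0// -powRM ?divr_ge0 ?(ltW y0)// divfK// gt_eqF.
Qed.

(** Used with [r = p - 1], where [p] is the sum of the weights, to raise an
    inequality for the complementary cover to the power [p - 1]. *)
Lemma poweR_rearrange (I : finType) (a b : \bar R) (K r : R) (p : I -> R) (y : I -> \bar R) :
  0 < r -> (0 <= a)%E -> (0 <= b)%E -> 0 <= K -> (forall i, 0 <= y i)%E ->
  (a `^ r^-1 * b <= K%:E * \prod_i y i `^ (p i / r))%E ->
  (a * b `^ r <= (K `^ r)%:E * \prod_i y i `^ p i)%E.
Proof.
move=> r0 a0 b0 K0 y0 h.
have -> : (a * b `^ r = (a `^ r^-1 * b) `^ r)%E.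
  by rewrite poweRM ?poweR_ge0// -poweRrM mulVf ?gt_eqF// poweRe1.
have -> : ((K `^ r)%:E * \prod_i y i `^ p i = (K%:E * \prod_i y i `^ (p i / r)) `^ r)%E.
  rewrite poweRM ?lee_fin ?prode_ge0//; last by move=> i _; exact: poweR_ge0.
  rewrite poweR_EFin prod_poweR; last by move=> i; exact: poweR_ge0.
  by congr (_ * _)%E; apply: eq_bigr => i _; rewrite -poweRrM divfK// gt_eqF.
apply: gt0_ler_poweR => //; first exact: ltW.
  by rewrite in_itv /= leey andbT mule_ge0// poweR_ge0.
rewrite in_itv /= leey andbT mule_ge0//; apply: prode_ge0 => i _; exact: poweR_ge0.
Qed.

End extended_powers.

Section projection_inequalities.
Context {R : realType} {n : nat}.
Implicit Types (f : 'rV[R]_n -> R).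

Lemma norm_sup_ge0 f : (forall x, 0 <= f x) -> (0 <= norm_sup f)%E.
Proof.
move=> f0; apply: le_ereal_sup_tmp; exists (f 0)%:E; last by rewrite lee_fin.
by exists 0.
Qed.

Lemma norm_sup_real f : (exists B, forall x, f x <= B) ->
  exists M, [/\ norm_sup f = M%:E, forall x, f x <= M &
    forall r, r < M -> exists x, r < f x].
Proof.
move=> [B fB].
have ubf : has_ubound (range f) by exists B => _ [x _ <-].
have nef : (range f) !=set0 by exists (f 0), 0.
exists (sup (range f)); split.
- rewrite /norm_sup -ereal_sup_EFin//; congr ereal_sup.
  by rewrite -image_comp.
- by move=> x; apply: ub_le_sup => //; exists x.
- by move=> r /(sup_gt nef)[_ [x _ <-] rx]; exists x.
Qed.

Variables (m : nat) (S : 'I_m -> {set 'I_n}) (p : 'I_m -> R).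
Hypothesis Sp : uniform_cover S p.
Local Notation P := (\sum_(j < m) p j).

(** The coordinate inequality for the image of [f] under a linear change of
    variables, with the envelopes already estimated by the [N j].  If the
    integral of [f] vanishes there is nothing to show; otherwise [f] is bounded
    and its supremum is positive. *)
Lemma linear_image_inequality f (V : 'M[R]_n) (c : 'I_m -> R) (N : 'I_m -> \bar R) :
  integrable_log_concave f -> V \in unitmx ->
  (forall j, 0 < c j) -> (forall j, 0 <= N j)%E ->
  (forall j, partial_integral (S j) (envelope (fun x => f (x *m V)) (S j)) <=
    (c j)%:E * N j)%E ->
  (norm_sup f `^ (P - 1)%R * norm1 f <=
    ((`|\det V| * \prod_j c j `^ p j) * (n`!%:R / \prod_j (#|S j|)`!%:R `^ p j))%:E *
    \prod_j N j `^ p j)%E.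
Proof.
case: Sp => _ p0 Sp1 [lf fin] uV c0 N0 IN.
have fc := log_concave_geo lf; have f0 := fc.1.
have -> : norm1 f = row_integral (EFin \o f) by [].
rewrite -[norm1 f]/(row_integral (EFin \o f)) in fin.
have den0 : 0 <= n`!%:R / \prod_j (#|S j|)`!%:R `^ p j :> R.
  by rewrite divr_ge0//; apply: prodr_ge0 => j _; exact: powR_ge0.
have prodc0 : 0 <= \prod_j c j `^ p j by apply: prodr_ge0 => j _; exact: powR_ge0.
have int0 : (0 <= row_integral (EFin \o f))%E by apply: row_integral_ge0 => v; rewrite lee_fin.
have [f00|fpos] := eqVneq (row_integral (EFin \o f)) 0%E.
  rewrite f00 mule0; apply: mule_ge0; last by apply: prode_ge0 => j _; exact: poweR_ge0.
  by rewrite lee_fin mulr_ge0// mulr_ge0.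
have {}fpos : (0 < row_integral (EFin \o f))%E by rewrite lt0e fpos.
have [M [supM fM Msup]] := norm_sup_real (geo_concave_bounded fc fpos fin).
have M0 : 0 < M.
  have [a [b [e [ab e0 fab]]]] := positive_integral_box fc fpos.
  apply: (lt_le_trans e0); apply: le_trans (fM (2^-1 *: (a + b))); apply: fab.
  apply/box_withinP => i _; rewrite !mxE; have := ab i => abi.
  by apply/andP; split; lra.
pose g (x : 'rV[R]_n) := f (x *m V).
have gc : geo_concave g by exact: geo_concave_linear.
have fg : row_integral (EFin \o f) = (`|\det V|%:E * row_integral (EFin \o g))%E.
  by apply: row_integral_unitmx => // v; rewrite lee_fin.
have gpos : (0 < row_integral (EFin \o g))%E.
  rewrite lt0e; apply/andP; split; last by apply: row_integral_ge0 => v; rewrite lee_fin; exact: f0.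
  by apply: contraTneq fpos => g00; rewrite fg g00 mule0 ltxx.
have gsup r : r < M -> exists x, r < g x.
  by move=> /Msup[x rx]; exists (x *m invmx V); rewrite /g mulmxKV.
have := coordinate_inequality gc M0 (fun x => fM _) gsup gpos p0 Sp1.
rewrite supM poweR_EFin fg muleCA => h.
apply: le_trans (lee_wpmul2l _ h) _; first by rewrite lee_fin.
rewrite muleA -EFinM mulrAC [in leRHS]EFinM -muleA.
apply: lee_wpmul2l; first by rewrite lee_fin mulr_ge0.
have -> : ((\prod_j c j `^ p j)%:E * \prod_j N j `^ p j = \prod_j ((c j)%:E * N j) `^ p j)%E.
  rewrite -prodEFin -big_split; apply: eq_bigr => j _ /=.
  by rewrite poweRM ?lee_fin ?(ltW (c0 j))// poweR_EFin.
apply: lee_prod => j; rewrite poweR_ge0/=.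
have I0 : (0 <= partial_integral (S j) (envelope g (S j)))%E.
  by apply: partial_integral_ge0 => v; apply: envelope_ge0 => x; exact: f0.
apply: gt0_ler_poweR => //; first exact/ltW/p0.
  by rewrite in_itv /= leey andbT.
by rewrite in_itv /= leey andbT mule_ge0// lee_fin ltW.
Qed.

Lemma subspace_norm1_ge0 F f : (forall x, 0 <= f x) ->
  (0 <= subspace_norm1 F (sup_projection F f))%E.
Proof.
move=> f0; apply: integral_ge0 => t _; apply: le_ereal_sup_tmp.
exists (f (subspace_point t + 0))%:E; last by rewrite lee_fin.
by exists 0 => //=; rewrite mem0v.
Qed.

Lemma norm1_ge0 f : (forall x, 0 <= f x) -> (0 <= norm1 f)%E.
Proof. by move=> f0; apply: integral_ge0 => t _; rewrite lee_fin. Qed.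

Variable w : n.-tuple 'rV[R]_n.
Hypothesis wB : basis_of fullv w.

Let w0 : 0 < wedge_norm w.
Proof. by rewrite wedge_norm_gt0// (basis_free wB). Qed.

Let ws0 A : 0 < wedge_norm (subfamily w A).
Proof. by rewrite wedge_norm_gt0// free_subfamily. Qed.

Let powR_wedge : wedge_norm w `^ P = wedge_norm w * wedge_norm w `^ (P - 1).
Proof.
rewrite -[X in X * _](powRr1 (ltW w0)) -powRD; last by rewrite (gt_eqF w0) implybT.
by rewrite addrC subrK.
Qed.

Lemma orthogonal_projection_inequality f (F := fun j => orthogonal_complement << subfamily w (~: S j) >>%VS) :
  integrable_log_concave f ->
  (norm_sup f `^ (P - 1)%R * norm1 f <=
    (BL1 w S p * (n`!%:R / \prod_j (#|S j|)`!%:R `^ p j))%:E *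
    \prod_j subspace_norm1 (F j) (sup_projection (F j) f) `^ p j)%E.
Proof.
move=> lf; have f0 := (log_concave_geo lf.1).1.
have := linear_image_inequality lf (basis_mx_unit wB)
  (c := fun j => wedge_norm (subfamily w (~: S j)) / wedge_norm w)
  (N := fun j => subspace_norm1 (F j) (sup_projection (F j) f)).
rewrite (_ : `|\det _| * _ = BL1 w S p); first apply.
- by move=> j; rewrite divr_gt0.
- by move=> j; exact: subspace_norm1_ge0.
- by move=> j; exact: (projection_orthogonal_bound wB).
rewrite -(wedge_norm_basis wB) /BL1.
rewrite (eq_bigr (fun j => wedge_norm (subfamily w (~: S j)) `^ p j / wedge_norm w `^ p j)); last first.
  by move=> j _; rewrite powR_div// ltW.
rewrite big_split /= prodfV -powR_sum// powR_wedge.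
by field; rewrite !gt_eqF// powR_gt0.
Qed.

Lemma span_projection_inequality f (F := fun j => << subfamily w (S j) >>%VS) :
  integrable_log_concave f ->
  (norm_sup f `^ (P - 1)%R * norm1 f <=
    (BL2 w S p * (n`!%:R / \prod_j (#|S j|)`!%:R `^ p j))%:E *
    \prod_j subspace_norm1 (F j) (sup_projection (F j) f) `^ p j)%E.
Proof.
move=> lf; have f0 := (log_concave_geo lf.1).1.
have uV : (invmx (basis_mx w))^T \in unitmx by rewrite unitmx_tr unitmx_inv basis_mx_unit.
have := linear_image_inequality lf uV
  (c := fun j => wedge_norm (subfamily w (S j)))
  (N := fun j => subspace_norm1 (F j) (sup_projection (F j) f)).
rewrite (_ : `|\det _| * _ = BL2 w S p); first apply.
- by move=> j.
- by move=> j; exact: subspace_norm1_ge0.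
- by move=> j; exact: (projection_span_bound wB).
rewrite det_tr det_inv normrV -?unitmxE ?basis_mx_unit//.
by rewrite -(wedge_norm_basis wB) /BL2 mulrC.
Qed.

End projection_inequalities.

(** * Complementary covers *)

Section complementary_cover.
Context {R : realType} {n m : nat}.
Variables (S : 'I_m -> {set 'I_n}) (p : 'I_m -> R).
Hypothesis Sp : uniform_cover S p.
Local Notation P := (\sum_(j < m) p j).

(** If [i] is outside [S j], then the weights other than [p j] already sum to at
    least 1. *)
Lemma full_cover_or_gt1 : (forall j, S j = [set: 'I_n]%SET) \/ 1 < P.
Proof.
case: Sp => _ p0 S1.
have [Sj|/existsNP[j Sj]] := pselect (forall j, S j = [set: 'I_n]%SET); [by left|right].
have [i iS] : exists i, i \notin S j.
  apply: contrapT => /forallNP h; apply: Sj; apply/setP => i; rewrite finset.in_setT.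
  by have /negP := h i; rewrite negbK.
rewrite -(S1 i) (bigD1 j)//= (negPf iS) mulr0 add0r [ltRHS](bigD1 j)//=.
rewrite ltr_pwDl// ler_sum// => k _; rewrite ler_piMr ?(ltW (p0 k))//.
by case: (i \in S k).
Qed.

Lemma uniform_cover_complement : 1 < P ->
  uniform_cover (fun j => ~: S j) (fun j => p j / (P - 1)).
Proof.
case: Sp => m0 p0 S1 P1; have P0 : 0 < P - 1 by rewrite subr_gt0.
split=> // [j|i]; first by rewrite divr_gt0.
have -> : \sum_(j < m) p j / (P - 1) * (i \in ~: S j)%:R =
    (P - \sum_(j < m) p j * (i \in S j)%:R) / (P - 1).
  rewrite -sumrB mulr_suml; apply: eq_bigr => j _.
  by rewrite inE; case: (i \in S j) => /=; rewrite ?mulr0 ?mulr1 ?subrr ?mul0r ?subr0.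
by rewrite S1 divff// gt_eqF.
Qed.

Lemma sum_complementary_weights : 1 < P ->
  \sum_(j < m) p j / (P - 1) - 1 = (P - 1)^-1.
Proof.
move=> P1; rewrite -mulr_suml; have : P - 1 != 0 by rewrite subr_eq0 gt_eqF.
by move=> h; field.
Qed.

Variable w : n.-tuple 'rV[R]_n.
Hypothesis wB : basis_of fullv w.

Let w0 : 0 < wedge_norm w.
Proof. by rewrite wedge_norm_gt0// (basis_free wB). Qed.

Let ws0 A : 0 < wedge_norm (subfamily w A).
Proof. by rewrite wedge_norm_gt0// free_subfamily. Qed.

Let prod_ws0 (A : 'I_m -> {set 'I_n}) (q : 'I_m -> R) :
  0 <= \prod_(j < m) wedge_norm (subfamily w (A j)) `^ q j.
Proof. by apply: prodr_ge0 => j _; exact: powR_ge0. Qed.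

Lemma BL1_complement : 1 < P ->
  BL1 w (fun j => ~: S j) (fun j => p j / (P - 1)) `^ (P - 1) = BL2 w S p.
Proof.
move=> P1; rewrite /BL1 /BL2 sum_complementary_weights//.
rewrite powR_div ?powR_gt0// -powRrM mulVf ?subr_eq0 ?gt_eqF// powRr1 ?ltW//.
rewrite prod_powR => [|j]; last exact: powR_ge0.
congr (_ / _); apply: eq_bigr => j _.
by rewrite finset.setCK -powRrM divfK// subr_eq0 gt_eqF.
Qed.

Lemma BL2_complement : 1 < P ->
  BL2 w (fun j => ~: S j) (fun j => p j / (P - 1)) `^ (P - 1) = BL1 w S p.
Proof.
move=> P1; rewrite /BL1 /BL2 powR_div//.
rewrite prod_powR => [|j]; last exact: powR_ge0.
congr (_ / _); apply: eq_bigr => j _.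
by rewrite -powRrM divfK// subr_eq0 gt_eqF.
Qed.

Lemma multinomial_complement : 1 < P ->
  (n`!%:R / \prod_(j < m) (#|~: S j|)`!%:R `^ (p j / (P - 1))) `^ (P - 1) =
  n`!%:R `^ (P - 1) / \prod_(j < m) (n - #|S j|)`!%:R `^ p j :> R.
Proof.
move=> P1; rewrite powR_div//; last first.
  by apply: prodr_gt0 => j _; rewrite powR_gt0// ltr0n fact_gt0.
rewrite prod_powR => [|j]; last exact: powR_ge0.
congr (_ / _); apply: eq_bigr => j _.
rewrite -powRrM divfK ?subr_eq0 ?gt_eqF//; congr (_%:R `^ _).
by rewrite finset.cardsCs finset.setCK card_ord.
Qed.

(** Integration over a point is evaluation, and the orthogonal complement of the
    zero space is everything. *)
Lemma sup_projection_point (f : 'rV[R]_n -> R) (F : {vspace 'rV[R]_n}) :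
  \dim F = 0%N -> subspace_norm1 F (sup_projection F f) = norm_sup f.
Proof.
move=> dF; rewrite (subspace_norm1_frame dF) row_integral0 mul0mx.
rewrite /sup_projection /norm_sup; congr ereal_sup.
apply/seteqP; split => _ [y _ <-]; exists y => //; rewrite ?add0r//.
by apply/(orthogonal_complement_frameP dF)/rowP => -[].
Qed.

Lemma subfamily_full : subfamily w [set: 'I_n]%SET = w.
Proof. by rewrite /subfamily enum_setT -enumT map_tnth_enum. Qed.

Lemma poweR_sum_le (x : \bar R) : (0 <= x)%E -> (x `^ P <= \prod_(j < m) x `^ p j)%E.
Proof.
case: Sp => m0 p0 _.
have P0 : 0 < P.
  by rewrite (bigD1 (Ordinal m0))//= ltr_wpDr// sumr_ge0// => j _; rewrite ltW.
case: x => [x| |]//; last first.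
  move=> _; rewrite (_ : \prod_(j < m) _ = +oo)%E ?leey//.
  rewrite (bigD1 (Ordinal m0))// poweRyr ?gt_eqF//= gt0_mulye//.
  apply: (big_ind (fun x : \bar R => (0 < x)%E)); [by []|exact: mule_gt0|].
  by move=> j _; case: ifP.
rewrite lee_fin le_eqVlt => /predU1P[<-|x0].
  by rewrite poweR0r ?gt_eqF//; apply: prode_ge0 => j _; rewrite lee_fin powR_ge0.
rewrite poweR_EFin powR_sum// -prodEFin.
by apply: lee_prod => j; rewrite lee_fin powR_ge0 poweR_EFin lexx.
Qed.

(** Either [n] is positive, and then the weights sum to 1; or the space is a point,
    and then both norms of [f] are its value there.  In both cases the powers of
    [n!] and of the volume in the constants are 1. *)
Lemma full_cover_inequality (f : 'rV[R]_n -> R) :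
  (forall j, S j = [set: 'I_n]%SET) -> (forall x, 0 <= f x) ->
  [/\ (norm_sup f * norm1 f `^ (P - 1)%R <= \prod_(j < m) norm_sup f `^ p j)%E,
      n`!%:R `^ (P - 1) = 1 :> R & wedge_norm w `^ (P - 1) = 1].
Proof.
case: Sp => m0 p0 S1 Sfull f0.
have supf0 := norm_sup_ge0 f0.
have := poweR_sum_le supf0.
have [n0|n0] := posnP n; last first.
  have -> : P = 1.
    by rewrite -[RHS](S1 (Ordinal n0)); apply: eq_bigr => j _;
      rewrite Sfull finset.in_setT mulr1.
  by rewrite subrr !powRr0 !poweRe0 mule1 poweRe1.
have rV0 (x : 'rV[R]_n) : x = 0.
  by apply/rowP => i; have := leq_ltn_trans (leq0n i) (ltn_ord i); rewrite [X in (_ < X)%N]n0.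
have -> : norm_sup f = (f 0)%:E.
  rewrite /norm_sup (_ : image _ _ = [set (f 0)%:E]) ?ereal_sup1//.
  apply/seteqP; split=> r => [[x _ <-]|->] /=; first by rewrite (rV0 x).
  by exists 0.
have -> : norm1 f = (f 0)%:E.
  have int0 k (h : 'rV[R]_k -> R) : k = 0%N -> row_integral (EFin \o h) = (h 0)%:E.
    by move=> k0; subst k; rewrite row_integral0.
  exact: int0 n0.
have wE : wedge_norm w = 1.
  have det0 k (A : 'M[R]_k) : k = 0%N -> `|\det A| = 1.
    by move=> k0; subst k; rewrite det_mx00 normr1.
  by rewrite (wedge_norm_basis wB) det0.
move=> h; rewrite wE (_ : n`! = 1)%N ?n0 // !powR1; split=> //; apply: le_trans h.
have := f0 0; rewrite le_eqVlt => /predU1P[<-|f00]; first by rewrite mul0e poweR_ge0.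
rewrite !poweR_EFin -EFinM lee_fin -[X in X * _](powRr1 (ltW f00)) -powRD; last first.
  by rewrite (gt_eqF f00) implybT.
by rewrite addrC subrK.
Qed.

End complementary_cover.

Theorem theorem4p2 (R : realType) (n m : nat) (w : n.-tuple 'rV[R]_n)
    (S : 'I_m -> {set 'I_n}) (p : 'I_m -> R) :
  basis_of fullv w -> uniform_cover S p ->
  let H j := << subfamily w (S j) >>%VS in
  let H' j := << subfamily w (~: S j) >>%VS in
  let d j := #|S j| in
  let d' j := (n - d j)%N in
  let P := \sum_(j < m) p j in
  forall f : 'rV[R]_n -> R, integrable_log_concave f ->
  [/\ (norm_sup f `^ (P - 1)%R * norm1 f <=
        (BL1 w S p * (n`!%:R / \prod_(j < m) (d j)`!%:R `^ p j))%:E *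
        \prod_(j < m) subspace_norm1 (orthogonal_complement (H' j))
          (sup_projection (orthogonal_complement (H' j)) f) `^ p j)%E,
      (norm_sup f * norm1 f `^ (P - 1)%R <=
        (BL2 w S p *
          (n`!%:R `^ (P - 1)%R / \prod_(j < m) (d' j)`!%:R `^ p j))%:E *
        \prod_(j < m) subspace_norm1 (orthogonal_complement (H j))
          (sup_projection (orthogonal_complement (H j)) f) `^ p j)%E,
      (norm_sup f `^ (P - 1)%R * norm1 f <=
        (BL2 w S p * (n`!%:R / \prod_(j < m) (d j)`!%:R `^ p j))%:E *
        \prod_(j < m) subspace_norm1 (H j) (sup_projection (H j) f) `^ p j)%E &
      (norm_sup f * norm1 f `^ (P - 1)%R <=
        (BL1 w S p *
          (n`!%:R `^ (P - 1)%R / \prod_(j < m) (d' j)`!%:R `^ p j))%:E *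
        \prod_(j < m) subspace_norm1 (H' j) (sup_projection (H' j) f) `^ p j)%E].
Proof.
move=> wB Sp H H' d d' P f lf.
have f0 := (log_concave_geo lf.1).1.
have supf0 := norm_sup_ge0 f0; have int0 := norm1_ge0 f0.
suff [h2 h4] : 
     (norm_sup f * norm1 f `^ (P - 1)%R <=
        (BL2 w S p *
          (n`!%:R `^ (P - 1)%R / \prod_(j < m) (d' j)`!%:R `^ p j))%:E *
        \prod_(j < m) subspace_norm1 (orthogonal_complement (H j))
          (sup_projection (orthogonal_complement (H j)) f) `^ p j)%E /\
      (norm_sup f * norm1 f `^ (P - 1)%R <=
        (BL1 w S p *
          (n`!%:R `^ (P - 1)%R / \prod_(j < m) (d' j)`!%:R `^ p j))%:E *
        \prod_(j < m) subspace_norm1 (H' j) (sup_projection (H' j) f) `^ p j)%E.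
  split=> //; first exact: orthogonal_projection_inequality.
  exact: span_projection_inequality.
have w0 : 0 < wedge_norm w by rewrite wedge_norm_gt0// (basis_free wB).
have [Sfull|P1] := full_cover_or_gt1 Sp.
  have [h n1 w1] := full_cover_inequality Sp wB Sfull f0.
  have d'1 : \prod_(j < m) (d' j)`!%:R `^ p j = 1 :> R.
    by apply: big1 => j _; rewrite /d' /d Sfull cardsT card_ord subnn fact0 powR1.
  rewrite n1 d'1 divr1 !mulr1.
  have dH j : \dim (H j) = n by rewrite dim_subfamily// Sfull cardsT card_ord.
  have dH' j : \dim (H' j) = 0%N by rewrite dim_subfamily// Sfull finset.setCT cards0.
  split.
    rewrite (eq_bigr (fun j => norm_sup f `^ p j)%E); last first.
      move=> j _; rewrite sup_projection_point//; apply/eqP.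
      by rewrite -(eqn_add2l n) (dim_orthogonal_complement (dH j)) addn0.
    rewrite /BL2 (eq_bigr (fun j => wedge_norm w `^ p j)) => [|j _]; last first.
      by rewrite Sfull subfamily_full.
    have wP : wedge_norm w `^ P = wedge_norm w.
      rewrite -[in LHS](subrK 1 P) powRD; last by rewrite (gt_eqF w0) implybT.
      by rewrite w1 powRr1 ?mul1r// ltW.
    by rewrite -powR_sum// -/P wP divff ?gt_eqF// mul1e.
  rewrite (eq_bigr (fun j => norm_sup f `^ p j)%E); last first.
    by move=> j _; rewrite sup_projection_point.
  rewrite /BL1 w1 divr1 big1 ?mul1e// => j _.
  rewrite wedge_norm_subfamily// (_ : `|_| = 1) ?powR1//.
  have det0 k (A : 'M[R]_k) : k = 0%N -> `|\det A| = 1.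
    by move=> k0; subst k; rewrite det_mx00 normr1.
  by rewrite det0// Sfull finset.setCT cards0.
have P0 : 0 < P - 1 by rewrite subr_gt0.
have Sc := uniform_cover_complement Sp P1.
have frac0 : 0 <= n`!%:R / \prod_(j < m) (#|~: S j|)`!%:R `^ (p j / (P - 1)) :> R.
  by rewrite divr_ge0//; apply: prodr_ge0 => j _; exact: powR_ge0.
have BL1_ge0 A q : 0 <= BL1 w A q :> R.
  by rewrite divr_ge0 ?powR_ge0//; apply: prodr_ge0 => j _; exact: powR_ge0.
have BL2_ge0 A q : 0 <= BL2 w A q :> R.
  by rewrite divr_ge0 ?(ltW w0)//; apply: prodr_ge0 => j _; exact: powR_ge0.
split.
  rewrite -BL1_complement// -multinomial_complement// -powRM//.
  apply: poweR_rearrange => //; first exact: mulr_ge0.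
    by move=> j; exact: subspace_norm1_ge0.
  have := orthogonal_projection_inequality Sc wB lf.
  rewrite sum_complementary_weights//.
  by under [in X in (_ <= _ * X)%E -> _]eq_bigr do rewrite finset.setCK.
rewrite -BL2_complement// -multinomial_complement// -powRM//.
apply: poweR_rearrange => //; first exact: mulr_ge0.
  by move=> j; exact: subspace_norm1_ge0.
have := span_projection_inequality Sc wB lf.
by rewrite sum_complementary_weights.
Qed.
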